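(* Let $n\geq 1$ and $\lambda>0$. Let $\Sigma$ be a compact $C^2$ hypersurface in the Heisenberg group $\mathbb{H}_n$ whose p-normal vector $N$ is defined almost everywhere on $\Sigma$ (i.e. except on a set of zero p-area). For a nonsingular point $p$ of the Pansu sphere $\mathcal{P}^n_\lambda$ let $\tilde N(p)$ be the unit p-normal vector of $\mathcal{P}^n_\lambda$ at $p$, and let $$\mathcal{A}(\Sigma|\tilde N(p)^\perp)=\int_{q\in\Sigma}\big|L_{qp^{-1}*}\tilde N(p)\cdot N(q)\big|\,d\Sigma_q$$ be the projected p-area of $\Sigma$ onto the orthogonal complement of $\tilde N(p)$. Then the p-area of $\Sigma$ is $$\mathcal{A}(\Sigma)=\frac{1}{2C_n\,\omega_{2n-1}}\int_{p\in\mathcal{P}^n_\lambda}\mathcal{A}(\Sigma|\tilde N(p)^\perp)\,d\Sigma_p,\qquad C_n=\frac{\sqrt{\pi}}{\lambda^{2n+1}}\,\frac{\Gamma(n+\frac12)}{\Gamma(n+1)},$$ where $\omega_{2n-1}$ is the volume of the unit ball in $\mathbb{R}^{2n-1}$. Moreover, $$\mathcal{A}(\Sigma)=\frac{S_{2n-1}}{2\,\omega_{2n-1}\,\mathcal{A}(\mathcal{P}^n_\lambda)}\int_{p\in\mathcal{P}^n_\lambda}\mathcal{A}(\Sigma|\tilde N(p)^\perp)\,d\Sigma_p,$$ where $S_{2n-1}$ is the Euclidean surface area of the unit $(2n-1)$-sphere in $\mathbb{R}^{2n}$ and $\mathcal{A}(\mathcal{P}^n_\lambda)$ is the p-area of 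$\mathcal{P}^n_\lambda$.
   Context: The Heisenberg group $\mathbb{H}_n$ is $\mathbb{R}^{2n+1}$ with coordinates $(x_1,y_1,\dots,x_n,y_n,z)$ and group law given by left translation $L_{(x,y,z)}(x',y',z')=\big(x+x',\,y+y',\,z+z'+\sum_{i=1}^n(y_ix'_i-x_iy'_i)\big)$. For $p,q\in\mathbb{H}_n$, $L_{qp^{-1}}=L_q\circ L_{p^{-1}}$, and $L_{qp^{-1}*}$ is its pushforward (differential). The left-invariant vector fields $\mathring e_{x_j}=\partial_{x_j}+y_j\partial_z$, $\mathring e_{y_j}=\partial_{y_j}-x_j\partial_z$ ($1\le j\le n$) span the contact hyperplanes $\xi=\ker\big(dz+\sum_j(x_jdy_j-y_jdx_j)\big)$. The Levi metric, written $\cdot$, is the inner product on $\xi$ for which $\{\mathring e_{x_j},\mathring e_{y_j}\}$ is orthonormal. Let $\Sigma$ be a hypersurface. A point $p\in\Sigma$ is singular if $T_p\Sigma=\xi_p$, and nonsingular otherwise. At a nonsingular point the p-normal vector $N(p)\in\xi_p$ is the unit vector (unique up to sign) that is Levi-orthogonal to $T_p\Sigma\cap\xi_p$. The p-area element is $d\Sigma=\big(\sum_j\langle \mathring e_{x_j},\nu\rangle^2+\langle\mathring e_{y_j},\nu\rangle^2\big)^{1/2}d\sigma$, where $\nu$ is the Euclidean unit normal, $\langle\cdot,\cdot\rangle$ the Euclidean inner product and $d\sigma$ the Euclidean surface measure; it vanishes at singular points. For a graph $z=f(x,y)$ this reads $d\Sigma=D\,dx_1dy_1\cdots dx_ndy_n$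 with $D=\big[\sum_j (f_{x_j}-y_j)^2+(f_{y_j}+x_j)^2\big]^{1/2}$, and $N=\frac{-1}{D}\sum_j[(f_{x_j}-y_j)\mathring e_{x_j}+(f_{y_j}+x_j)\mathring e_{y_j}]$ up to sign. The p-area is $\mathcal{A}(\Sigma)=\int_\Sigma d\Sigma$. The Pansu sphere $\mathcal{P}^n_\lambda$ is the union of the graphs $z=f$ and $z=-f$ over $\{r\le 1/\lambda\}$, where $r=\sqrt{\sum_j(x_j^2+y_j^2)}$ and $f=\frac{1}{2\lambda^2}\big(\lambda r\sqrt{1-\lambda^2r^2}+\cos^{-1}(\lambda r)\big)$. Its only singular points are the two poles $(0,\dots,0,\pm\frac{\pi}{4\lambda^2})$. *)

(* Defs.v *)
From HB Require Import structures.
From mathcomp Require Import all_boot all_order all_algebra.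
From mathcomp Require Import all_classical all_reals all_analysis.

Set Implicit Arguments.
Unset Strict Implicit.
Unset Printing Implicit Defensive.

Import Order.TTheory GRing.Theory Num.Theory.
Import numFieldNormedType.Exports.

Local Open Scope classical_set_scope.
Local Open Scope ring_scope.

(** * Euclidean space ['rV[R]_k] *)

(* The Borel sigma-algebra. *)
HB.instance Definition _ (R : realType) (k : nat) :=
  @isMeasurable.Build (sigma_display (@open 'rV[R]_k)) 'rV[R]_k
    <<s @open 'rV[R]_k >>
    (@sigma_algebra0 _ setT _) (@sigma_algebraC _ _)
    (@sigma_algebra_bigcup _ setT _).

Section Euclidean.
Variable R : realType.

Definition edot k (u v : 'rV[R]_k) : R := \sum_(i < k) u 0 i * v 0 i.

(* The norm of the library on ['rV[R]_k] is the sup norm. *)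
Definition enorm k (u : 'rV[R]_k) : R := Num.sqrt (edot u u).

Definition unit_ball k : set 'rV[R]_k := [set u | enorm u <= 1].

(* The unit k-sphere in R^(k+1). *)
Definition unit_sphere k : set 'rV[R]_k.+1 := [set u | enorm u = 1].

Definition unit_cube k : set 'rV[R]_k := [set u | forall i, 0 <= u 0 i <= 1].

(* k-dimensional Lebesgue measure of Borel sets, as an iterated product
   measure: R^(k+1) = R x R^k, the volume of a set is the integral of the
   volumes of its slices. *)
Fixpoint volume k : set 'rV[R]_k -> \bar R :=
  match k return set 'rV[R]_k -> \bar R with
  | 0 => fun A => \d_(0 : 'rV[R]_0) A
  | k'.+1 => fun A => (\int[@lebesgue_measure R]_t
      volume [set u : 'rV[R]_k' | A (row_mx (t%:M : 'rV[R]_1) u)])%E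
  end.

(* Countable covers of [A] by sets of Euclidean diameter at most [delta];
   [d i] bounds the diameter of the [i]-th set. *)
Definition cover_diameters k (delta : R) (A : set 'rV[R]_k)
    : set (nat -> R) :=
  [set d | exists C : nat -> set 'rV[R]_k,
    [/\ A `<=` \bigcup_i C i,
        forall i, 0 <= d i <= delta &
        forall i u v, C i u -> C i v -> enorm (u - v) <= d i]].

Definition hausdorff_content (m k : nat) (delta : R) (A : set 'rV[R]_k)
    : \bar R :=
  ereal_inf [set (\sum_(0 <= i <oo) (d i ^+ m)%:E)%E
            | d in cover_diameters delta A].

(* Unnormalised m-dimensional Hausdorff (outer) measure on R^k, i.e. the
   limit of the contents as [delta] tends to 0 from above. *)
Definition hausdorff (m k : nat) (A : set 'rV[R]_k) : \bar R :=
  ereal_sup [set hausdorff_content m delta A | delta in [set e : R | 0 < e]].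

(* Euclidean surface measure: the m-dimensional Hausdorff measure,
   normalised so that a unit m-cube has area 1, that is, so that it agrees
   with Lebesgue measure on R^m.  It is a measure on the Borel sets of R^k. *)
Definition surface_measure (m k : nat) (A : set 'rV[R]_k) : \bar R :=
  ((fine (hausdorff m (@unit_cube m)))^-1%:E * hausdorff m A)%E.

Fixpoint Ck_on (r m : nat) (V : set 'rV[R]_m) (g : 'rV[R]_m -> R) : Prop :=
  {in V, continuous g} /\
  match r with
  | 0 => True
  | r'.+1 => forall i : 'I_m,
      (forall u, V u -> derivable g u (delta_mx 0 i)) /\
      Ck_on r' V ('D_(delta_mx 0 i) g)
  end.

(* Embedded hypersurface without boundary of class C^2: locally the graph of
   a C^2 function of all the coordinates but one.  [col' i q] is [q] with its
   [i]-th coordinate removed. *)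
Definition C2_hypersurface m (S : set 'rV[R]_m.+1) : Prop :=
  forall p, S p ->
  exists (i : 'I_m.+1) (U : set 'rV[R]_m.+1) (V : set 'rV[R]_m)
         (g : 'rV[R]_m -> R),
    [/\ open U, U p, open V, Ck_on 2 V g &
        S `&` U = [set q | V (col' i q) /\ q 0 i = g (col' i q)]].

(* Tangent space, as the set of velocities of curves in S issued from p. *)
Definition tangent k (S : set 'rV[R]_k) (p : 'rV[R]_k) : set 'rV[R]_k :=
  [set v | exists gamma : R -> 'rV[R]_k,
    [/\ gamma 0 = p, \forall t \near (0 : R), S (gamma t) &
        is_derive (0 : R) 1 gamma v]].

(* A Euclidean unit normal; only its line is determined, the sign is an
   arbitrary choice. *)
Definition unit_normal k (S : set 'rV[R]_k) (p : 'rV[R]_k) : 'rV[R]_k :=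
  xget 0 [set nu | enorm nu = 1 /\ forall v, tangent S p v -> edot nu v = 0].

(* Euler's Gamma function, for s > 0. *)
Definition Gamma (s : R) : R :=
  \int[@lebesgue_measure R]_(t in `]0, +oo[) (t `^ (s - 1) * expR (- t)).

End Euclidean.

(** * The Heisenberg group *)

Section Heisenberg.
Variables (R : realType) (n : nat).
Implicit Types (p q v w : 'rV[R]_(n + n).+1) (S D : set 'rV[R]_(n + n).+1).

(* The coordinates are listed in the order x_1, ..., x_n, y_1, ..., y_n, z. *)
Definition xi (j : 'I_n) : 'I_(n + n).+1 :=
  widen_ord (leqnSn _) (lshift n j).
Definition yi (j : 'I_n) : 'I_(n + n).+1 :=
  widen_ord (leqnSn _) (rshift n j).
Definition zi : 'I_(n + n).+1 := ord_max.

Definition left_translation p q : 'rV[R]_(n + n).+1 :=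
  p + q + (\sum_(j < n) (p 0 (yi j) * q 0 (xi j) - p 0 (xi j) * q 0 (yi j)))
            *: delta_mx 0 zi.

Definition hinv p : 'rV[R]_(n + n).+1 := - p.

Lemma left_translationV p : left_translation p (hinv p) = 0.
Proof.
rewrite /left_translation /hinv subrr add0r big1 ?scale0r// => j _.
by rewrite !mxE !mulrN opprK mulrC addNr.
Qed.

(* Differential at p of L_(q p^-1), which maps p to q. *)
Definition push p q v : 'rV[R]_(n + n).+1 :=
  'd (left_translation q \o left_translation (hinv p)) p v.

Definition eX (j : 'I_n) p : 'rV[R]_(n + n).+1 :=
  delta_mx 0 (xi j) + p 0 (yi j) *: delta_mx 0 zi.
Definition eY (j : 'I_n) p : 'rV[R]_(n + n).+1 :=
  delta_mx 0 (yi j) - p 0 (xi j) *: delta_mx 0 zi.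

(* The contact hyperplane at p, kernel of dz + sum_j (x_j dy_j - y_j dx_j). *)
Definition contact p : set 'rV[R]_(n + n).+1 :=
  [set v | v 0 zi + \sum_(j < n)
     (p 0 (xi j) * v 0 (yi j) - p 0 (yi j) * v 0 (xi j)) = 0].

(* The Levi metric on contact vectors: by [contact_frame] below, the entries
   of index [xi j] and [yi j] of a contact vector are its coordinates in the
   frame [eX], [eY], which is thus orthonormal. *)
Definition levi v w : R :=
  \sum_(j < n) (v 0 (xi j) * w 0 (xi j) + v 0 (yi j) * w 0 (yi j)).

Lemma contact_frame p v : contact p v ->
  v = \sum_(j < n) (v 0 (xi j) *: eX j p + v 0 (yi j) *: eY j p).
Proof.
move=> /= /eqP; rewrite addr_eq0 => /eqP vz.
have xiE (i j : 'I_n) : (xi i == xi j) = (i == j).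
  by rewrite -val_eqE/= val_eqE.
have yiE (i j : 'I_n) : (yi i == yi j) = (i == j).
  by rewrite -val_eqE/= eqn_add2l.
have xy (i j : 'I_n) : (xi i == yi j) = false.
  by rewrite -val_eqE/= ltn_eqF// ltn_addr.
have xz (j : 'I_n) : (xi j == zi) = false.
  by rewrite -val_eqE/= ltn_eqF// ltn_addr.
have yz (j : 'I_n) : (yi j == zi) = false.
  by rewrite -val_eqE/= ltn_eqF// ltn_add2l.
apply/rowP => i; rewrite summxE.
have [->|iz] := eqVneq i zi.
  rewrite vz -sumrN; apply: eq_bigr => j _.
  rewrite !mxE !eqxx/= 2!(eq_sym zi) xz yz/= mulr1n add0r sub0r !mulr1.
  by rewrite opprB mulrN (mulrC (v _ _)) (mulrC (v _ _)).
have iN : (i < n + n)%N.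
  by rewrite ltn_neqAle -ltnS ltn_ord andbT; apply: contraNneq iz => iE;
     apply/eqP/val_inj.
have [[j ->]|[j ->]] : (exists j, i = xi j) \/ (exists j, i = yi j).
  case: (split_ordP (Ordinal iN)) => j /(congr1 val)/= ij; [left|right];
    by exists j; apply/val_inj.
- rewrite (bigD1 j)//= big1 => [|k kj]; rewrite !mxE !xiE !xy xz !eqxx/=.
    by rewrite !(mulr1n, mulr0n, mulr0, oppr0, addr0, add0r, mulr1).
  by rewrite eq_sym (negbTE kj)/= !(mulr1n, mulr0n, mulr0, oppr0, addr0, add0r, mulr1).
- rewrite (bigD1 j)//= big1 => [|k kj];
    rewrite !mxE (eq_sym (yi j) (xi _)) !yiE !xy yz !eqxx/=.
    by rewrite !(mulr1n, mulr0n, mulr0, oppr0, addr0, add0r, mulr1).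
  by rewrite eq_sym (negbTE kj)/= !(mulr1n, mulr0n, mulr0, oppr0, addr0, add0r, mulr1).
Qed.

Definition singular S p : Prop := tangent S p = contact p.

(* The p-normal vector at a nonsingular point, up to the choice of a sign;
   its value is 0 where there is none. *)
Definition pnormal S p : 'rV[R]_(n + n).+1 :=
  xget 0 [set N | [/\ contact p N, levi N N = 1 &
    forall v, tangent S p v -> contact p v -> levi N v = 0]].

(* Density of the p-area element with respect to the Euclidean surface
   measure. *)
Definition parea_density S p : R :=
  Num.sqrt (\sum_(j < n) (edot (eX j p) (unit_normal S p) ^+ 2 +
                          edot (eY j p) (unit_normal S p) ^+ 2)).

(* Integral over D, a part of S, with respect to the p-area element of S. *)
Definition pintegral S D (F : 'rV[R]_(n + n).+1 -> \bar R) : \bar R :=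
  (\int[@surface_measure R (n + n) (n + n).+1]_(q in D)
     (F q * (parea_density S q)%:E))%E.

Definition parea S : \bar R := pintegral S S (cst 1%E).

(* Projected p-area of S onto the orthogonal complement of the vector v
   at p. *)
Definition projected_parea S p v : \bar R :=
  pintegral S S (fun q => `|levi (push p q v) (pnormal S q)|%:E).

Definition radius p : R :=
  Num.sqrt (\sum_(j < n) (p 0 (xi j) ^+ 2 + p 0 (yi j) ^+ 2)).

Definition pansu_profile (lambda r : R) : R :=
  (2 * lambda ^+ 2)^-1 *
  (lambda * r * Num.sqrt (1 - lambda ^+ 2 * r ^+ 2) + acos (lambda * r)).

Definition pansu (lambda : R) : set 'rV[R]_(n + n).+1 :=
  [set p | radius p <= lambda^-1 /\
     (p 0 zi = pansu_profile lambda (radius p) \/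
      p 0 zi = - pansu_profile lambda (radius p))].

Definition Cn (lambda : R) : R :=
  Num.sqrt pi / lambda ^+ (2 * n).+1 *
  (Gamma (n%:R + 2^-1) / Gamma (n%:R + 1)).

End Heisenberg.

(* Main.v *)
(* Left translations preserve the horizontal coordinates, so the Levi product of
   the translated normal of P at p with the normal of Sigma at q is a Euclidean
   product in R^(2n), and Tonelli reduces the double integral to the values
   I(w) = int_P |<N(p), w>| dA(p) at the horizontal covectors w of Sigma.

   Over an open hemisphere of P, the graph of a function of the radius r, the
   normal times the p-area density is the field (a(r) + J) X with J the complex
   structure of R^(2n).  Both the domain and the field are invariant under the
   unitary group, so I(w) = c |w|.  To find c, average over w in the unit ball:
   only the length |X| / sqrt(1 - lambda^2 r^2) of the field matters, and the
   field X / sqrt(1 - lambda^2 r^2) of the same length has for integral that of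
   |<q, w>| over a Euclidean hemisphere of radius 1 / lambda, which reflections
   reduce to the volume of its equatorial disc.  The same averaging over the unit
   sphere of R^(2n) gives S_(2n-1), and Gaussian integrals give the volumes of
   balls in terms of Gamma.

   The Hausdorff measure of a graph is computed by comparison with the graph of
   the differential: strict differentiability makes the two locally bi-Lipschitz
   with constant close to 1. *)

Require Import Defs.
From HB Require Import structures.
From mathcomp Require Import all_boot all_order all_algebra.
From mathcomp Require Import all_classical all_reals all_analysis.
From mathcomp Require Import measurable_realfun gauss_integral.
From mathcomp Require Import ring lra.

Set Implicit Arguments.
Unset Strict Implicit.
Unset Printing Implicit Defensive.

Import Order.TTheory GRing.Theory Num.Theory.
Import numFieldNormedType.Exports.

Local Open Scope classical_set_scope.
Local Open Scope ring_scope.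

(** * The Euclidean norm *)

(** Signs and singular points never need a discussion, because the p-normal and the p-area density
    are merged into one vector [hor q nu], the horizontal part of a Euclidean unit normal [nu]. Its
    length is the density and it is parallel to the coordinates of the p-normal, so |<w, N>| dSigma
    becomes |<w, hor q nu>| times the Euclidean measure, and this vanishes by itself where no
    p-normal exists. The obstacle to a direct computation is the twist J: reflections do not commute
    with it, and the unitary maps, which do, leave the constant undetermined. The constant is
    explicit because the slope of the Pansu profile gives the field exactly the length |X| times the
    area factor of a Euclidean hemisphere. The integrals of |w| and |w_1| over the unit ball, which
    averaging introduces, are never evaluated: they occur in the same ratio in S_(2n-1) and in the
    p-area of the Pansu sphere. Tonelli moreover needs a sigma-finite measure and a measurable
    normal on Sigma; both come from countably many charts. *)

Section euclidean_norm.
Variables (R : realType) (k : nat).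
Implicit Types u v w : 'rV[R]_k.

Lemma edotC u v : edot u v = edot v u.
Proof. by apply: eq_bigr => i _; rewrite mulrC. Qed.

Lemma edotDl u v w : edot (u + v) w = edot u w + edot v w.
Proof. by rewrite -big_split; apply: eq_bigr => i _; rewrite mxE mulrDl. Qed.

Lemma edotDr u v w : edot w (u + v) = edot w u + edot w v.
Proof. by rewrite edotC edotDl !(edotC w). Qed.

Lemma edotZl c u v : edot (c *: u) v = c * edot u v.
Proof. by rewrite mulr_sumr; apply: eq_bigr => i _; rewrite mxE mulrA. Qed.

Lemma edotZr c u v : edot v (c *: u) = c * edot v u.
Proof. by rewrite edotC edotZl edotC. Qed.

Lemma edotNl u v : edot (- u) v = - edot u v.
Proof. by rewrite -scaleN1r edotZl mulN1r. Qed.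

Lemma edotNr u v : edot v (- u) = - edot v u.
Proof. by rewrite edotC edotNl edotC. Qed.

Lemma edotBl u v w : edot (u - v) w = edot u w - edot v w.
Proof. by rewrite edotDl edotNl. Qed.

Lemma edotBr u v w : edot w (u - v) = edot w u - edot w v.
Proof. by rewrite edotDr edotNr. Qed.

Lemma edot0l u : edot 0 u = 0.
Proof. by rewrite /edot big1// => i _; rewrite mxE mul0r. Qed.

Lemma edot0r u : edot u 0 = 0. Proof. by rewrite edotC edot0l. Qed.

Lemma edot_ge0 u : 0 <= edot u u.
Proof. by apply: sumr_ge0 => i _; rewrite -expr2 sqr_ge0. Qed.

Lemma edot_delta u i : edot u (delta_mx 0 i) = u 0 i.
Proof.
rewrite /edot (bigD1 i)//= big1 => [|j ji]; rewrite !mxE !eqxx/= ?mulr1 ?addr0//.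
by rewrite (negbTE ji) mulr0n mulr0.
Qed.

Lemma enorm_ge0 u : 0 <= enorm u. Proof. exact: sqrtr_ge0. Qed.

Lemma sqr_enorm u : enorm u ^+ 2 = edot u u.
Proof. by rewrite sqr_sqrtr// edot_ge0. Qed.

Lemma enormZ c u : enorm (c *: u) = `|c| * enorm u.
Proof.
by rewrite /enorm edotZl edotZr mulrA -expr2 sqrtrM ?sqr_ge0// sqrtr_sqr.
Qed.

Lemma enorm0 : enorm (0 : 'rV[R]_k) = 0.
Proof. by rewrite /enorm edot0l sqrtr0. Qed.

Lemma enormN u : enorm (- u) = enorm u.
Proof. by rewrite -scaleN1r enormZ normrN1 mul1r. Qed.

Lemma enormBC u v : enorm (u - v) = enorm (v - u).
Proof. by rewrite -enormN opprB. Qed.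

Lemma coord_le_enorm u i : `|u 0 i| <= enorm u.
Proof.
rewrite -sqrtr_sqr ler_wsqrtr// /edot (bigD1 i)//= -expr2 lerDl.
by apply: sumr_ge0 => j _; rewrite -expr2 sqr_ge0.
Qed.

Lemma enorm_eq0 u : (enorm u == 0) = (u == 0).
Proof.
apply/eqP/eqP => [u0|->]; last exact: enorm0.
by apply/rowP => i; rewrite mxE; apply/normr0_eq0/le_anti;
   rewrite normr_ge0 andbT -u0 coord_le_enorm.
Qed.

Lemma enorm_gt0 u : (0 < enorm u) = (u != 0).
Proof. by rewrite lt_def enorm_ge0 andbT enorm_eq0. Qed.

Lemma cauchy_schwarz u v : `|edot u v| <= enorm u * enorm v.
Proof.
have [->|u0] := eqVneq u 0; first by rewrite edot0l normr0 enorm0 mul0r.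
have up : 0 < edot u u by rewrite -sqr_enorm exprn_gt0// enorm_gt0.
have := edot_ge0 (v - (edot u v / edot u u) *: u).
rewrite edotBl !edotBr !edotZl !edotZr (edotC v u) => le.
have {}le : edot u v ^+ 2 <= edot u u * edot v v.
  rewrite -ler_pdivrMl// -subr_ge0 (le_trans le)// le_eqVlt.
  by apply/orP; left; apply/eqP; field; rewrite gt_eqF.
by rewrite -sqrtr_sqr -sqrtrM ?edot_ge0// ler_wsqrtr.
Qed.

Lemma ler_enormD u v : enorm (u + v) <= enorm u + enorm v.
Proof.
rewrite -(@ler_pXn2r _ 2) ?nnegrE ?addr_ge0 ?enorm_ge0//.
rewrite sqr_enorm sqrrD !sqr_enorm edotDl !edotDr (edotC v u).
have := le_trans (ler_norm _) (cauchy_schwarz u v); lra.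
Qed.

Lemma ler_enormB u v w : enorm (u - w) <= enorm (u - v) + enorm (v - w).
Proof. by rewrite (le_trans _ (ler_enormD _ _))// addrA subrK. Qed.

Lemma ler_enorm_dist u v : enorm u - enorm v <= enorm (u - v).
Proof. by rewrite lerBlDr (le_trans _ (ler_enormD _ _))// subrK. Qed.

(** The constant [k] comes from bounding the Euclidean norm by the sum of the absolute values; it is
    not optimal, but every use only needs some finite constant. *)
Lemma enorm_le_sup u c : (forall i, `|u 0 i| <= c) -> enorm u <= k%:R * c.
Proof.
move=> uc; have sum_ge0 : 0 <= \sum_(i < k) `|u 0 i| by exact: sumr_ge0.
apply: (@le_trans _ _ (\sum_(i < k) `|u 0 i|)); last first.
  by apply: (le_trans (ler_sum _ (fun i _ => uc i)));
    rewrite sumr_const card_ord mulr_natl.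
rewrite -(@ler_pXn2r _ 2) ?nnegrE ?enorm_ge0// sqr_enorm expr2 mulr_suml.
apply: ler_sum => i _; rewrite (le_trans (ler_norm _))// normrM ler_wpM2l//.
by rewrite (bigD1 i)//= lerDl sumr_ge0.
Qed.

End euclidean_norm.

(** * Euclidean balls, Borel sets and measurable maps of R^k *)

Section euclidean_topology.
Variables (R : realType) (k : nat).
Implicit Types (u v : 'rV[R]_k) (A : set 'rV[R]_k).

Definition eball u (r : R) : set 'rV[R]_k := [set v | enorm (v - u) < r].

(** The topology of ['rV] is that of the sup norm, and the two norms differ at most by the factor
    [k]. Dividing the radius by [k.+1] keeps the inequality strict, and also covers [k = 0]. *)
Lemma nbhs_eball u A : nbhs u A <-> exists2 e, 0 < e & eball u e `<=` A.
Proof.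
split=> [/nbhs_ballP[e /= e0 eA]|[e e0 eA]].
  exists e => // v uv; apply: eA; split=> // i j; rewrite ord1 /ball/=.
  rewrite -(normrN (_ - _)) opprB (le_lt_trans _ uv)//.
  by have := coord_le_enorm (v - u) j; rewrite !mxE.
have e'0 : 0 < e / k.+1%:R by rewrite divr_gt0.
apply/nbhs_ballP; exists (e / k.+1%:R) => //= v [_ uv]; apply: eA.
have : enorm (v - u) <= k%:R * (e / k.+1%:R).
  apply: enorm_le_sup => i; have := uv 0 i; rewrite !mxE /ball/=.
  by rewrite -(normrN (_ - _)) opprB => /ltW.
move=> /le_lt_trans; apply; rewrite mulrCA gtr_pMr// ltr_pdivrMr// mul1r.
by rewrite ltr_nat.
Qed.

Lemma open_eball u r : open (eball u r).
Proof.
rewrite openE => v uv; apply/nbhs_eball; exists (r - enorm (v - u)).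
  by rewrite subr_gt0.
move=> w vw; rewrite /eball/= (le_lt_trans (ler_enormB _ v _))//.
by rewrite -ltrBrDr.
Qed.

Lemma eball_center u r : 0 < r -> eball u r u.
Proof. by rewrite /eball/= subrr enorm0. Qed.

Lemma open_eballP A :
  open A <-> forall u, A u -> exists2 e, 0 < e & eball u e `<=` A.
Proof.
by rewrite openE; split => [oA u /oA /nbhs_eball //|oA u /oA ?]; apply/nbhs_eball.
Qed.

Lemma open_nbhsW A : (forall u, A u -> nbhs u A) -> open A.
Proof. by rewrite openE. Qed.

Lemma continuous_eball (f : 'rV[R]_k -> R) u :
  (forall e, 0 < e -> exists2 eta, 0 < eta &
    forall v, eball u eta v -> `|f v - f u| <= e) -> {for u, continuous f}.
Proof.
move=> fu A /nbhs_ballP[e /= e0 eA]; have [eta eta0 uP] := fu (e / 2) (divr_gt0 e0 (ltr0Sn R 1)).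
apply/nbhs_eball; exists eta => // v /uP fv; apply: eA; rewrite /ball/= distrC.
by rewrite (le_lt_trans fv)// ltr_pdivrMr// ltr_pMr// ltr1n.
Qed.

Lemma measurable_open A : open A -> measurable A.
Proof. exact: sub_sigma_algebra. Qed.

Lemma measurable_closed A : closed A -> measurable A.
Proof.
by move=> cA; rewrite -(setCK A); apply: measurableC; apply: measurable_open; exact: closed_openC.
Qed.

Lemma measurable_eball u r : measurable (eball u r).
Proof. by apply: measurable_open; exact: open_eball. Qed.

Lemma continuous_measurable (D : set 'rV[R]_k) (f : 'rV[R]_k -> R) : open D ->
  {in D, continuous f} -> measurable_fun D f.
Proof.
move=> oD cf; apply: (measurability _ (RGenOpens.measurableE R)).
move=> _ [_ [a [b ->] <-]]; apply: measurable_open.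
apply: open_nbhsW => u [Du fu]; apply: filterI; first exact: open_nbhs_nbhs.
apply: cf; first by rewrite inE.
by apply: open_nbhs_nbhs; split => //; exact: interval_open.
Qed.

Lemma measurable_coord i : measurable_fun setT (fun u : 'rV[R]_k => u 0 i).
Proof.
apply: continuous_measurable; first exact: openT.
by move=> u _; exact: coord_continuous.
Qed.

Lemma measurable_coord_comp d (T : measurableType d) (D : set T)
    (f : T -> 'rV[R]_k) i :
  measurable_fun D f -> measurable_fun D (fun x => f x 0 i).
Proof. exact: (measurableT_comp (measurable_coord i)). Qed.

(* Every open set is a countable union of coordinate boxes with rational data. *)
Lemma measurable_fun_rV d (T : measurableType d) (D : set T)
    (f : T -> 'rV[R]_k) :
  (forall i, measurable_fun D (fun x => f x 0 i)) -> measurable_fun D f.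
Proof.
move=> mf mD; move: (mD); apply: (measurability (@open 'rV[R]_k) erefl).
move=> _ [A oA <-].
pose q (c : 'rV[rat]_k) : 'rV[R]_k := \row_i ratr (c 0 i).
pose B (x : 'rV[rat]_k * nat) := ball (q x.1) (x.2.+1%:R^-1 : R).
have -> : A = \bigcup_(n in setT) (if unpickle n is Some x then
    (if `[< B x `<=` A >] then B x else set0) else set0).
  apply/seteqP; split=> [u Au|u [n _]]; last first.
    by case: unpickle => // x; case: asboolP => // xA /xA.
  have /nbhs_ballP[e /= e0 eA] : nbhs u A by exact: open_nbhs_nbhs.
  have [n ne] : exists n : nat, n.+1%:R^-1 < e / 2.
    have /ltr_add_invr[n] : 0 < e / 2 by rewrite divr_gt0.
    by rewrite add0r => ne; exists n.
  have n0 : 0 < n.+1%:R^-1 :> R by rewrite invr_gt0.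
  have /choice[c cP] (i : 'I_k) : exists c : rat, `|u 0 i - ratr c| < n.+1%:R^-1.
    have /rat_in_itvoo[c] : u 0 i - n.+1%:R^-1 < u 0 i + n.+1%:R^-1.
      by rewrite ltrD2l gtrN.
    by rewrite in_itv/= => /andP[c1 c2]; exists c; rewrite distrC ltr_distl c1 c2.
  pose x := (\row_i c i, n).
  have uq : ball (q x.1) n.+1%:R^-1 u.
    by split => // i j; rewrite ord1 !mxE /ball/= distrC.
  exists (pickle x) => //=; rewrite pickleK.
  case: asboolP => // -[] v xv; apply: eA.
  have -> : e = e / 2 + e / 2 by rewrite -splitr.
  by apply: (ball_triangle (y := q x.1)); apply: le_ball (ltW ne) _ _ => //;
    exact: ball_sym.
rewrite preimage_bigcup setI_bigcupr; apply: bigcup_measurable => n _.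
case: unpickle => [x|]; last by rewrite preimage_set0 setI0.
case: ifP => _; last by rewrite preimage_set0 setI0.
have -> : D `&` f @^-1` B x =
    \bigcap_(i in [set: 'I_k]) (D `&` (fun t => f t 0 i) @^-1`
        [set r | `|q x.1 0 i - r| < x.2.+1%:R^-1]) `&` D.
  apply/seteqP; split=> [t [Dt [_ ft]]|t [ft Dt]].
    by split=> // i _; split => //=; exact: ft.
  by split => //; split=> [|i j]; [rewrite invr_gt0|rewrite ord1; case: (ft j)].
apply: measurableI => //; apply: fin_bigcap_measurable => // i _.
apply: mf => //.
exact: (measurable_ball (q x.1 0 i)).
Qed.

Lemma measurable_edot d (T : measurableType d) (D : set T)
    (f g : T -> 'rV[R]_k) :
  measurable_fun D f -> measurable_fun D g ->
  measurable_fun D (fun x => edot (f x) (g x)).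
Proof.
move=> mf mg; apply: measurable_sum => i.
by apply: measurable_funM; exact: measurable_coord_comp.
Qed.

Lemma measurable_enorm d (T : measurableType d) (D : set T)
    (f : T -> 'rV[R]_k) :
  measurable_fun D f -> measurable_fun D (fun x => enorm (f x)).
Proof.
move=> mf; have msqrt : measurable_fun [set: R] (@Num.sqrt R).
  by apply: continuous_measurable_fun; exact: sqrt_continuous.
by apply: (measurableT_comp msqrt); exact: measurable_edot.
Qed.

Lemma measurable_addrV d (T : measurableType d) (D : set T)
    (f g : T -> 'rV[R]_k) :
  measurable_fun D f -> measurable_fun D g -> measurable_fun D (fun x => f x + g x).
Proof.
move=> mf mg; apply: measurable_fun_rV => i; under eq_fun do rewrite mxE.
by apply: measurable_funD; exact: measurable_coord_comp.
Qed.

Lemma measurable_scalerV d (T : measurableType d) (D : set T)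
    (c : T -> R) (f : T -> 'rV[R]_k) :
  measurable_fun D c -> measurable_fun D f ->
  measurable_fun D (fun x => c x *: f x).
Proof.
move=> mf mg; apply: measurable_fun_rV => i; under eq_fun do rewrite mxE.
by apply: measurable_funM => //; exact: measurable_coord_comp.
Qed.

End euclidean_topology.

(** Serves to merge countably many countable covers into a single one. *)
Lemma nneseries_pair (R : realType) (g : nat -> nat -> \bar R)
    (f : nat -> nat * nat) : (forall i j, 0 <= g i j)%E ->
  set_bij setT setT f ->
  (\sum_(i <oo) g (f i).1 (f i).2 = \sum_(i <oo) \sum_(j <oo) g i j)%E.
Proof.
move=> g0 bf.
rewrite nneseries_esum//.
under [RHS]eq_eseriesr do rewrite nneseries_esum//.
rewrite nneseries_esum; last by move=> i _; exact: esum_ge0.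
rewrite esum_esum//.
rewrite (reindex_esum setT _ f) ?[fun=> _]set_true//.
rewrite (_ : [set: nat] `*`` _ = setT)//.
by apply/seteqP; split => // -[].
Qed.

Lemma nat_pair_bij : exists f : nat -> nat * nat, set_bij setT setT f.
Proof.
have /card_esym/card_set_bijP[f fP] := card_nat2.
by exists f.
Qed.

(** * Hausdorff measure *)

Section hausdorff_content.
Variables (R : realType) (m k : nat).
Implicit Types (A B : set 'rV[R]_k) (d : nat -> R).
Local Open Scope ereal_scope.
Local Notation content := (@hausdorff_content R m.+1 k).
Local Notation H := (@hausdorff R m.+1 k).

Lemma content_le delta A d : cover_diameters delta A d ->
  content delta A <= \sum_(0 <= i <oo) (d i ^+ m.+1)%:E.
Proof. by move=> dA; apply: ereal_inf_lbound; exists d. Qed.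

Lemma exprd_ge0 delta A d : cover_diameters delta A d ->
  forall i, 0 <= (d i ^+ m.+1)%:E.
Proof.
by move=> [C [_ dP _]] i; rewrite lee_fin exprn_ge0//; case/andP: (dP i).
Qed.

Lemma content_ge0 delta A : 0 <= content delta A.
Proof.
apply: le_ereal_inf_tmp => _ [d dA <-].
by apply: nneseries_ge0 => i _ _; exact: (exprd_ge0 dA).
Qed.

Lemma content_le_hausdorff delta A : (0 < delta)%R -> content delta A <= H A.
Proof. by move=> d0; apply: ereal_sup_ubound; exists delta. Qed.

Lemma hausdorff_ge0 A : 0 <= H A.
Proof. by rewrite (le_trans _ (content_le_hausdorff A ltr01))// content_ge0. Qed.

Lemma le_content delta A B : A `<=` B -> content delta A <= content delta B.
Proof.
move=> AB; apply: ereal_inf_le_tmp => _ [d [C [BC dP CP]] <-].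
by exists d => //; exists C; split => // x /AB/BC.
Qed.

Lemma le_hausdorff A B : A `<=` B -> H A <= H B.
Proof.
move=> AB; apply: ge_ereal_sup => _ [delta d0 <-].
by rewrite (le_trans (le_content _ AB))// content_le_hausdorff.
Qed.

Lemma content_anti delta delta' A : (delta <= delta')%R ->
  content delta' A <= content delta A.
Proof.
move=> dd'; apply: ereal_inf_le_tmp => _ [d [C [BC dP CP]] <-].
exists d => //; exists C; split => // i.
by case/andP: (dP i) => -> /= /le_trans; apply.
Qed.

Lemma hausdorff0 : H set0 = 0.
Proof.
apply/eqP; rewrite eq_le hausdorff_ge0 andbT; apply: ge_ereal_sup => _ [delta d0 <-].
have : cover_diameters delta (@set0 'rV[R]_k) (fun=> 0%R).
  by exists (fun=> set0); split => // i; rewrite lexx ltW.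
by move/content_le/le_trans; apply; rewrite eseries0// => i _ _; rewrite expr0n.
Qed.

(** Covers of the [A n] that exceed [H (A n)] by at most [e / 2 ^ n.+1] are merged along a bijection
    of [nat] with the pairs. An infinite [H (A i)] is set aside first, since such covers exist only
    for finite values. *)
Lemma hausdorff_sigma_subadditive : sigma_subadditive H.
Proof.
move=> A; have [[i ioo]|] := pselect (exists i, H (A i) = +oo).
  by rewrite (nneseries_pinfty _ _ ioo) ?leey// => n _; exact: hausdorff_ge0.
rewrite -forallNE => Aoo; apply: ge_ereal_sup => _ [delta d0 <-].
apply/lee_addgt0Pr => e e0.
rewrite (le_trans _ (epsilon_trick _ _ (ltW e0)))//; last first.
  by move=> n; exact: hausdorff_ge0.
have /choice[d dP] (n : nat) : exists d, cover_diameters delta (A n) d /\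
    \sum_(k <oo) (d k ^+ m.+1)%:E <= H (A n) + (e / (2 ^ n.+1)%:R)%:E.
  have : content delta (A n) < H (A n) + (e / (2 ^ n.+1)%:R)%:E.
    rewrite (le_lt_trans (content_le_hausdorff _ d0))// lteDl ?lte_fin ?divr_gt0//.
    by rewrite ge0_fin_numE ?hausdorff_ge0// ltey; apply/eqP/Aoo.
  by move=> /ereal_inf_lt[_ [d dA <-] /ltW ?]; exists d.
have [f bf] := nat_pair_bij.
apply: (@le_trans _ _ (\sum_(i <oo) (d (f i).1 (f i).2 ^+ m.+1)%:E)); last first.
  rewrite (nneseries_pair (g := fun i j => (d i j ^+ m.+1)%:E)) //; last first.
    by move=> i j; exact: (exprd_ge0 (dP i).1).
  apply: lee_nneseries => [i _ _|i _]; last exact: (dP i).2.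
  by apply: nneseries_ge0 => j _ _; exact: (exprd_ge0 (dP i).1).
apply: content_le.
have /choice[C CP] := fun n => (dP n).1.
exists (fun i => C (f i).1 (f i).2); split => [u [n _]|i|i].
- have [sC _ _] := CP n; move=> /sC[j _ Cu].
  have [_ _ /(_ (n, j) I)[i _ fi]] := bf.
  by exists i => //; rewrite fi.
- by have [_ + _] := CP (f i).1; exact.
- by have [_ _] := CP (f i).1; exact.
Qed.

End hausdorff_content.

Section hausdorff_outer_measure.
Variables (R : realType) (m k : nat).
Local Open Scope ereal_scope.

(* Replaces the degenerate case [m = 0], where [hausdorff 0] is not an outer
   measure: it is infinite on [set0]. *)
Definition houter : set 'rV[R]_k -> \bar R :=
  if m is m'.+1 then @hausdorff R m'.+1 k else fun=> 0.

Lemma houter0 : houter set0 = 0.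
Proof. by rewrite /houter; case: m => // m'; exact: hausdorff0. Qed.

Lemma houter_ge0 A : 0 <= houter A.
Proof. by rewrite /houter; case: m => // m'; exact: hausdorff_ge0. Qed.

Lemma le_houter : {homo houter : A B / A `<=` B >-> A <= B}.
Proof. by rewrite /houter; case: m => // m' A B; exact: le_hausdorff. Qed.

Lemma houter_sigma_subadditive : sigma_subadditive houter.
Proof.
rewrite /houter; case: m => [F|m']; last exact: hausdorff_sigma_subadditive.
by rewrite eseries0.
Qed.

HB.instance Definition _ := isOuterMeasure.Build R 'rV[R]_k houter
  houter0 houter_ge0 le_houter houter_sigma_subadditive.

End hausdorff_outer_measure.

Section hausdorff_lipschitz.
Variables (R : realType) (m k l : nat).
Local Open Scope ereal_scope.

(** A cover [C] of the [h]-image yields the cover of the [f]-image by the sets [f (A & h^-1 (C i))],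
    with diameters multiplied by [L]; hence the scale [delta / L]. Using two maps from a common
    source avoids naming the Lipschitz map between the images, and covers isometries, projections
    and graphs alike. *)
Lemma houter_lipschitz (T : Type) (A : set T) (f : T -> 'rV[R]_k)
    (h : T -> 'rV[R]_l) (L : R) : (0 < L)%R ->
  (forall x y, A x -> A y -> (enorm (f x - f y) <= L * enorm (h x - h y))%R) ->
  houter m (f @` A) <= (L ^+ m)%:E * houter m (h @` A).
Proof.
rewrite /houter; case: m => [|m'] L0 fh; first by rewrite mule0.
apply: ge_ereal_sup => _ [delta d0 <-].
have dL0 : (0 < delta / L)%R by rewrite divr_gt0.
have Lm0 : (0 < L ^+ m'.+1)%R by rewrite exprn_gt0.
apply: (@le_trans _ _ ((L ^+ m'.+1)%:E * hausdorff_content m'.+1 (delta / L) (h @` A)));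
  last by rewrite lee_pmul2l// content_le_hausdorff.
rewrite -lee_pdivrMl//; apply: le_ereal_inf_tmp => _ [d [C [AC dP CP]] <-].
rewrite lee_pdivrMl// -nneseriesZl; last first.
  by move=> i _; rewrite lee_fin exprn_ge0//; case/andP: (dP i).
under eq_eseriesr do rewrite -EFinM -exprMn.
apply: content_le; exists (fun i => f @` (A `&` h @^-1` C i)); split.
- move=> _ [x Ax <-]; have [i _ Ci] := AC _ (imageP h Ax).
  by exists i => //; exists x.
- move=> i; have /andP[di0 di] := dP i.
  by rewrite mulr_ge0 ?(ltW L0)//= mulrC -ler_pdivlMr.
- move=> i _ _ [x [Ax Cx] <-] [y [Ay Cy] <-].
  by rewrite (le_trans (fh _ _ Ax Ay))// ler_pM2l// CP.
Qed.

End hausdorff_lipschitz.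

Section hausdorff_metric.
Variables (R : realType) (m k : nat).
Local Open Scope ereal_scope.
Implicit Types A B : set 'rV[R]_k.

(** Below the scale [eta] no set of a cover meets both [A] and [B], so every cover of the union
    splits into a cover of [A] and a cover of [B]. *)
Lemma houter_separated A B (eta : R) : (0 < eta)%R ->
  (forall u v, A u -> B v -> (eta <= enorm (u - v))%R) ->
  houter m A + houter m B <= houter m (A `|` B).
Proof.
rewrite /houter; case: m => [|m'] eta0 AB; first by rewrite adde0.
have key delta : (0 < delta < eta)%R ->
    hausdorff_content m'.+1 delta A + hausdorff_content m'.+1 delta B <=
    hausdorff m'.+1 (A `|` B).
  move=> /andP[d0 deta]; apply: le_trans (content_le_hausdorff _ _ d0).
  apply: le_ereal_inf_tmp => _ [d [C [ABC dP CP]] <-].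
  (* Sets that miss [X] are replaced by the empty set, of diameter 0; they cost nothing since the
     exponent [m'.+1] is positive. *)
  pose d' X i := if `[< C i `&` X !=set0 >] then d i else 0%R.
  have d'P X : X `<=` A `|` B -> cover_diameters delta X (d' X).
    move=> XAB; exists (fun i => C i `&` X); split => [u Xu|i|i u v [Cu Xu] [Cv Xv]].
    - by have [i _ Ci] := ABC _ (XAB _ Xu); exists i.
    - by rewrite /d'; case: ifP => // _; rewrite lexx ltW.
    - by rewrite /d' ifT ?CP//; apply/asboolP; exists u.
  apply: (le_trans (leeD (content_le m' (d'P A _)) (content_le m' (d'P B _)))).
  - exact: subsetUl.
  - exact: subsetUr.
  have d0' X i : 0 <= (d' X i ^+ m'.+1)%:E.
    by rewrite lee_fin exprn_ge0// /d'; case: ifP => // _; case/andP: (dP i).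
  rewrite -nneseriesD => [|i _ _|i _ _]; [|exact: d0'|exact: d0'].
  apply: lee_nneseries => [i _ _|i _]; first by rewrite adde_ge0.
  rewrite /d'; case: asboolP => [[u [Cu Au]]|_]; last first.
    rewrite expr0n add0e; case: ifP => // _; rewrite expr0n lee_fin exprn_ge0//.
    by case/andP: (dP i).
  case: asboolP => [[v [Cv Bv]]|_]; last by rewrite expr0n adde0.
  have := AB _ _ Au Bv; rewrite leNgt (le_lt_trans (CP _ _ _ Cu Cv))//.
  by case/andP: (dP i) => _ /le_lt_trans; apply.
have [->|ABoo] := eqVneq (hausdorff m'.+1 (A `|` B)) +oo; first exact: leey.
have ABfin X : X `<=` A `|` B -> hausdorff m'.+1 X \is a fin_num.
  move=> XAB; rewrite ge0_fin_numE ?hausdorff_ge0//.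
  by rewrite (le_lt_trans (le_hausdorff _ XAB))// ltey.
have Afin := ABfin A (@subsetUl _ _ _); have Bfin := ABfin B (@subsetUr _ _ _).
rewrite -leeBrDr//; apply: ge_ereal_sup => _ [d1 d10 <-].
rewrite leeBrDr// addeC -leeBrDr; last first.
  rewrite ge0_fin_numE ?content_ge0// (le_lt_trans (content_le_hausdorff _ _ d10))//.
  by rewrite -ge0_fin_numE ?hausdorff_ge0.
apply: ge_ereal_sup => _ [d2 d20 <-].
rewrite leeBrDr; last first.
  rewrite ge0_fin_numE ?content_ge0// (le_lt_trans (content_le_hausdorff _ _ d10))//.
  by rewrite -ge0_fin_numE ?hausdorff_ge0.
(* The contents only grow when the scale shrinks, so one scale below [d1], [d2] and [eta] serves
   both suprema. *)
pose delta : R := (Num.min (eta / 2) (Num.min d1 d2))%R.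
rewrite addeC (le_trans _ (key delta _))//; last first.
  by rewrite /delta lt_min divr_gt0// lt_min d10 d20/= gt_min ltr_pdivrMr//
     ltr_pMr// ltr1n.
by apply: leeD; apply: content_anti; rewrite /delta !ge_min lexx ?orbT.
Qed.

End hausdorff_metric.

(** * Borel sets are Caratheodory measurable *)

Section caratheodory_hausdorff.
Variables (R : realType) (m k : nat).
Local Open Scope ereal_scope.
Local Notation H := (@houter R m k).

(** Caratheodory's criterion for metric outer measures. The half-space is exhausted by the sets
    [A n], which are at positive distance from its complement; what is lost lies in the rings
    between consecutive levels [s n], and the measures of these rings form a convergent series. *)
Lemma houter_coord_caratheodory (i : 'I_k) (c : R) :
  H.-caratheodory [set u | (u 0 i < c)%R].
Proof.
set E := (X in _ X); apply: le_caratheodory_measurable => X.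
have [XE|Xoo] := eqVneq (H X) +oo.
  by apply: (le_trans (leey _)); rewrite -XE.
have gap (A B : set 'rV[R]_k) (a b : R) : (a < b)%R ->
    (forall u, A u -> (u 0 i <= a)%R) -> (forall u, B u -> (b <= u 0 i)%R) ->
    H A + H B <= H (A `|` B).
  move=> ab Aa Bb; apply: (@houter_separated _ _ _ _ _ (b - a)); first by rewrite subr_gt0.
  move=> u v Au Bv; rewrite enormBC (le_trans _ (coord_le_enorm _ i))// !mxE.
  by rewrite (le_trans _ (ler_norm _))// lerB ?Aa ?Bb.
pose s n : R := (c - n.+1%:R^-1)%R.
have ss n p : (n < p)%N -> (s n < s p)%R.
  by move=> np; rewrite ltrD2l ltrN2 ltf_pV2 ?posrE// ltr_nat ltnS.
pose A n := X `&` [set u | (u 0 i <= s n)%R].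
pose ring n := X `&` [set u | (s n < u 0 i <= s n.+1)%R].
have split_X n : H (A n) + H (X `&` ~` E) <= H X.
  apply: (le_trans (gap _ _ (s n) c _ _ _)).
  - by rewrite gtrDl oppr_lt0 invr_gt0.
  - by move=> u [].
  - by move=> u [_ /negP]; rewrite -leNgt.
  - by apply: le_outer_measure; rewrite subUset; split => u [].
(* Two rings of the same parity are separated by a ring of the other parity, so their measures add
   up to at most that of [X]; [b] is 0 or 1 and selects the parity. Both parities together bound the
   whole series by twice [H X]. *)
have rings (b : nat) N : \sum_(0 <= j < N) H (ring (b + j.*2)%N) <= H X.
  apply: (@le_trans _ _ (H (\bigcup_(j in `I_N) ring (b + j.*2)%N))); last first.
    by apply: le_outer_measure => u [j _ []].
  elim: N => [|N IHN]; first by rewrite big_geq// outer_measure_ge0.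
  rewrite big_nat_recr//= (le_trans (leeD2r _ IHN))//.
  have -> : \bigcup_(j in `I_N.+1) ring (b + j.*2)%N =
            \bigcup_(j in `I_N) ring (b + j.*2)%N `|` ring (b + N.*2)%N.
    by rewrite IIS bigcup_setU bigcup_set1.
  case: N {IHN} => [|N].
    by rewrite II0 bigcup_set0 set0U outer_measure0 add0e.
  set mid := (s (b + N.+1.*2)%N + s (b + N.+1.*2).+1)%R.
  apply: (gap _ _ (s (b + N.*2).+1) (s (b + N.+1.*2)%N)).
  - by apply: ss; rewrite doubleS !addnS.
  - move=> u [j /=]; rewrite ltnS => jN [_ /andP[_ /le_trans]]; apply.
    have [->//|jN'] := eqVneq j N.
    by apply/ltW/ss; rewrite ltnS ltn_add2l ltn_double ltn_neqAle jN'.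
  - by move=> u [_ /andP[/ltW]].
have ring_ge0 n : 0 <= H (ring n) by exact: outer_measure_ge0.
have ring_sum : \sum_(0 <= n <oo) H (ring n) < +oo.
  have XX : H X + H X < +oo by rewrite lte_add_pinfty// ltey.
  apply: le_lt_trans XX; apply: lime_le; first exact: is_cvg_nneseries.
  apply: nearW => N; apply: (@le_trans _ _ (\sum_(0 <= n < N.*2) H (ring n))).
    by apply: lee_sum_nneg_natr => //; rewrite -addnn leq_addr.
  have -> : \sum_(0 <= n < N.*2) H (ring n) =
    \sum_(0 <= j < N) H (ring (0 + j.*2)%N) + \sum_(0 <= j < N) H (ring (1 + j.*2)%N).
    elim: N => [|N IHN]; first by rewrite !big_geq// adde0.
    by rewrite doubleS !big_nat_recr//= IHN add0n add1n -!addeA; congr (_ + _);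
       rewrite addeCA.
  by rewrite leeD.
(* The excess is the tail of a convergent series, and tends to 0 with [n]. *)
have tail n : H (X `&` E) + H (X `&` ~` E) <= H X + \sum_(n <= j <oo) H (ring j).
  apply: (@le_trans _ _ (H (A n) + \sum_(n <= j <oo) H (ring j) + H (X `&` ~` E))).
    rewrite leeD2r//.
    have XE : X `&` E `<=` A n `|` \bigcup_(j in ~` `I_n) ring j.
      move=> u [Xu Eu].
      have [un|un] := leP (u 0 i)%R (s n); [by left|right].
      have ex : exists j, (u 0 i <= s j.+1)%R.
        have /ltr_add_invr[j uj] : (u 0 i < c)%R by [].
        exists j; rewrite (le_trans (y := c - j.+1%:R^-1)%R)//.
          by rewrite lerBrDr ltW.
        exact/ltW/ss.
      case: (ex_minnP ex) => j uj jmin; exists j.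
        apply/negP; rewrite -leqNgt.
        rewrite leqNgt; apply/negP => jn; move: un; rewrite ltNge => /negP; apply.
        move: jn; rewrite leq_eqVlt => /orP[/eqP <-//|/ss/ltW]; exact: le_trans.
      split => //=; rewrite uj andbT; case: j uj jmin => [|j] uj jmin.
        case: n un {jmin} => // n; apply: le_lt_trans; exact/ltW/ss.
      by rewrite ltNge; apply/negP => /jmin; rewrite ltnn.
    apply: (le_trans (le_outer_measure _ _ _ XE)).
    rewrite (le_trans (outer_measureU2 _ _ _))// leeD2l//.
    exact: outer_measure_sigma_subadditive_tail.
  by rewrite addeAC leeD2r.
apply/lee_addgt0Pr => e e0; apply/negP => /negP; rewrite -ltNge => lt.
have lim0 : \sum_(N <= j <oo) H (ring j) @[N --> \oo] --> 0.
  exact: nneseries_tail_cvg.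
suff : e%:E <= 0 by rewrite lee_fin leNgt e0.
rewrite -(cvg_lim _ lim0)//; apply: lime_ge; first by apply/cvg_ex; exists 0.
apply: nearW => n; have := lt_le_trans lt (tail n).
rewrite lteD2lE; first exact: ltW.
by rewrite ge0_fin_numE ?outer_measure_ge0// ltey.
Qed.

(** The identity from the Caratheodory sigma-algebra to the Borel one is measurable as soon as its
    coordinates are, so half-spaces suffice. *)
Lemma borel_caratheodory (A : set 'rV[R]_k) : measurable A -> H.-caratheodory A.
Proof.
pose id' : caratheodory_type H -> 'rV[R]_k := id.
suff mid : measurable_fun setT id'.
  by move=> mA; have := mid measurableT A mA; rewrite setTI.
apply: measurable_fun_rV => i; apply: (measurability _ (RGenInftyO.measurableE R)).
move=> _ [_ [c ->] <-]; rewrite setTI.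
have -> : (fun x : caratheodory_type H => (id' x 0 i)%R) @^-1` `]-oo, c[ =
    [set u | (u 0 i < c)%R] by apply/seteqP; split => u; rewrite /= in_itv.
exact: houter_coord_caratheodory.
Qed.

End caratheodory_hausdorff.

Section surface_measure.
Variables (R : realType) (m k : nat).
Local Open Scope ereal_scope.

(** The variant of [surface_measure] built on [houter], so that it is a measure for every [m]; the
    two agree for [m > 0] by [hmeasureE]. *)
Definition hmeasure (A : set 'rV[R]_k) : \bar R :=
  (fine (hausdorff m (@unit_cube R m)))^-1%:E * houter m A.

Lemma hcst_ge0 : (0 <= (fine (hausdorff m (@unit_cube R m)))^-1)%R.
Proof.
rewrite invr_ge0 fine_ge0//; case: m => [|m']; last exact: hausdorff_ge0.
apply: le_ereal_sup_tmp; eexists; first by exists 1%R; [exact: ltr01|reflexivity].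
apply: le_ereal_inf_tmp => _ [d _ <-].
by apply: nneseries_ge0 => i _ _; rewrite lee_fin expr0.
Qed.

Lemma hmeasure0 : hmeasure set0 = 0.
Proof. by rewrite /hmeasure houter0 mule0. Qed.

Lemma hmeasure_ge0 A : 0 <= hmeasure A.
Proof. by rewrite mule_ge0 ?houter_ge0// lee_fin hcst_ge0. Qed.

Lemma hmeasure_semi_sigma_additive : semi_sigma_additive hmeasure.
Proof.
move=> F mF tF mUF; rewrite /hmeasure.
have sumE n : \sum_(0 <= i < n) ((fine (hausdorff m (@unit_cube R m)))^-1%:E *
    houter m (F i)) = (fine (hausdorff m (@unit_cube R m)))^-1%:E *
    \sum_(0 <= i < n) houter m (F i).
  by rewrite ge0_sume_distrr// => i _; exact: houter_ge0.
under eq_fun do rewrite sumE.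
apply: cvgeZl => //.
have := @caratheodory_measure_sigma_additive _ _ (@houter R m k) F.
apply => //; [move=> i; exact: borel_caratheodory|exact: borel_caratheodory].
Qed.

HB.instance Definition _ := isMeasure.Build _ 'rV[R]_k R hmeasure
  hmeasure0 hmeasure_ge0 hmeasure_semi_sigma_additive.

Lemma hmeasureE : (0 < m)%N -> hmeasure = @surface_measure R m k.
Proof. by rewrite /hmeasure /surface_measure /houter; case: m. Qed.

End surface_measure.

(** * Lebesgue measure *)

Section cons_vector.
Variables (R : realType) (k : nat).

Definition consv (x : measurableTypeR R * 'rV[R]_k) : 'rV[R]_k.+1 :=
  row_mx (x.1%:M : 'rV[R]_1) x.2.
Definition tailv (u : 'rV[R]_k.+1) : 'rV[R]_k := \row_i u 0 (lift ord0 i).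
Definition uncons (u : 'rV[R]_k.+1) : measurableTypeR R * 'rV[R]_k :=
  (u 0 ord0, tailv u).

Lemma consv_head x : consv x 0 ord0 = x.1.
Proof.
have := row_mxEl (x.1%:M : 'rV[R]_1) x.2 0 ord0; rewrite [RHS]mxE eqxx mulr1n => <-.
by congr (fun_of_matrix _ _ _); exact/val_inj.
Qed.

Lemma consv_tail x i : consv x 0 (lift ord0 i) = x.2 0 i.
Proof.
rewrite -(row_mxEr (x.1%:M : 'rV[R]_1) x.2 0 i).
by congr (fun_of_matrix _ _ _); exact/val_inj.
Qed.

Lemma consvK : cancel consv uncons.
Proof.
move=> [t u]; rewrite /uncons consv_head; congr pair.
by apply/rowP => i; rewrite mxE consv_tail.
Qed.

Lemma unconsK : cancel uncons consv.
Proof.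
move=> u; apply/rowP => i; have [j ->|->] := unliftP ord0 i.
  by rewrite consv_tail mxE.
by rewrite consv_head.
Qed.

Lemma edot_consv x y : edot (consv x) (consv y) = x.1 * y.1 + edot x.2 y.2.
Proof.
rewrite /edot big_ord_recl !consv_head; congr (_ + _).
by apply: eq_bigr => i _; rewrite !consv_tail.
Qed.

Lemma measurable_consv : measurable_fun setT consv.
Proof.
apply: measurable_fun_rV => i; have [j ->|->] := unliftP ord0 i.
  under eq_fun do rewrite consv_tail.
  by apply: measurable_coord_comp; exact: measurable_snd.
by under eq_fun do rewrite consv_head; exact: measurable_fst.
Qed.

Lemma measurable_tailv : measurable_fun setT tailv.
Proof.
apply: measurable_fun_rV => i; under eq_fun do rewrite mxE.
exact: measurable_coord.
Qed.

Lemma measurable_uncons : measurable_fun setT uncons.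
Proof.
by apply: measurable_fun_pair; [exact: measurable_coord|exact: measurable_tailv].
Qed.

End cons_vector.

Lemma lebesgue_measureD (R : realType) (c : R) (A : set R) : measurable A ->
  lebesgue_measure [set t | A (t + c)] = lebesgue_measure A.
Proof.
have mc : measurable_fun [set: measurableTypeR R]
    (fun t => t + c : measurableTypeR R).
  by apply: continuous_measurable_fun => t; apply: cvgD => //; exact: cvg_cst.
move=> mA.
pose mc' := isMeasurableFun.Build _ _ _ _ _ mc.
pose f : {mfun measurableTypeR R >-> measurableTypeR R} :=
  HB.pack (fun t => t + c : measurableTypeR R) mc'.
rewrite [RHS](@lebesgue_measure_unique _ (pushforward lebesgue_measure f))//.
move=> _ [[a b] _ <-].
have fE : f @^-1` `]a, b]%classic = `]a - c, b - c]%classic.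
  by apply/seteqP; split => t /=; rewrite !in_itv/= ltrBlDr lerBrDr.
rewrite [RHS](_ : _ = lebesgue_measure `]a - c, b - c]%classic); last by rewrite -fE.
rewrite !lebesgue_measure_itv/= !lte_fin ltrD2r.
by case: ifPn => // _; rewrite -!EFinB; congr EFin; ring.
Qed.

Lemma product_measure_sigma_finite d1 d2 (T1 : measurableType d1)
    (T2 : measurableType d2) (R : realType)
    (m1 : {sigma_finite_measure set T1 -> \bar R})
    (m2 : {sigma_finite_measure set T2 -> \bar R}) :
  sigma_finite setT (m1 \x m2)%E.
Proof.
have /sigma_finiteP[F [TF ndF Foo]] := sigma_finiteT m1.
have /sigma_finiteP[G [TG ndG Goo]] := sigma_finiteT m2.
exists (fun n => F n `*` G n).
  apply/seteqP; split=> [[x y] _|//].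
  have [i _ Fx] : (\bigcup_k F k) x by rewrite -TF.
  have [j _ Gy] : (\bigcup_k G k) y by rewrite -TG.
  exists (maxn i j) => //; split.
    by move: x Fx; apply/subsetPset/ndF/leq_maxl.
  by move: y Gy; apply/subsetPset/ndG/leq_maxr.
move=> k; have [mF Fk] := Foo k; have [mG Gk] := Goo k.
by split; [exact: measurableX|rewrite product_measure1E// lte_mul_pinfty// ge0_fin_numE].
Qed.

Lemma pushforward_measureW d d' (T : measurableType d) (T' : measurableType d')
    (R : realType) (mu : {measure set T -> \bar R}) (f : T -> T') :
  measurable_fun setT f ->
  exists nu : {measure set T' -> \bar R}, nu = pushforward mu f :> (set T' -> \bar R).
Proof.
by move=> mf; unshelve eexists (pushforward mu f : {measure set T' -> \bar R}).
Qed.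

(** An alias of [mu], to which the sigma-finite structure given by the proof [sf] can be
    attached. *)
Definition sigma_measure d (T : measurableType d) (R : realType)
  (mu : {measure set T -> \bar R}) (sf : sigma_finite setT mu) : set T -> \bar R := mu.

Section sigma_measure.
Context d (T : measurableType d) (R : realType).
Variables (mu : {measure set T -> \bar R}) (sf : sigma_finite setT mu).
HB.instance Definition _ := Measure.copy (sigma_measure sf) mu.
HB.instance Definition _ := @Measure_isSigmaFinite.Build _ _ _ (sigma_measure sf) sf.

Lemma sigma_finite_measureW :
  exists nu : {sigma_finite_measure set T -> \bar R}, nu = mu :> (set T -> \bar R).
Proof. by exists (sigma_measure sf). Qed.

End sigma_measure.

Section lebesgue_rV.
Variable R : realType.

(** [volume] is a mere set function. On Borel sets it is the image under [consv] of the product of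
    the Lebesgue measure of the line with the measure of the previous dimension, and this image is a
    sigma-finite measure. *)
Lemma volume_sigma_finite_measure k : exists
  mu : {sigma_finite_measure set 'rV[R]_k -> \bar R},
  forall A, measurable A -> mu A = volume A.
Proof.
elim: k => [|k [mu muE]].
  by exists (\d_(0 : 'rV[R]_0)) => A _.
pose leb : {sigma_finite_measure set (measurableTypeR R) -> \bar R} :=
  @lebesgue_measure R.
pose nu : {measure set (measurableTypeR R * 'rV[R]_k)%type -> \bar R} :=
  (leb \x mu)%E.
have [nu' nu'E] := pushforward_measureW nu (@measurable_consv R k).
have sf : sigma_finite setT nu'.
  have [F FT FP] := product_measure_sigma_finite leb mu.
  exists (fun i => @uncons R k @^-1` F i).
    by rewrite -preimage_bigcup -FT preimage_setT.
  move=> i; have [mF Foo] := FP i; split.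
    by rewrite -[X in measurable X]setTI; exact: measurable_uncons.
  rewrite nu'E /pushforward -comp_preimage (_ : uncons (k:=k) \o consv (k:=k) = id).
    by rewrite preimage_id.
  by apply/funext => x /=; exact: consvK.
have [mu' mu'E] := sigma_finite_measureW sf.
exists mu' => A mA.
rewrite mu'E nu'E /pushforward /= /product_measure1.
apply: eq_integral => t _ /=; rewrite muE.
  by rewrite /xsection/=; congr (volume _); apply/seteqP; split => u /=; rewrite inE.
apply: measurable_xsection; rewrite -[X in measurable X]setTI.
exact: measurable_consv.
Qed.

End lebesgue_rV.

Section change_of_variables.
Context d d' (T : measurableType d) (T' : measurableType d') (R : realType).
Variables (mu : {measure set T -> \bar R}) (nu : {measure set T' -> \bar R}).
Variables (f : T -> T').
Local Open Scope ereal_scope.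

Lemma ge0_integral_preserving (D : set T') (g : T' -> \bar R) :
  measurable_fun setT f ->
  (forall A, measurable A -> A `<=` D -> mu (f @^-1` A) = nu A) ->
  measurable D -> measurable_fun D g -> (forall y, D y -> 0 <= g y) ->
  \int[mu]_(x in f @^-1` D) g (f x) = \int[nu]_(y in D) g y.
Proof.
move=> mf munu mD mg g0.
rewrite -(ge0_integral_pushforward mf mu)//; last by move=> y; rewrite inE; exact: g0.
have [nu' nu'E] := pushforward_measureW mu mf.
by rewrite -nu'E; apply: eq_measure_integral => A mA AD; rewrite nu'E; exact: munu.
Qed.

End change_of_variables.

Section fubini_sections.
Context d1 d2 (T1 : measurableType d1) (T2 : measurableType d2) (R : realType).
Variables (m1 : {sigma_finite_measure set T1 -> \bar R}).
Variables (m2 : {sigma_finite_measure set T2 -> \bar R}).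
Local Open Scope ereal_scope.

Lemma integral_sections (E : set (T1 * T2)) : measurable E ->
  \int[m1]_x m2 [set y | E (x, y)] = \int[m2]_y m1 [set x | E (x, y)].
Proof.
move=> mE; have := indic_fubini_tonelli m1 m2 mE.
rewrite indic_fubini_tonelli_FE// indic_fubini_tonelli_GE// => fub.
transitivity (\int[m1]_x (m2 \o xsection E) x).
  apply: eq_integral => x _ /=; congr (m2 _).
  by apply/seteqP; split => y; rewrite /xsection/= inE.
rewrite fub; apply: eq_integral => y _ /=; congr (m1 _).
by apply/seteqP; split => x; rewrite /ysection/= inE.
Qed.

End fubini_sections.

Lemma integral_if_cst d (T : measurableType d) (R : realType)
    (mu : {measure set T -> \bar R}) (B : set T) (c : \bar R) : measurable B ->
  (\int[mu]_y (if y \in B then c else 0) = c * mu B)%E.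
Proof.
move=> mB; rewrite -integral_cst// [RHS]integral_mkcond.
by apply: eq_integral => y _; rewrite patchE.
Qed.

(** * Uniqueness of translation invariant measures, and Lebesgue measure on R^k *)

Definition translation_invariant (R : realType) k (mu : set 'rV[R]_k -> \bar R) :=
  forall (v : 'rV[R]_k) (A : set 'rV[R]_k), measurable A ->
  mu [set u : 'rV[R]_k | A (u + v)] = mu A.

Section translation_uniqueness.
Variables (R : realType) (k : nat).
Variables (mu nu : {sigma_finite_measure set 'rV[R]_k -> \bar R}).
Local Open Scope ereal_scope.

Lemma measurable_preimage d (T : measurableType d) (f : T -> 'rV[R]_k) A :
  measurable_fun setT f -> measurable A -> measurable [set x | A (f x)].
Proof. by move=> mf mA; rewrite -[X in measurable X]setTI; exact: mf. Qed.

(* Weil's argument for the uniqueness of Haar measure. *)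
Lemma translation_invariant_unique A B :
  translation_invariant mu -> translation_invariant nu ->
  measurable A -> measurable B -> mu A * nu B = mu [set u | B (- u)%R] * nu A.
Proof.
move=> muD nuD mA mB.
have mN : measurable_fun setT (fun u : 'rV[R]_k => - u)%R.
  rewrite (_ : (fun u => _) = (fun u : 'rV[R]_k => (-1) *: u)%R).
    by apply: measurable_scalerV => //; exact: measurable_id.
  by apply/funext => u; rewrite scaleN1r.
have mx : measurable_fun setT (fun z : 'rV[R]_k * 'rV[R]_k => z.1) by exact: measurable_fst.
have my : measurable_fun setT (fun z : 'rV[R]_k * 'rV[R]_k => z.2) by exact: measurable_snd.
have mNx : measurable_fun setT (fun z : 'rV[R]_k * 'rV[R]_k => (- z.1)%R).
  exact: (measurableT_comp mN mx).
(* The shear (x, y) -> (x, x + y) maps [E] onto [E'], so their sections at a fixed x are translates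
   of each other and have the same [nu]-measure. Their sections at a fixed y give the two sides of
   the identity. *)
pose E := [set z : 'rV[R]_k * 'rV[R]_k | A (z.1 + z.2)%R /\ B z.2].
have mE : measurable E.
  apply: measurableI; first exact: measurable_preimage (measurable_addrV mx my) mA.
  exact: measurable_preimage my mB.
pose E' := [set z : 'rV[R]_k * 'rV[R]_k | A z.2 /\ B (z.2 - z.1)%R].
have mE' : measurable E'.
  apply: measurableI; first exact: measurable_preimage my mA.
  exact: measurable_preimage (measurable_addrV my mNx) mB.
have <- : \int[nu]_y mu [set x | E (x, y)] = mu A * nu B.
  rewrite -integral_if_cst//; apply: eq_integral => y _; rewrite /E/=.
  case: ifPn => [|/negP] yB; last first.
    by rewrite (_ : [set _ | _] = set0)// -subset0 => x [_ By]; apply: yB; rewrite inE.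
  rewrite -(muD y A)//; congr (mu _); apply/seteqP; split => [x []//|x Ax].
  by split=> //; rewrite inE in yB.
have <- : \int[nu]_y mu [set x | E' (x, y)] = mu [set u | B (- u)%R] * nu A.
  rewrite -integral_if_cst//; apply: eq_integral => y _; rewrite /E'/=.
  case: ifPn => [|/negP] yA; last first.
    by rewrite (_ : [set _ | _] = set0)// -subset0 => x [Ay _]; apply: yA; rewrite inE.
  have mBN : measurable [set u | B (- u)%R] by exact: measurable_preimage mN mB.
  rewrite -[RHS](muD (- y)%R)//; congr (mu _); apply/seteqP; split => [x [_]/=|x /=]; rewrite opprB//.
  by rewrite inE in yA.
rewrite -!integral_sections//; apply: eq_integral => x _; rewrite /E /E'/=.
rewrite -(nuD x [set y | A y /\ B (y - x)%R]).
  by congr (nu _); apply/seteqP; split => y /=; rewrite addrK addrC.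
apply: measurableI => //; apply: measurable_preimage mB.
by apply: measurable_addrV => //; exact: measurable_cst.
Qed.

End translation_uniqueness.

Section lebesgue_measure_rV.
Variable R : realType.
Local Open Scope ereal_scope.
Local Notation lambda := (@lebesgue_measure R).

Definition leb k : {sigma_finite_measure set 'rV[R]_k -> \bar R} :=
  projT1 (cid (volume_sigma_finite_measure R k)).

Lemma lebE k A : measurable A -> leb k A = volume A.
Proof. exact: (projT2 (cid (volume_sigma_finite_measure R k))). Qed.

Lemma measurable_consv_slice k (A : set 'rV[R]_k.+1) t :
  measurable A -> measurable [set u | A (consv (t, u))].
Proof.
move=> mA; apply: (@measurable_preimage R k.+1 _ _ (fun u => consv (t, u))) => //.
exact: (measurableT_comp (@measurable_consv R k) (measurable_pair1 t)).
Qed.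

Lemma lebS k (A : set 'rV[R]_k.+1) : measurable A ->
  leb k.+1 A = \int[lambda]_t leb k [set u | A (consv (t, u))].
Proof.
move=> mA; rewrite lebE//=; apply: eq_integral => t _; rewrite lebE//.
exact: measurable_consv_slice.
Qed.

Let lam : {sigma_finite_measure set (measurableTypeR R) -> \bar R} := lambda.

Lemma leb_consv k (A : set 'rV[R]_k.+1) : measurable A ->
  (lam \x leb k) (@consv R k @^-1` A) = leb k.+1 A.
Proof.
move=> mA; rewrite lebS// /product_measure1; apply: eq_integral => t _ /=.
by congr (leb k _); apply/seteqP; split => u; rewrite /xsection/= inE.
Qed.

Lemma ge0_integral_lebS k (f : 'rV[R]_k.+1 -> \bar R) :
  measurable_fun setT f -> (forall u, 0 <= f u) ->
  \int[leb k.+1]_u f u = \int[lambda]_t \int[leb k]_u f (consv (t, u)).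
Proof.
move=> mf f0.
rewrite -(ge0_integral_preserving (mu := lam \x leb k) (@measurable_consv R k))//.
  rewrite preimage_setT fubini_tonelli1//.
  exact: (measurableT_comp mf (@measurable_consv R k)).
by move=> A mA _; exact: leb_consv.
Qed.

Lemma leb_translation_invariant k : translation_invariant (leb k).
Proof.
elim: k => [|k IHk] v A mA.
  congr (leb 0 _); apply/seteqP; split => u;
  by rewrite /= (_ : (u + v)%R = u)//; apply/rowP => -[].
have msh : measurable_fun setT (fun u : 'rV[R]_k.+1 => u + v)%R.
  by apply: measurable_addrV; [exact: measurable_id|exact: measurable_cst].
rewrite !lebS//; last exact: measurable_preimage msh mA.
pose G t := leb k [set u | A (consv (t, u))].
have mG : measurable_fun setT (G : measurableTypeR R -> _).
  have := measurable_fun_xsection (leb k) (measurable_preimage (@measurable_consv R k) mA).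
  apply: eq_measurable_fun => t _ /=.
  by congr (leb k _); apply/seteqP; split => u; rewrite /xsection/= inE.
transitivity (\int[lambda]_t G (t + v ord0 ord0)%R).
  apply: eq_integral => t _; rewrite /G -[RHS](IHk (tailv v)); last exact: measurable_consv_slice.
  congr (leb k _); apply/seteqP; split => u /=;
  rewrite (_ : (consv (t, u) + v)%R = consv ((t + v ord0 ord0)%R, (u + tailv v)%R))//;
  by apply: (can_inj (@unconsK R k)); rewrite consvK /uncons mxE consv_head; congr pair;
     apply/rowP => i; do 2 rewrite [LHS]mxE; rewrite consv_tail [RHS]mxE; congr (_ + _)%R; rewrite mxE.
have mc : measurable_fun [set: measurableTypeR R]
    (fun t => (t + v ord0 ord0)%R : measurableTypeR R).
  by apply: continuous_measurable_fun => t; apply: cvgD => //; exact: cvg_cst.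
have := ge0_integral_preserving (mu := lam) (nu := lam) mc (D := setT) (g := G).
rewrite preimage_setT; apply => //.
- by move=> B mB _; exact: lebesgue_measureD.
Qed.

Definition cube k (c : R) : set 'rV[R]_k := [set u | forall i, (0 <= u 0 i <= c)%R].

Lemma measurable_cube k c : measurable (@cube k c).
Proof.
rewrite (_ : @cube k c = \bigcap_(i in [set: 'I_k]) [set u | (0 <= u 0 i <= c)%R]).
  apply: fin_bigcap_measurable => // i _.
  have m01 : measurable (`[0%R, c]%classic : set R) by exact: measurable_itv.
  have := measurable_coord i measurableT m01.
  by rewrite setTI; congr (measurable _); apply/seteqP; split => u; rewrite /= in_itv.
by apply/seteqP; split => [u uc i _|u uc i]; exact: uc.
Qed.

Lemma leb_cube k c : (0 <= c)%R -> leb k (@cube k c) = (c ^+ k)%:E.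
Proof.
move=> c0; elim: k => [|k IHk].
  rewrite lebE; last exact: measurable_cube.
  by rewrite /= diracE mem_set// => -[].
rewrite lebS; last exact: measurable_cube.
transitivity (\int[lambda]_t (if t \in `[0%R, c]%classic then (c ^+ k)%:E else 0)).
  apply: eq_integral => t _; case: ifPn => [|/negP] t01.
    rewrite -IHk; congr (leb k _); apply/seteqP; split => u /= uc i.
      by have := uc (lift ord0 i); rewrite consv_tail.
    have [j ->|->] := unliftP ord0 i; first by rewrite consv_tail.
    by rewrite consv_head; move: t01; rewrite inE/= in_itv.
  rewrite (_ : [set _ | _] = set0)// -subset0 => u /= /(_ ord0).
  by rewrite consv_head => t01'; apply: t01; rewrite inE/= in_itv.
have -> := integral_if_cst lam (c ^+ k)%:E (measurable_itv `[0%R, c]).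
rewrite /lam/= lebesgue_measure_itv/= lte_fin.
have [->|c'] := eqVneq c 0%R; first by rewrite ltxx mule0 expr0n.
by rewrite lt_neqAle eq_sym c' c0 oppr0 adde0 -EFinM exprSr.
Qed.

End lebesgue_measure_rV.

(** * Hausdorff measure of top dimension is Lebesgue measure *)

Section hausdorff_isometry.
Variables (R : realType) (m k l : nat).

Lemma houter_isometry (T : Type) (A : set T) (f : T -> 'rV[R]_k)
    (h : T -> 'rV[R]_l) :
  (forall x y, A x -> A y -> enorm (f x - f y) = enorm (h x - h y)) ->
  houter m (f @` A) = houter m (h @` A).
Proof.
move=> fh; apply/eqP; rewrite eq_le; apply/andP; split.
- have := @houter_lipschitz R m k l T A f h 1 ltr01; rewrite expr1n mul1e; apply.
  by move=> x y Ax Ay; rewrite mul1r fh.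
- have := @houter_lipschitz R m l k T A h f 1 ltr01; rewrite expr1n mul1e; apply.
  by move=> x y Ax Ay; rewrite mul1r fh.
Qed.

Lemma hmeasure_isometry (T : Type) (A : set T) (f : T -> 'rV[R]_k)
    (h : T -> 'rV[R]_l) :
  (forall x y, A x -> A y -> enorm (f x - f y) = enorm (h x - h y)) ->
  hmeasure m (f @` A) = hmeasure m (h @` A).
Proof. by move=> fh; rewrite /hmeasure (houter_isometry fh). Qed.

Lemma hmeasure_lipschitz (T : Type) (A : set T) (f : T -> 'rV[R]_k)
    (h : T -> 'rV[R]_l) (L : R) : 0 < L ->
  (forall x y, A x -> A y -> enorm (f x - f y) <= L * enorm (h x - h y)) ->
  (hmeasure m (f @` A) <= (L ^+ m)%:E * hmeasure m (h @` A))%E.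
Proof.
move=> L0 fh; rewrite /hmeasure muleCA; apply: lee_pmul => //.
- by rewrite lee_fin hcst_ge0.
- exact: houter_ge0.
- exact: houter_lipschitz.
Qed.

End hausdorff_isometry.

Section hausdorff_cube.
Variables (R : realType) (m' : nat).
Local Notation m := m'.+1.
Local Open Scope ereal_scope.

(** A grid of [N.+1 ^ m] cells of side [1 / N.+1], each of diameter at most [m / N.+1], has total
    cost [m ^ m], whatever the fineness [N]. *)
Lemma hausdorff_cube_lty : hausdorff m (@unit_cube R m) < +oo.
Proof.
apply: (@le_lt_trans _ _ (m%:R ^+ m)%:E); last exact: ltry.
apply: ge_ereal_sup => _ [delta d0 <-].
have [N Nd] : exists N : nat, (m%:R / N.+1%:R <= delta :> R)%R.
  have /ltr_add_invr[N] : (0 < delta / m%:R :> R)%R by rewrite divr_gt0.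
  rewrite add0r => Nd; exists N; apply/ltW.
  by rewrite mulrC -ltr_pdivlMr.
pose I := {ffun 'I_m -> 'I_N.+1}.
have cardI : #|{: I}| = (N.+1 ^ m)%N by rewrite card_ffun !card_ord.
pose d i : R := if (i < #|{: I}|)%N then (m%:R / N.+1%:R)%R else 0%R.
have dn : (0 <= m%:R / N.+1%:R :> R)%R by rewrite divr_ge0.
have d_cover : cover_diameters delta (@unit_cube R m) d.
  exists (fun i => [set u | exists2 j : 'I_#|{: I}|, i = j :> nat &
    forall a, ((enum_val j a : nat)%:R / N.+1%:R <= u 0 a <=
      (enum_val j a).+1%:R / N.+1%:R)%R]); split.
  (* The index is capped at [N] because a coordinate equal to 1 belongs to the last cell. *)
  - move=> u uc; pose f : I := [ffun a => inord (minn (Num.truncn (u 0 a * N.+1%:R)%R) N)].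
    exists (enum_rank f) => //; exists (enum_rank f) => // a.
    rewrite enum_rankK ffunE inordK; last by rewrite ltnS geq_minr.
    have /andP[u0 u1] := uc a.
    have u0' : (0 <= u ord0 a * N.+1%:R)%R by rewrite mulr_ge0.
    have /andP[t1 t2] := truncn_itv u0'.
    rewrite ler_pdivrMr// ler_pdivlMr//; apply/andP; split.
      by rewrite (le_trans _ t1)// ler_nat geq_minl.
    rewrite /minn; case: ltnP => _; first exact: ltW.
    by rewrite -[leRHS]mul1r ler_wpM2r.
  - by move=> i; rewrite /d; case: ifP => _; rewrite ?lexx ?(ltW d0)// dn.
  - move=> i u v [j ij uj] [j' ij' vj']; have jj' : j = j' by apply: val_inj; rewrite /= -ij.
    subst j'; rewrite /d ij ltn_ord; apply: (enorm_le_sup (c := N.+1%:R^-1%R)) => a.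
    rewrite !mxE ler_norml; have /andP[u1 u2] := uj a; have /andP[v1 v2] := vj' a.
    move: u2 v2; rewrite -[(enum_val j a).+1%:R]natr1 mulrDl mul1r => u2 v2.
    move: u1 u2 v1 v2; rewrite -/(_ / _); set p := (_%:R / _)%R; set q := (_^-1)%R.
    by move=> *; apply/andP; split; lra.
apply: (le_trans (content_le _ d_cover)).
rewrite (@nneseries_split _ _ 0%N #|{: I}|); last first.
  move=> i _; rewrite lee_fin exprn_ge0// /d; by case: ifP.
rewrite [X in _ + X]eseries0 ?adde0; last first.
  by move=> i iK _; rewrite /d ltnNge iK expr0n.
rewrite add0n big_mkord (eq_bigr (fun=> ((m%:R / N.+1%:R) ^+ m)%:E)); last first.
  by move=> i _; rewrite /d ltn_ord.
rewrite sumEFin lee_fin sumr_const card_ord cardI -[(_ *+ (_ ^ _)%N)%R]mulr_natr natrX -exprMn.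
by rewrite divfK.
Qed.

(** A set of diameter [d] lies in a cube of side [2 * d] centred at any of its points. The volumes
    of these cubes add up to at least that of the unit cube, hence the bound [2 ^- m]. *)
Lemma hausdorff_cube_gt0 : 0 < hausdorff m (@unit_cube R m).
Proof.
apply: (@lt_le_trans _ _ ((2 ^+ m)^-1)%:E); first by rewrite lte_fin invr_gt0 exprn_gt0.
rewrite (le_trans _ (content_le_hausdorff _ _ ltr01))//.
apply: le_ereal_inf_tmp => _ [d [C [AC dP CP]] <-].
rewrite -[leLHS]mule1 lee_pdivrMl ?exprn_gt0// -nneseriesZl; last first.
  by move=> i _; rewrite lee_fin exprn_ge0//; case/andP: (dP i).
under eq_eseriesr do rewrite -EFinM -exprMn.
have /choice[x xP] (i : nat) : exists y, C i !=set0 -> C i y.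
  by have [[y Cy]|nC] := pselect (C i !=set0); [exists y|exists 0%R].
(* This shift carries the chosen point [x i] to the centre of the cube of side [2 * d i] with a
   corner at the origin. *)
pose s i : 'rV[R]_m := (const_mx (d i) - x i)%R.
pose B i := [set u | @cube R m (2 * d i)%R (u + s i)%R].
have mB i : measurable (B i).
  apply: measurable_preimage (@measurable_cube R m _).
  by apply: measurable_addrV; [exact: measurable_id|exact: measurable_cst].
have lB i : leb R m (B i) = ((2 * d i) ^+ m)%:E.
  have /andP[d0 _] := dP i.
  rewrite /B leb_translation_invariant; last exact: measurable_cube.
  by rewrite leb_cube// mulr_ge0.
apply: (@le_trans _ _ (leb R m (@cube R m 1%R))); first by rewrite leb_cube// expr1n.
under eq_eseriesr do rewrite -lB.
apply: measure_sigma_subadditive => //; first exact: measurable_cube.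
move=> u /AC[i _ Cu]; exists i => // a; rewrite !mxE.
have := le_trans (coord_le_enorm _ a) (CP _ _ _ Cu (xP i (ex_intro _ u Cu))).
by rewrite !mxE ler_norml => /andP[? ?]; apply/andP; split; lra.
Qed.

End hausdorff_cube.

Section hausdorff_lebesgue.
Variables (R : realType) (m' : nat).
Local Notation m := m'.+1.
Local Open Scope ereal_scope.

Lemma hmeasure_unit_cube : hmeasure m (@unit_cube R m) = 1.
Proof.
have c0 := hausdorff_cube_gt0 R m'; have coo := hausdorff_cube_lty R m'.
rewrite /hmeasure /houter -[X in _ * X]fineK; last by rewrite ge0_fin_numE// ltW.
by rewrite -EFinM mulVf// gt_eqF// fine_gt0// c0 coo.
Qed.

Lemma hmeasure_translation_invariant : translation_invariant (@hmeasure R m m).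
Proof.
move=> v A mA.
have -> : [set u | A (u + v)%R] = (fun u => u - v)%R @` A.
  apply/seteqP; split => [u Au|_ [u Au <-]/=]; last by rewrite subrK.
  by exists (u + v)%R => //; rewrite addrK.
rewrite -[in RHS](image_id A); apply: hmeasure_isometry => x y _ _.
by rewrite opprB addrA subrK.
Qed.

(** The pieces are the cubes with coordinates between [-n] and [n], seen as affine images of the
    unit cube, whose measure is 1. The piece [n = 0] is a single point and is treated apart for
    measurability. *)
Lemma hmeasure_sigma_finite : sigma_finite setT (@hmeasure R m m).
Proof.
pose s n : 'rV[R]_m := const_mx n%:R.
exists (fun n => (fun u => 2 * n%:R *: u - s n)%R @` @unit_cube R m).
  apply/seteqP; split => // u _.
  pose n := (Num.truncn (enorm u)).+1; exists n => //.
  have n0 : (0 < n%:R :> R)%R by [].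
  exists ((2 * n%:R)^-1 *: (u + s n))%R; last first.
    by rewrite scalerA divff ?scale1r ?addrK// mulf_neq0// gt_eqF.
  move=> i; rewrite !mxE ler_pdivlMl ?mulr_gt0// ler_pdivrMl ?mulr_gt0//.
  have := coord_le_enorm u i; have /andP[_ un] := truncn_itv (enorm_ge0 u).
  rewrite -/n in un; rewrite ler_norml => /andP[u1 u2].
  by apply/andP; split; lra.
move=> n; split.
  have [->|n0] := eqVneq n 0%N.
    rewrite (_ : _ @` _ = [set 0%R]); last first.
      apply/seteqP; split => [_ [u _ <-]|_ ->] /=.
        by rewrite mulr0 scale0r sub0r; apply/rowP => i; rewrite !mxE oppr0.
      exists 0%R; first by move=> i; rewrite mxE lexx ler01.
      by rewrite scaler0 sub0r; apply/rowP => i; rewrite !mxE oppr0.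
    apply: measurable_closed; exact: accessible_closed_set1 (hausdorff_accessible (@norm_hausdorff _ _)) _.
  have n0' : (2 * n%:R != 0 :> R)%R by rewrite mulf_neq0// pnatr_eq0.
  rewrite (_ : _ @` _ = [set u | @unit_cube R m ((2 * n%:R)^-1 *: (u + s n))%R]); last first.
    apply/seteqP; split => [_ [u uc <-]|u uc] /=; last first.
      by eexists; [exact: uc|rewrite scalerA divff// scale1r addrK].
    by rewrite subrK scalerA mulVf// scale1r.
  apply: measurable_preimage (@measurable_cube R m 1%R).
  apply: measurable_scalerV; first exact: measurable_cst.
  by apply: measurable_addrV; [exact: measurable_id|exact: measurable_cst].
(* One is added to the Lipschitz constant [2 * n] to keep it positive for [n = 0]. *)
have L0 : (0 < 2 * n%:R + 1 :> R)%R by rewrite ltr_wpDl// mulr_ge0.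
apply: (@le_lt_trans _ _ (((2 * n%:R + 1) ^+ m)%:E * hmeasure m (id @` @unit_cube R m))).
  apply: hmeasure_lipschitz => // x y _ _.
  rewrite opprB addrA subrK -scalerBr enormZ ler_wpM2r ?enorm_ge0//.
  by rewrite ger0_norm ?mulr_ge0// lerDl.
by rewrite image_id hmeasure_unit_cube mule1 ltry.
Qed.

(** Both measures are translation invariant and give mass 1 to the unit cube. The mirrored cube in
    the uniqueness identity has the same Hausdorff measure because u -> -u is an isometry. *)
Lemma hmeasure_leb A : measurable A -> hmeasure m A = leb R m A.
Proof.
move=> mA.
have [mu muE] := sigma_finite_measureW hmeasure_sigma_finite.
have muN : mu [set u | @unit_cube R m (- u)%R] = 1.
  rewrite muE -hmeasure_unit_cube -[in RHS](image_id (@unit_cube R m)).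
  rewrite (_ : [set u | _] = -%R @` @unit_cube R m).
    by apply: hmeasure_isometry => x y _ _; rewrite -opprD enormN.
  apply/seteqP; split => [u uc|_ [u uc <-]]; last by rewrite /= opprK.
  by exists (- u)%R => //; rewrite opprK.
have := @translation_invariant_unique R m mu (leb R m) A (@unit_cube R m).
rewrite muN mul1e (@leb_cube R m 1%R)// expr1n mule1 -muE; apply => //.
- by rewrite muE; exact: hmeasure_translation_invariant.
- exact: leb_translation_invariant.
- exact: (@measurable_cube R m 1%R).
Qed.

End hausdorff_lebesgue.

(** * Reflections, isometries and dilations *)

Section reflection.
Variables (R : realType) (k : nat).
Implicit Types u v w : 'rV[R]_k.

(** The reflection in the hyperplane orthogonal to [w]. For [w = 0] it is the identity, so
    [refl_swap] includes the case of equal vectors. *)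
Definition refl w u : 'rV[R]_k := u - (2 * edot u w / edot w w) *: w.

Lemma edot_refl w u v : edot (refl w u) (refl w v) = edot u v.
Proof.
rewrite /refl; have [->|w0] := eqVneq w 0; first by rewrite !scaler0 !subr0.
have ww : edot w w != 0 by rewrite -sqr_enorm expf_neq0// enorm_eq0.
rewrite edotBl !edotBr !edotZl !edotZr (edotC w v).
by field.
Qed.

Lemma reflK w : involutive (refl w).
Proof.
move=> u; have [->|w0] := eqVneq w 0; first by rewrite /refl !scaler0 !subr0.
have ww : edot w w != 0 by rewrite -sqr_enorm expf_neq0// enorm_eq0.
rewrite {1}/refl (_ : edot (refl w u) w = - edot u w).
  by rewrite /refl mulrN mulNr scaleNr opprK subrK.
by rewrite /refl edotBl edotZl; field.
Qed.

Lemma reflB w u v : refl w (u - v) = refl w u - refl w v.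
Proof.
by rewrite /refl edotBl; apply/rowP => i; rewrite !mxE; ring.
Qed.

Lemma enorm_refl w u : enorm (refl w u) = enorm u.
Proof. by rewrite /enorm edot_refl. Qed.

(** The mirror is the bisecting hyperplane of [u] and [v]. One reflection thus carries any vector to
    any other of the same length, which replaces every appeal to rotations. *)
Lemma refl_swap u v : enorm u = enorm v -> refl (u - v) u = v.
Proof.
move=> uv; have [->|uv0] := eqVneq u v; first by rewrite /refl subrr scaler0 subr0.
have ww : edot (u - v) (u - v) != 0 by rewrite -sqr_enorm expf_neq0// enorm_eq0 subr_eq0.
have c1 : 2 * edot u (u - v) / edot (u - v) (u - v) = 1.
  apply: (canLR (mulfK ww)); rewrite mul1r edotBl !edotBr (edotC v u).
  have : edot u u = edot v v by rewrite -!sqr_enorm uv.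
  by move=> ->; ring.
by rewrite /refl c1 scale1r opprB addrC subrK.
Qed.

Lemma measurable_refl w : measurable_fun setT (refl w).
Proof.
have -> : refl w = (fun u => u + (- (2 * edot u w / edot w w)) *: w).
  by apply/funext => u; rewrite scaleNr.
apply: measurable_addrV; first exact: measurable_id.
apply: measurable_scalerV; last exact: measurable_cst.
apply: measurableT_comp => //; apply: measurable_funM; last exact: measurable_cst.
apply: measurable_funM; first exact: measurable_cst.
by apply: measurable_edot; [exact: measurable_id|exact: measurable_cst].
Qed.

End reflection.

Section leb_maps.
Variables (R : realType) (m' : nat).
Local Notation m := m'.+1.
Local Open Scope ereal_scope.

(** Invariance is inherited from the Hausdorff measure, which only sees distances; no determinant is
    involved. *)
Lemma leb_isometry (O : 'rV[R]_m -> 'rV[R]_m) (A : set 'rV[R]_m) :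
  measurable_fun setT O -> (forall u v, enorm (O u - O v) = enorm (u - v)) ->
  (forall v, exists u, O u = v) -> measurable A -> leb R m (O @^-1` A) = leb R m A.
Proof.
move=> mO iO sO mA; rewrite -!hmeasure_leb//; last exact: measurable_preimage mO mA.
have {2}-> : A = O @` (O @^-1` A).
  by apply/seteqP; split => [u Au|_ [u Au <-]//]; have [v vu] := sO u; exists v; rewrite /= ?vu.
by rewrite -[X in hmeasure m X](image_id (O @^-1` A)); apply: hmeasure_isometry.
Qed.

Lemma leb_refl w (A : set 'rV[R]_m) : measurable A -> leb R m (refl w @^-1` A) = leb R m A.
Proof.
apply: leb_isometry; first exact: measurable_refl.
- by move=> u v; rewrite -reflB enorm_refl.
- by move=> v; exists (refl w v); exact: reflK.
Qed.

(** The dilation is Lipschitz with constant [s] and its inverse with constant [s^-1]; the two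
    resulting inequalities between Hausdorff measures are inverse to each other. *)
Lemma leb_scale (s : R) (A : set 'rV[R]_m) : (0 < s)%R -> measurable A ->
  leb R m [set u | A (s *: u)%R] = (s ^- m)%:E * leb R m A.
Proof.
move=> s0 mA; have ms : measurable_fun setT (fun u : 'rV[R]_m => s *: u)%R.
  by apply: measurable_scalerV; [exact: measurable_cst|exact: measurable_id].
have mA' := measurable_preimage ms mA.
have sm0 : (0 < s ^+ m)%R by rewrite exprn_gt0.
rewrite -!hmeasure_leb//; set A' := [set u | _].
have AE : A = (fun u => s *: u)%R @` A'.
  apply/seteqP; split => [u Au|_ [u Au <-]//].
  by exists (s^-1 *: u)%R; rewrite /A'/= scalerA divff ?scale1r// gt_eqF.
apply/eqP; rewrite eq_le; apply/andP; split.
  rewrite [X in _ * hmeasure _ X]AE lee_pdivlMl//.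
  have := @hmeasure_lipschitz R m _ _ _ A' id (fun u => s *: u)%R s^-1.
  rewrite image_id invr_gt0 => /(_ s0) H.
  rewrite -lee_pdivlMl// -exprVn; apply: H => x y _ _.
  by rewrite -scalerBr enormZ gtr0_norm// mulrA mulVf ?mul1r// gt_eqF.
rewrite lee_pdivrMl// [X in hmeasure _ X <= _]AE.
rewrite -[X in _ * hmeasure _ X](image_id A'); apply: hmeasure_lipschitz => // x y _ _.
by rewrite -scalerBr enormZ gtr0_norm.
Qed.

End leb_maps.

Lemma lebesgue_measureZ (R : realType) (s : R) (A : set R) : 0 < s -> measurable A ->
  (lebesgue_measure [set t | A (s * t)%R] = s^-1%:E * lebesgue_measure A)%E.
Proof.
move=> s0 mA.
have ms : measurable_fun [set: measurableTypeR R] (fun t => s * t : measurableTypeR R).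
  by apply: continuous_measurable_fun => t; apply: cvgM => //; exact: cvg_cst.
have [mu muE] := pushforward_measureW (@lebesgue_measure R) ms.
pose nu := mscale (NngNum (ltW s0)) mu.
have nuE B : nu B = (s%:E * lebesgue_measure [set t | B (s * t)%R])%E by rewrite /nu /mscale/= muE.
have -> : lebesgue_measure A = (s%:E * lebesgue_measure [set t | A (s * t)%R])%E.
  apply: (eq_trans (lebesgue_measure_unique (mu := nu) _ mA)); last exact: nuE.
  move=> _ [[a b] _ <-]; apply: (eq_trans _ (esym (nuE _))).
  have -> : [set t | `]a, b]%classic (s * t)] = `]a / s, b / s]%classic.
    by apply/seteqP; split => t /=; rewrite !in_itv/= ltr_pdivrMr// ler_pdivlMr// (mulrC t).
  rewrite !lebesgue_measure_itv/= !lte_fin ltr_pM2r ?invr_gt0//.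
  case: ifPn => _; last by rewrite mule0.
  by rewrite -!EFinB -EFinM; congr EFin; field; rewrite gt_eqF.
by rewrite muleA -EFinM mulVf ?mul1e// gt_eqF.
Qed.

Lemma row_subE (R : realType) k (u v : 'rV[R]_k) j : (u - v) 0 j = u 0 j - v 0 j.
Proof. by rewrite !mxE. Qed.

Lemma row_oppE (R : realType) k (u : 'rV[R]_k) j : (- u) 0 j = - u 0 j.
Proof. by rewrite mxE. Qed.

Lemma row_scaleE (R : realType) k c (u : 'rV[R]_k) j : (c *: u) 0 j = c * u 0 j.
Proof. by rewrite mxE. Qed.

Section stretch.
Variables (R : realType) (k : nat).
Local Open Scope ereal_scope.

Definition stretch (s : R) (u : 'rV[R]_k.+1) : 'rV[R]_k.+1 :=
  consv ((s * u 0 ord0)%R, tailv u).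

Lemma stretch_head s u : stretch s u 0%R ord0 = (s * u 0 ord0)%R.
Proof. by rewrite /stretch consv_head. Qed.

Lemma stretch_tail s u j : stretch s u 0%R (lift ord0 j) = u 0%R (lift ord0 j).
Proof. by rewrite /stretch consv_tail mxE. Qed.

Lemma stretchB s u v : stretch s (u - v)%R = (stretch s u - stretch s v)%R.
Proof.
apply/rowP => j; rewrite row_subE; have [k' ->|->] := unliftP ord0 j.
  by rewrite !stretch_tail row_subE.
by rewrite !stretch_head row_subE mulrBr.
Qed.

Lemma stretchK s : s != 0%R -> cancel (stretch s) (stretch s^-1).
Proof.
move=> s0 u; apply/rowP => j; have [k' ->|->] := unliftP ord0 j.
  by rewrite !stretch_tail.
by rewrite !stretch_head mulrA mulVf ?mul1r.
Qed.

Lemma sqr_enorm_stretch s u :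
  (enorm (stretch s u) ^+ 2 = enorm u ^+ 2 + (s ^+ 2 - 1) * u 0 ord0 ^+ 2)%R.
Proof.
rewrite !sqr_enorm /edot !big_ord_recl !stretch_head.
under eq_bigr do rewrite !stretch_tail.
by ring.
Qed.

Lemma measurable_stretch s : measurable_fun setT (stretch s).
Proof.
apply: (measurableT_comp (@measurable_consv R k)); apply: measurable_fun_pair.
  by apply: measurable_funM; [exact: measurable_cst|exact: measurable_coord].
exact: measurable_tailv.
Qed.

Lemma leb_stretch s (A : set 'rV[R]_k.+1) : (0 < s)%R -> measurable A ->
  leb R k.+1 (stretch s @^-1` A) = s^-1%:E * leb R k.+1 A.
Proof.
move=> s0 mA; have mA' := measurable_preimage (measurable_stretch s) mA.
rewrite !lebS//.
pose G t := leb R k [set u | A (consv (t, u))].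
have mG : measurable_fun setT (G : measurableTypeR R -> _).
  have := measurable_fun_xsection (leb R k) (measurable_preimage (@measurable_consv R k) mA).
  apply: eq_measurable_fun => t _ /=.
  by congr (leb R k _); apply/seteqP; split => u; rewrite /xsection/= inE.
transitivity (\int[lebesgue_measure]_t G (s * t)%R).
  apply: eq_integral => t _; rewrite /G; congr (leb R k _); apply/seteqP; split => u /=;
  by rewrite /stretch consv_head (_ : tailv (consv (t, u)) = u)//;
     apply/rowP => i; rewrite mxE consv_tail.
have ms : measurable_fun [set: measurableTypeR R] (fun t => s * t : measurableTypeR R)%R.
  by apply: continuous_measurable_fun => t; apply: cvgM => //; exact: cvg_cst.
have sV0 : (0 <= s^-1)%R by rewrite invr_ge0 ltW.
pose mu := mscale (NngNum sV0) (@lebesgue_measure R).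
have := ge0_integral_preserving (mu := @lebesgue_measure R) (nu := mu) ms (D := setT) (g := G).
rewrite preimage_setT => ->//.
- by rewrite ge0_integral_mscale.
- by move=> B mB _; exact: lebesgue_measureZ.
Qed.

End stretch.

(** * The area formula for graphs *)

Section insert_coordinate.
Variables (R : realType) (m : nat) (i : 'I_m.+1).
Implicit Types (u v : 'rV[R]_m) (q : 'rV[R]_m.+1) (s t : R).

Definition emb u t : 'rV[R]_m.+1 :=
  \row_j if unlift i j is Some k then u 0 k else t.

Lemma emb_lift u t k : emb u t 0 (lift i k) = u 0 k.
Proof. by rewrite mxE liftK. Qed.

Lemma emb_id u t : emb u t 0 i = t.
Proof. by rewrite mxE unlift_none. Qed.

Lemma col'_emb u t : col' i (emb u t) = u.
Proof. by apply/rowP => k; rewrite mxE emb_lift. Qed.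

Lemma emb_col' q : emb (col' i q) (q 0 i) = q.
Proof. by apply/rowP => j; rewrite mxE; case: unliftP => [k|] ->; rewrite ?mxE. Qed.

Lemma col'B q q' : col' i (q - q') = col' i q - col' i q'.
Proof. by apply/rowP => j; rewrite !mxE. Qed.

Lemma col'Z c q : col' i (c *: q) = c *: col' i q.
Proof. by apply/rowP => j; rewrite !mxE. Qed.

Lemma edot_emb u v s t : edot (emb u s) (emb v t) = edot u v + s * t.
Proof.
rewrite /edot (bigD1_ord i)//= !emb_id addrC; congr (_ + _).
by apply: eq_bigr => k _; rewrite !emb_lift.
Qed.

Lemma embD u v s t : emb u s + emb v t = emb (u + v) (s + t).
Proof. by apply/rowP => j; rewrite !mxE; case: unliftP => [k|] _; rewrite ?mxE. Qed.

Lemma embZ c u t : c *: emb u t = emb (c *: u) (c * t).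
Proof. by apply/rowP => j; rewrite !mxE; case: unliftP => [k|] _; rewrite ?mxE. Qed.

Lemma embB u v s t : emb u s - emb v t = emb (u - v) (s - t).
Proof. by rewrite -scaleN1r embZ embD scaleN1r mulN1r. Qed.

Lemma sqr_enorm_emb u t : enorm (emb u t) ^+ 2 = enorm u ^+ 2 + t ^+ 2.
Proof. by rewrite !sqr_enorm edot_emb. Qed.

Lemma enorm_emb0 t : enorm (emb 0 t) = `|t|.
Proof. by rewrite /enorm edot_emb edot0l add0r -expr2 sqrtr_sqr. Qed.

Lemma enorm_le_emb u t : enorm u <= enorm (emb u t).
Proof.
rewrite -(@ler_pXn2r _ 2) ?nnegrE ?enorm_ge0// sqr_enorm_emb.
by rewrite lerDl sqr_ge0.
Qed.

Lemma enorm_col' q : enorm (col' i q) <= enorm q.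
Proof. by rewrite -[X in _ <= enorm X]emb_col' enorm_le_emb. Qed.

Lemma measurable_emb d (T : measurableType d) (D : set T) (f : T -> 'rV[R]_m)
    (g : T -> R) : measurable_fun D f -> measurable_fun D g ->
  measurable_fun D (fun x => emb (f x) (g x)).
Proof.
move=> mf mg; apply: measurable_fun_rV => j; under eq_fun do rewrite mxE.
by case: unliftP => [k|] _ //; exact: measurable_coord_comp.
Qed.

Lemma measurable_col' : measurable_fun setT (fun q => col' i q).
Proof.
by apply: measurable_fun_rV => k; under eq_fun do rewrite mxE; exact: measurable_coord.
Qed.

End insert_coordinate.

(* Strict differentiability of [g] at [x], with gradient [a]. *)
Definition sdiff (R : realType) m (g : 'rV[R]_m -> R) (x a : 'rV[R]_m) : Prop :=
  forall e, 0 < e -> exists2 eta, 0 < eta & forall u v, eball x eta u -> eball x eta v ->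
    `|g u - g v - edot a (u - v)| <= e * enorm (u - v).

Section strict_differentiability.
Variables (R : realType) (m : nat) (V : set 'rV[R]_m).
Variables (g : 'rV[R]_m -> R) (a : 'rV[R]_m -> 'rV[R]_m).
Hypothesis (oV : open V) (ga : forall x, V x -> sdiff g x (a x)).

(** Near [y] the same increments are estimated by the gradients at [x] and at [y]. Testing both
    estimates on an increment along [a y - a x] bounds the length of this difference. *)
Lemma sdiff_grad_continuous x e : V x -> 0 < e ->
  exists2 eta, 0 < eta & forall y, V y -> eball x eta y -> enorm (a y - a x) <= e.
Proof.
move=> Vx e0; have e20 : 0 < e / 2 by rewrite divr_gt0.
have [eta eta0 xP] := ga Vx e20; exists eta => // y Vy xy.
have [eta' eta'0 yP] := ga Vy e20.
have [->|ayx] := eqVneq (a y) (a x); first by rewrite subrr enorm0 ltW.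
set w := a y - a x; have w0 : 0 < enorm w by rewrite enorm_gt0 subr_eq0.
(* The increment [r *: w] has to stay both in the ball around [y] and in the ball around [x]. *)
have [r r0 rP] : exists2 r, 0 < r & r * enorm w < Num.min eta' (eta - enorm (y - x)).
  exists (Num.min eta' (eta - enorm (y - x)) / (2 * enorm w)).
    by rewrite divr_gt0 ?mulr_gt0// lt_min eta'0 subr_gt0.
  rewrite invfM mulrA divfK ?gt_eqF// ltr_pdivrMr// ltr_pMr ?ltr1n//.
  by rewrite lt_min eta'0 subr_gt0.
move: rP; rewrite lt_min => /andP[r1 r2].
pose u := y + r *: w.
have uy : u - y = r *: w by rewrite /u addrC addKr.
have yu : enorm (u - y) = r * enorm w by rewrite uy enormZ gtr0_norm.
have xu : eball x eta u.
  by rewrite /eball/= (le_lt_trans (ler_enormB _ y _))// yu -ltrBrDr.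
have yu' : eball y eta' u by rewrite /eball/= yu.
have := xP _ _ xu xy; have := yP _ _ yu' (eball_center y eta'0).
rewrite yu uy !edotZr => h1 h2.
have h : r * edot w w <= e * (r * enorm w).
  rewrite /w edotBl mulrBr -/w; move: h1 h2; rewrite !ler_norml => /andP[h1 h2] /andP[h3 h4].
  by lra.
move: h; rewrite mulrCA ler_pM2l// -sqr_enorm expr2.
by rewrite ler_pM2r.
Qed.

Lemma sdiff_continuous x e : V x -> 0 < e ->
  exists2 eta, 0 < eta & forall y, eball x eta y -> `|g y - g x| <= e.
Proof.
move=> Vx e0; have [eta eta0 xP] := ga Vx ltr01.
have c0 : 0 < 1 + enorm (a x) by rewrite ltr_pwDl// enorm_ge0.
exists (Num.min eta (e / (1 + enorm (a x)))); first by rewrite lt_min eta0 divr_gt0.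
move=> y; rewrite /eball/= lt_min => /andP[y1 y2].
have := xP _ _ y1 (eball_center x eta0).
have := cauchy_schwarz (a x) (y - x).
have : enorm (y - x) * (1 + enorm (a x)) <= e by rewrite -ler_pdivlMr// ltW.
rewrite !ler_norml mulrDr mulr1 mul1r (mulrC (enorm (y - x))).
by move=> h /andP[h1 h2] /andP[h3 h4]; apply/andP; split; lra.
Qed.

Lemma measurable_sdiff : measurable_fun V g.
Proof.
apply: continuous_measurable => // x; rewrite inE => Vx.
by apply: continuous_eball => e; exact: sdiff_continuous.
Qed.

Lemma measurable_grad : measurable_fun V a.
Proof.
apply: measurable_fun_rV => j.
apply: continuous_measurable => // x; rewrite inE => Vx.
apply: continuous_eball => e e0; have [eta eta0 xP] := sdiff_grad_continuous Vx e0.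
have [eta' eta'0 xV] := (open_eballP _).1 oV x Vx.
exists (Num.min eta eta'); first by rewrite lt_min eta0.
move=> y; rewrite /eball/= lt_min => /andP[y1 y2].
have := xP y (xV _ y2) y1; apply: le_trans.
by have := coord_le_enorm (a y - a x) j; rewrite !mxE.
Qed.

End strict_differentiability.

Section jacobian.
Variables (R : realType) (m : nat) (i : 'I_m.+1).
Implicit Types (a b : 'rV[R]_m).

(** The area factor of a graph with gradient [a], which is also the length of its normal
    [emb i (- a) 1]. *)
Definition jac a : R := Num.sqrt (1 + edot a a).

Lemma jac_ge1 a : (1 <= jac a)%R.
Proof. by rewrite -[X in (X <= _)%R]sqrtr1 ler_wsqrtr// lerDl edot_ge0. Qed.

Lemma jac_gt0 a : (0 < jac a)%R. Proof. exact: lt_le_trans ltr01 (jac_ge1 a). Qed.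

Lemma jacE a : jac a = enorm (emb i a 1).
Proof. by rewrite /jac /enorm edot_emb mulr1 addrC. Qed.

(** The triangle inequality for the vectors [emb i a 1] and [emb i b 1]. *)
Lemma jac_lipschitz a b : (jac a <= jac b + enorm (a - b))%R.
Proof.
rewrite !jacE -(@subrK _ (emb i b 1) (emb i a 1)) addrC.
by rewrite (le_trans (ler_enormD _ _))// lerD2l embB subrr /enorm edot_emb mulr0 addr0.
Qed.

End jacobian.

Section linear_graph.
Variables (R : realType) (m' : nat).
Local Notation m := m'.+1.
Variable (i : 'I_m.+1).
Implicit Types (a u v : 'rV[R]_m).
Local Open Scope ereal_scope.

Definition lin a u : 'rV[R]_m.+1 := emb i u (edot a u).

Lemma linB a u v : (lin a u - lin a v = lin a (u - v))%R.
Proof. by rewrite /lin embB edotBr. Qed.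

(* After a reflection carrying [a] to a multiple of the first basis vector, the
   graph map of [edot a] stretches lengths exactly as a diagonal map does. *)
Lemma hmeasure_lin a A : measurable A ->
  hmeasure m (lin a @` A) = (jac a)%:E * leb R m A.
Proof.
move=> mA; pose b : 'rV[R]_m := consv (enorm a, 0%R).
have ab : enorm a = enorm b.
  by rewrite [RHS]/enorm edot_consv edot0l addr0 -expr2 sqrtr_sqr ger0_norm// enorm_ge0.
pose O := refl (a - b); pose f u := stretch (jac a) (O u).
have j0 := jac_gt0 a.
rewrite (@hmeasure_isometry _ _ _ _ _ A (lin a) f); last first.
  move=> u v _ _.
  rewrite linB /f -stretchB /O -reflB; set w := (u - v)%R.
  apply/eqP; rewrite -(@eqrXn2 _ 2) ?enorm_ge0//; apply/eqP.
  rewrite sqr_enorm_stretch /lin sqr_enorm_emb enorm_refl [(jac a ^+ 2)%R]sqr_sqrtr; last first.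
    by rewrite addr_ge0 ?edot_ge0.
  have -> : edot a w = (enorm a * refl (a - b) w 0 ord0)%R.
    rewrite -(edot_refl (a - b) a w) refl_swap//.
    rewrite -[X in edot _ X = _]unconsK /b edot_consv edot0l addr0 /=.
    by congr (_ * _)%R.
  by rewrite exprMn (sqr_enorm a) addrAC subrr add0r.
have jV0 : (0 < (jac a)^-1)%R by rewrite invr_gt0.
have fE : f @` A = stretch (jac a)^-1 @^-1` (O @^-1` A).
  apply/seteqP; split => [_ [u Au <-]|u Au].
    by rewrite /= /f stretchK ?gt_eqF// /O reflK.
  exists (O (stretch (jac a)^-1 u)) => //; rewrite /f {1}/O reflK.
  by rewrite -{1}[jac a]invrK stretchK// invr_eq0 gt_eqF.
have mO : measurable (O @^-1` A) by exact: measurable_preimage (measurable_refl _) mA.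
rewrite hmeasure_leb; last first.
  by rewrite fE; exact: measurable_preimage (measurable_stretch _) mO.
by rewrite fE leb_stretch// invrK leb_refl.
Qed.

End linear_graph.

Section density.
Import HBNNSimple.

(** The density is tested on measurable subsets of [D] only, which is what the area formula supplies
    on a chart. Simple functions and monotone convergence extend it to [h]. *)
Lemma integral_density d (T : measurableType d) (R : realType)
    (mu nu : {measure set T -> \bar R}) (D : set T) (J : T -> R) (h : T -> \bar R) :
  measurable D -> measurable_fun D J -> (forall x, D x -> 0 <= J x) ->
  (forall A, measurable A -> A `<=` D -> nu A = \int[mu]_(x in A) (J x)%:E)%E ->
  measurable_fun D h -> (forall x, D x -> 0 <= h x)%E ->
  (\int[nu]_(x in D) h x = \int[mu]_(x in D) (h x * (J x)%:E))%E.
Proof.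
move=> mD mJ' J0 nuE mh h0.
have mJ : measurable_fun D (EFin \o J) by exact/measurable_EFinP.
pose f_ := nnsfun_approx mD mh.
have nd x : nondecreasing_seq (f_ ^~ x).
  by move=> p q pq; exact/lefP/nd_nnsfun_approx.
have cvg_f x : D x -> (f_ n x)%:E @[n --> \oo] --> h x.
  by move=> Dx; apply: cvg_nnsfun_approx.
have mf n : measurable_fun D (EFin \o f_ n).
  by apply/measurable_EFinP; apply: measurable_funTS; exact: measurable_funP.
transitivity (limn (fun n => \int[nu]_(x in D) (f_ n x)%:E)%E).
  rewrite -monotone_convergence//.
  - by apply: eq_integral => x; rewrite inE => Dx; apply/esym/cvg_lim => //; exact: cvg_f.
  - by move=> n x _; rewrite lee_fin.
  - by move=> x _ p q pq; rewrite lee_fin; exact: nd.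
transitivity (limn (fun n => \int[mu]_(x in D) ((f_ n x)%:E * (J x)%:E))%E); last first.
  rewrite -monotone_convergence//.
  - apply: eq_integral => x; rewrite inE => Dx; apply/cvg_lim => //.
    by have := cvgeMr (isT : (J x)%:E \is a fin_num) (cvg_f x Dx).
  - by move=> n; exact: (emeasurable_funM (mf n) mJ).
  - by move=> n x Dx; rewrite mule_ge0 ?lee_fin ?J0.
  - move=> x Dx p q pq; apply: lee_wpmul2r; first by rewrite lee_fin J0.
    by rewrite lee_fin; exact: nd.
congr (limn _); apply/funext => n.
transitivity (\sum_(k \in range (f_ n))
    \int[nu]_(x in D) (k * \1_(f_ n @^-1` [set k]) x)%:E)%E.
  under eq_integral do rewrite fimfunE -fsumEFin//.
  rewrite ge0_integral_fsum// => [k|k x _].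
    exact/measurable_EFinP/measurable_funM.
  by rewrite nnfun_muleindic_ge0.
transitivity (\sum_(k \in range (f_ n))
    \int[mu]_(x in D) ((k * \1_(f_ n @^-1` [set k]) x)%:E * (J x)%:E))%E; last first.
  rewrite -ge0_integral_fsum//.
  - apply: eq_integral => x _.
    rewrite [in RHS]fimfunE -fsumEFin// ge0_mule_fsuml// => k.
    by rewrite nnfun_muleindic_ge0.
  - move=> k; apply: emeasurable_funM => //.
    exact/measurable_EFinP/measurable_funM.
  - by move=> k x Dx; rewrite mule_ge0 ?nnfun_muleindic_ge0 ?lee_fin ?J0.
apply: eq_fsbigr => k; rewrite inE => -[y _ yk].
have k0 : 0 <= k by rewrite -yk.
have mI : measurable (D `&` f_ n @^-1` [set k]) by exact: measurableI.
have m1 : measurable_fun D (fun x => (\1_(f_ n @^-1` [set k]) x)%:E : \bar R).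
  by apply/measurable_EFinP; exact: measurable_indic.
under eq_integral do rewrite EFinM.
rewrite ge0_integralZl//=.
rewrite integral_indic// (setIC _ D) (nuE _ mI (@subIsetl _ _ _)).
under [RHS]eq_integral do rewrite EFinM -muleA.
rewrite ge0_integralZl//; last 2 first.
- exact: (emeasurable_funM m1 mJ).
- by move=> x Dx; rewrite mule_ge0 ?lee_fin ?J0.
congr (_ * _)%E; rewrite integral_mkcondr; apply: eq_integral => x _.
by rewrite patchE indicE; case: ifPn => _; rewrite ?mul1e ?mul0e.
Qed.

End density.

(** In the induction the factor [1 + t] produces the terms [t] and [3 ^+ k * t * t], each at most
    [3 ^+ k * t]; hence a factor 3 per step. *)
Lemma expr_onem_le (R : realType) (k : nat) (t : R) : 0 <= t <= 1 ->
  (1 + t) ^+ k <= 1 + 3 ^+ k * t.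
Proof.
move=> /andP[t0 t1]; elim: k => [|k IHk]; first by rewrite !expr0 mul1r lerDl.
rewrite exprS (le_trans (ler_wpM2l _ IHk)) ?addr_ge0//.
have k1 : 1 <= 3 ^+ k :> R by rewrite exprn_ege1// ler1n.
have : t * (3 ^+ k * t) <= 3 ^+ k * t.
  by rewrite mulrC -mulrA ler_wpM2l// ?exprn_ge0// ler_piMr.
have : t <= 3 ^+ k * t by rewrite ler_peMl.
by rewrite exprS; lra.
Qed.

(** Lets the distortion [c] of a comparison tend to 1. An infinite [y] is allowed. *)
Lemma lee_expr_mul (R : realType) (k : nat) (x y : \bar R) : (0 <= y)%E ->
  (forall c : R, (1 < c)%R -> x <= (c ^+ k)%:E * y)%E -> (x <= y)%E.
Proof.
case: y => [y| |]; [|by move=> _ _; rewrite leey|by rewrite leNgt ltNy0].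
rewrite lee_fin => y0 xy; apply/lee_addgt0Pr => e e0.
have K0 : 0 < 3 ^+ k * (y + 1) :> R by rewrite mulr_gt0 ?exprn_gt0// ltr_wpDl.
pose t := Num.min 1 (e / (3 ^+ k * (y + 1))).
have t0 : 0 < t by rewrite lt_min ltr01 divr_gt0.
have t1 : t <= 1 by rewrite ge_min lexx.
have te : t * (3 ^+ k * (y + 1)) <= e by rewrite -ler_pdivlMr// ge_min lexx orbT.
have t01 : 0 <= t <= 1 by rewrite ltW.
apply: (le_trans (xy (1 + t) _)); first by rewrite ltrDl.
rewrite -EFinM -EFinD lee_fin (le_trans (ler_wpM2r y0 (expr_onem_le k t01)))//.
have : 0 <= 3 ^+ k * t by rewrite mulr_ge0 ?exprn_ge0// ltW.
by move: te; rewrite mulrA (mulrC t (3 ^+ k)); set z := 3 ^+ k * t => te z0; lra.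
Qed.

Section area_formula.
Variables (R : realType) (m' : nat).
Local Notation m := m'.+1.
Variables (i : 'I_m.+1) (V : set 'rV[R]_m).
Variables (g : 'rV[R]_m -> R) (a : 'rV[R]_m -> 'rV[R]_m).
Hypothesis (oV : open V) (ga : forall x, V x -> sdiff g x (a x)).
Local Open Scope ereal_scope.

Definition gr u : 'rV[R]_m.+1 := emb i u (g u).
Local Notation J u := (jac (a u)).
Local Notation hm := (@hmeasure R m m.+1).

(** The graph over [A] is the zero set of [q 0 i - g (col' i q)] in the cylinder over [A], so no
    theorem on images of Borel sets is called for. *)
Lemma measurable_gr_image A : measurable A -> A `<=` V -> measurable (gr @` A).
Proof.
move=> mA AV; pose D := [set q : 'rV[R]_m.+1 | A (col' i q)].
have mD : measurable D by exact: measurable_preimage (measurable_col' i) mA.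
have mf : measurable_fun D (fun q => q 0 i - g (col' i q))%R.
  apply: measurable_funB; first exact: measurable_funTS (measurable_coord i).
  apply: (@measurable_comp _ _ _ _ _ _ V g D (fun q => col' i q)).
  - exact: measurable_open.
  - by move=> _ [q Dq <-]; exact: AV.
  - exact: measurable_sdiff oV ga.
  - exact: measurable_funTS (measurable_col' i).
rewrite (_ : gr @` A = D `&` (fun q : 'rV[R]_m.+1 => q 0 i - g (col' i q))%R @^-1` [set 0%R]).
  by apply: mf => //; exact: measurable_set1.
apply/seteqP; split => [_ [u Au <-]|q [Dq /= /eqP]].
  by rewrite /D/= /gr col'_emb emb_id subrr.
by rewrite subr_eq0 => /eqP qg; exists (col' i q) => //; rewrite /gr -qg emb_col'.
Qed.

Lemma gr_inj u v : gr u = gr v -> u = v.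
Proof. by move=> uv; rewrite -(col'_emb i u (g u)) -/(gr u) uv col'_emb. Qed.

Lemma measurable_jac : measurable_fun V (fun u => J u).
Proof.
have ma := measurable_grad oV ga.
have -> : (fun u => J u) = (fun u => enorm (emb i (a u) 1%R)).
  by apply/funext => u; rewrite (jacE i).
by apply: measurable_enorm; apply: measurable_emb => //; exact: measurable_cst.
Qed.

Lemma measurable_gr : measurable_fun V gr.
Proof.
by apply: measurable_emb; [exact: measurable_id|exact: measurable_sdiff oV ga].
Qed.

(** The differences of the two graph maps deviate only in the last coordinate, by the strict
    differentiability error, which is at most [e] times the length of the linear increment. *)
Lemma gr_bilipschitz x c : V x -> (1 < c)%R -> exists2 eta, (0 < eta)%R &
  forall u v, eball x eta u -> eball x eta v ->
    (enorm (gr u - gr v) <= c * enorm (lin i (a x) u - lin i (a x) v))%R /\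
    (enorm (lin i (a x) u - lin i (a x) v) <= c * enorm (gr u - gr v))%R.
Proof.
move=> Vx c1; have c0 : (0 < c)%R by rewrite (lt_trans ltr01).
(* This value satisfies [1 + e <= c] and [1 - e = c^-1], which are the upper and the lower bound. *)
pose e := ((c - 1) / c)%R.
have e0 : (0 < e)%R by rewrite divr_gt0// subr_gt0.
have [eta eta0 xP] := ga Vx e0; exists eta => // u v xu xv.
have d : (enorm ((gr u - gr v) - (lin i (a x) u - lin i (a x) v)) <=
    e * enorm (lin i (a x) u - lin i (a x) v))%R.
  rewrite linB /gr /lin !embB subrr enorm_emb0 (le_trans (xP _ _ xu xv))//.
  by rewrite ler_wpM2l ?(ltW e0)// enorm_le_emb.
have ce : (c * e = c - 1)%R by rewrite /e mulrC divfK// gt_eqF.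
have ec : (e <= c - 1)%R by rewrite ler_pdivrMr// ler_peMr ?subr_ge0 ?ltW.
move: d; set p := (gr u - gr v)%R; set q := (lin _ _ _ - _)%R => d.
have q0 : (0 <= enorm q)%R by exact: enorm_ge0.
split.
  have := ler_enormD (p - q) q; rewrite subrK => h.
  have : (e * enorm q <= (c - 1) * enorm q)%R by rewrite ler_wpM2r.
  by rewrite mulrBl mul1r; lra.
have := ler_enormD (q - p) p; rewrite subrK enormBC => h.
have : (c * enorm q <= c * (e * enorm q + enorm p))%R by rewrite ler_pM2l//; lra.
by rewrite mulrDr mulrA ce mulrBl mul1r; lra.
Qed.

(** The exponent [m.+1] collects [c ^+ m] from the Lipschitz bounds on an [m]-dimensional measure
    and one more [c] from the variation of the area factor. *)
Definition comparable (c : R) (E : set 'rV[R]_m) := forall A, measurable A -> A `<=` E ->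
  hm (gr @` A) <= (c ^+ m.+1)%:E * \int[leb R m]_(u in A) (J u)%:E /\
  \int[leb R m]_(u in A) (J u)%:E <= (c ^+ m.+1)%:E * hm (gr @` A).

Lemma comparable_local x c : V x -> (1 < c)%R ->
  exists eta, [/\ (0 < eta)%R, eball x eta `<=` V & comparable c (eball x eta)].
Proof.
move=> Vx c1; have c0 : (0 < c)%R by rewrite (lt_trans ltr01).
have [eta1 eta10 bl] := gr_bilipschitz Vx c1.
have [eta2 eta20 V2] := (open_eballP _).1 oV x Vx.
have c10 : (0 < c - 1)%R by rewrite subr_gt0.
have [eta3 eta30 a3] := sdiff_grad_continuous ga Vx c10.
pose eta := Num.min eta1 (Num.min eta2 eta3).
have sub y : eball x eta y -> [/\ eball x eta1 y, V y & eball x eta3 y].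
  by rewrite /eball/= !lt_min => /and3P[h1 h2 h3]; split => //; exact: V2.
exists eta; split; first by rewrite !lt_min eta10 eta20.
  by move=> y /sub[].
move=> A mA AE.
have AV : A `<=` V by move=> y /AE/sub[].
have mJA : measurable_fun A (fun u => (J u)%:E).
  apply/measurable_EFinP; apply: measurable_funS measurable_jac => //.
  exact: measurable_open.
(* Since [jac] is at least 1, the additive error [c - 1] is at most [c - 1] times the factor: it
   becomes multiplicative. *)
have J1 u : A u -> (J x <= c * J u)%R.
  move=> /AE/sub[_ Vu u3]; have := jac_lipschitz i (a x) (a u).
  have := a3 _ Vu u3; rewrite enormBC => h1 h2.
  have : ((c - 1) * 1 <= (c - 1) * J u)%R by rewrite ler_pM2l// jac_ge1.
  by rewrite mulrBl mul1r mulr1; lra.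
have J2 u : A u -> (J u <= c * J x)%R.
  move=> /AE/sub[_ Vu u3]; have := jac_lipschitz i (a u) (a x).
  have := a3 _ Vu u3 => h1 h2.
  have : ((c - 1) * 1 <= (c - 1) * J x)%R by rewrite ler_pM2l// jac_ge1.
  by rewrite mulrBl mul1r mulr1; lra.
have cm0 : (0 <= c ^+ m)%R by rewrite exprn_ge0// ltW.
split.
  apply: (@le_trans _ _ ((c ^+ m)%:E * hm (lin i (a x) @` A))).
    apply: hmeasure_lipschitz => // u v Au Av.
    by have [u1 _ _] := sub _ (AE _ Au); have [v1 _ _] := sub _ (AE _ Av);
       have [] := bl _ _ u1 v1.
  rewrite [in leRHS]exprSr EFinM -muleA lee_wpmul2l ?lee_fin// hmeasure_lin//.
  rewrite -integral_cst// -ge0_integralZl//; last 2 first.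
  - by move=> u _; rewrite lee_fin ltW// jac_gt0.
  - by rewrite lee_fin ltW.
  apply: ge0_le_integral => //.
  - by move=> u _; rewrite lee_fin ltW// jac_gt0.
  - by apply: emeasurable_funM => //; exact: measurable_cst.
apply: (@le_trans _ _ (c%:E * hm (lin i (a x) @` A))).
  rewrite hmeasure_lin// muleA -EFinM -integral_cst//; apply: ge0_le_integral => //.
  - by move=> u _; rewrite lee_fin ltW// jac_gt0.
rewrite [in leRHS]exprS EFinM -muleA; apply: lee_wpmul2l; first by rewrite lee_fin ltW.
apply: hmeasure_lipschitz => // u v Au Av.
by have [u1 _ _] := sub _ (AE _ Au); have [v1 _ _] := sub _ (AE _ Av);
   have [] := bl _ _ u1 v1.
Qed.

End area_formula.

(** Each good ball contains a ball around the same point with rational centre and radius [1 / n.+1],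
    and [P] passes to it by heredity. The countable list of such balls keeps those that satisfy [P];
    [P set0] fills the other indices. *)
Lemma eball_lindelof (R : realType) k (V : set 'rV[R]_k) (P : set 'rV[R]_k -> Prop) :
  P set0 -> (forall E F, E `<=` F -> P F -> P E) ->
  (forall x, V x -> exists2 eta, 0 < eta & P (eball x eta)) ->
  exists E : nat -> set 'rV[R]_k,
    [/\ forall n, open (E n), forall n, P (E n) & V `<=` \bigcup_n E n].
Proof.
move=> P0 PS VP.
pose q (c : 'rV[rat]_k) : 'rV[R]_k := \row_i ratr (c 0 i).
pose B (x : 'rV[rat]_k * nat) := eball (q x.1) (x.2.+1%:R^-1 : R).
pose E n := if unpickle n is Some x then (if `[< P (B x) >] then B x else set0) else set0.
exists E; split.
- rewrite /E => n; case: unpickle => [x|]; last exact: open0.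
  by case: ifP => _; [exact: open_eball|exact: open0].
- by rewrite /E => n; case: unpickle => [x|//]; case: asboolP.
move=> x Vx; have [eta eta0 Peta] := VP x Vx.
have [n neta] : exists n : nat, n.+1%:R^-1 < eta / 2.
  have /ltr_add_invr[n] : 0 < eta / 2 by rewrite divr_gt0.
  by rewrite add0r => ?; exists n.
have d0 : 0 < n.+1%:R^-1 / k.+1%:R :> R by rewrite divr_gt0// invr_gt0.
have /choice[c cP] (i : 'I_k) : exists c : rat,
    `|x 0 i - ratr c| < n.+1%:R^-1 / k.+1%:R.
  have /rat_in_itvoo[c] : x 0 i - n.+1%:R^-1 / k.+1%:R < x 0 i + n.+1%:R^-1 / k.+1%:R.
    by rewrite ltrD2l gtrN.
  by rewrite in_itv/= => /andP[c1 c2]; exists c; rewrite distrC ltr_distl c1 c2.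
pose y := (\row_i c i, n).
have yx : enorm (x - q y.1) < n.+1%:R^-1.
  apply: (@le_lt_trans _ _ (k%:R * (n.+1%:R^-1 / k.+1%:R))).
    by apply: enorm_le_sup => i; rewrite !mxE ltW.
  by rewrite mulrCA gtr_pMr ?invr_gt0// ltr_pdivrMr// mul1r ltr_nat.
have PB : P (B y).
  apply: PS Peta => z; rewrite /B/= /eball/= => yz.
  rewrite (le_lt_trans (ler_enormB _ (q y.1) _))// [eta]splitr.
  by rewrite ltrD// (lt_trans _ neta)// enormBC.
exists (pickle y) => //; rewrite /E pickleK; case: asboolP => //.
Qed.

Lemma ge0_integral_mrestr d (T : measurableType d) (R : realType)
    (mu : {measure set T -> \bar R}) (D G : set T) (mG : measurable G)
    (f : T -> \bar R) : measurable D -> G `<=` D -> measurable_fun D f ->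
  (forall x, D x -> 0 <= f x)%E ->
  (\int[mrestr mu mG]_(x in D) f x = \int[mu]_(x in G) f x)%E.
Proof.
move=> mD GD mf f0.
have mDG : measurable (D `\` G) by exact: measurableD.
rewrite (@ge0_negligible_integral _ _ _ (mrestr mu mG) D (D `\` G))//; last first.
  apply: (@eq_trans _ _ (mu set0)); last exact: measure0.
  apply: (congr1 mu).
  by rewrite -subset0 => x [[_ nG] /nG].
rewrite setDD setIidr//; apply: eq_measure_integral => A mA AG.
by apply: (congr1 mu); exact: setIidl.
Qed.

Section area_formula.
Variables (R : realType) (m' : nat).
Local Notation m := m'.+1.
Variables (i : 'I_m.+1) (V : set 'rV[R]_m).
Variables (g : 'rV[R]_m -> R) (a : 'rV[R]_m -> 'rV[R]_m).
Hypothesis (oV : open V) (ga : forall x, V x -> sdiff g x (a x)).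
Local Open Scope ereal_scope.
Local Notation gr := (gr i g).
Local Notation J u := (jac (a u)).
Local Notation hm := (@hmeasure R m m.+1).

(** Both sides are countably additive in [A], so it is enough to cut [A] into disjoint measurable
    pieces, each inside a set of a countable cover; the constant does not deteriorate. *)
Lemma comparable_global c : (1 < c)%R -> comparable i g a c V.
Proof.
move=> c1 A mA AV.
pose P E := comparable i g a c E /\ E `<=` V.
have [||x Vx|E [oE PE VE]] := @eball_lindelof R m V P.
- split => // B mB; rewrite subset0 => ->.
  by rewrite image_set0 measure0 integral_set0 mule0.
- move=> E F EF [cF FV]; split; last exact: subset_trans FV.
  by move=> B mB BE; apply: cF => //; exact: subset_trans EF.
- by have [eta [eta0 etaV ceta]] := comparable_local i oV ga Vx c1; exists eta.
pose B n := A `&` seqDU E n.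
have mB n : measurable (B n).
  by apply: measurableI => //; apply: seqDU_measurable => k; exact: measurable_open.
have tB : trivIset setT B.
  by apply: trivIset_setIl; exact: trivIset_seqDU.
have AB : A = \bigcup_n B n.
  by rewrite -setI_bigcupr -seqDU_bigcup_eq; apply/esym; apply: setIidl;
     exact: subset_trans VE.
have BE n : B n `<=` E n by move=> x [_ h]; exact: subset_seqDU h.
have BV n : B n `<=` V by exact: subset_trans (PE n).2.
have mgB n : measurable (gr @` B n) by exact: (measurable_gr_image i oV ga).
have c0 : (0 <= c ^+ m.+1)%R by rewrite exprn_ge0// (le_trans ler01)// ltW.
have J0 u : 0 <= (J u)%:E by rewrite lee_fin ltW// jac_gt0.
have -> : hm (gr @` A) = \sum_(0 <= n <oo) hm (gr @` B n).
  rewrite AB image_bigcup measure_semi_bigcup//; last exact: bigcupT_measurable.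
  apply/trivIsetP => p q _ _ pq; rewrite -subset0 => _ [[u Bu <-] [v Bv /gr_inj vu]].
  have : (B p `&` B q) u by split; [exact: Bu|rewrite -vu].
  by move/trivIsetP : tB => /(_ p q I I pq) ->.
have -> : \int[leb R m]_(u in A) (J u)%:E = \sum_(0 <= n <oo) \int[leb R m]_(u in B n) (J u)%:E.
  rewrite AB ge0_integral_bigcup// -AB; apply/measurable_EFinP.
  by apply: measurable_funS (measurable_jac i oV ga) => //; exact: measurable_open.
rewrite -!nneseriesZl; last 2 first.
- by move=> n _.
- by move=> n _; exact: integral_ge0.
split; apply: lee_nneseries => n *; rewrite ?integral_ge0//.
- by have [] := (PE n).1 _ (mB n) (BE n).
- by have [] := (PE n).1 _ (mB n) (BE n).
Qed.

Lemma area_measure A : measurable A -> A `<=` V ->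
  hm (gr @` A) = \int[leb R m]_(u in A) (J u)%:E.
Proof.
move=> mA AV; have J0 u : 0 <= (J u)%:E by rewrite lee_fin ltW// jac_gt0.
apply/eqP; rewrite eq_le; apply/andP; split; apply: (@lee_expr_mul _ m.+1).
- exact: integral_ge0.
- by move=> c c1; have [] := comparable_global c1 mA AV.
- exact: measure_ge0.
- by move=> c c1; have [] := comparable_global c1 mA AV.
Qed.

(** The restriction of [hm] to the graph is pushed down to the chart by [col' i]; [area_measure]
    says that the image has density [J] with respect to [leb]. *)
Theorem area_formula (F : 'rV[R]_m.+1 -> \bar R) :
  measurable_fun (gr @` V) F -> (forall q, 0 <= F q) ->
  \int[hm]_(q in gr @` V) F q = \int[leb R m]_(u in V) (F (gr u) * (J u)%:E).
Proof.
move=> mF F0.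
have mV : measurable V by exact: measurable_open.
have mG : measurable (gr @` V) by exact: (measurable_gr_image i oV ga).
have [nu nuE] := pushforward_measureW (mrestr hm mG) (measurable_col' i).
have mgr : measurable_fun V gr by exact: (measurable_gr i oV ga).
have mFgr : measurable_fun V (F \o gr).
  by apply: (measurable_comp mG _ mF mgr) => _ [u Vu <-]; exists u.
have nuA A : measurable A -> A `<=` V -> nu A = hm (gr @` A).
  move=> mA AV; rewrite nuE; apply: (congr1 hm).
  apply/seteqP; split => [q [/= Aq [u Vu uq]]|_ [u Au <-]].
    by move: Aq; rewrite -uq /gr col'_emb => Au; exists u.
  by split; [rewrite /= /gr col'_emb|exists u => //; exact: AV].
rewrite -(@integral_density _ _ _ (leb R m) nu V (fun u => J u) (F \o gr))//; last 4 first.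
- exact: (measurable_jac i oV ga).
- by move=> x _; rewrite ltW// jac_gt0.
- by move=> A mA AV; rewrite nuA// area_measure.
- by move=> x _; exact: F0.
rewrite -(ge0_integral_preserving (mu := mrestr hm mG) (measurable_col' i))//; last 2 first.
- by move=> A mA AV; rewrite nuE.
- by move=> x _; exact: F0.
have mD : measurable ((fun q => col' i q) @^-1` V).
  exact: (measurable_preimage (measurable_col' i) mV).
rewrite ge0_integral_mrestr//.
- by apply: eq_integral => _ /[!inE] -[u Vu <-]; rewrite /= /gr col'_emb.
- by move=> _ [u Vu <-]; rewrite /= /gr col'_emb.
- apply: (@measurable_comp _ _ _ _ _ _ V (F \o gr) _ (fun q => col' i q)) => //.
    by move=> _ [q Dq <-].
  exact: measurable_funTS (measurable_col' i).
- by move=> q _; exact: F0.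
Qed.

End area_formula.

(** * Tangent spaces and normals *)

Section velocity.
Variables (R : realType) (k : nat).
Implicit Types (gamma : R -> 'rV[R]_k) (v : 'rV[R]_k).

Lemma velocityP gamma v : is_derive (0 : R) 1 gamma v <->
  forall e, 0 < e -> exists2 d, 0 < d & forall h, h != 0 -> `|h| < d ->
    enorm (h^-1 *: (gamma h - gamma 0) - v) <= e.
Proof.
have E : (fun h : R => h^-1 *: ((gamma \o shift (0 : R)) (h *: (1 : R)) - gamma 0)) =
    (fun h => h^-1 *: (gamma h - gamma 0)).
  by apply/funext => h /=; rewrite addr0 /GRing.scale/= mulr1.
split=> [dg e e0|H].
  have : (fun h => h^-1 *: (gamma h - gamma 0)) @ 0^' --> v.
    by rewrite -E -(@derive_val _ _ _ _ _ _ _ dg); exact: (@ex_derive _ _ _ _ _ _ _ dg).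
  move=> /(_ (eball v e)) []; first by apply/nbhs_eball; exists e.
  move=> d /= d0 dP; exists d => // h h0 hd; apply: ltW; apply: dP => //.
  by rewrite /= sub0r normrN.
have cv : (fun h => h^-1 *: (gamma h - gamma 0)) @ 0^' --> v.
  move=> A /nbhs_eball[e e0 eA]; have [d d0 dP] := H (e / 2) (divr_gt0 e0 (ltr0Sn R 1)).
  exists d => //= h; rewrite /= sub0r normrN => hd h0; apply: eA.
  by rewrite /eball/= (le_lt_trans (dP _ h0 hd))// ltr_pdivrMr// ltr_pMr// ltr1n.
apply: DeriveDef; first by rewrite /derivable E; apply/cvg_ex; exists v.
by rewrite /derive E; exact/cvg_lim.
Qed.

End velocity.

Section graph_tangent.
Variables (R : realType) (m : nat) (S U : set 'rV[R]_m.+1) (i : 'I_m.+1).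
Variables (V : set 'rV[R]_m) (g : 'rV[R]_m -> R) (p : 'rV[R]_m.+1) (a : 'rV[R]_m).
Hypotheses (oU : open U) (Up : U p) (Sp : S p) (oV : open V).
Hypothesis SU : S `&` U = [set q | V (col' i q) /\ q 0 i = g (col' i q)].
Hypothesis ga : sdiff g (col' i p) a.

(** For a velocity [v], one small time [h] suffices for each [e]: the difference quotient [w] is
    close to [v], and it nearly satisfies the linear equation because the curve stays on the graph.
    Conversely, a vector in the hyperplane is the velocity of a lifted segment. *)
Lemma tangent_graph : tangent S p = [set v : 'rV[R]_m.+1 | v 0 i = edot a (col' i v)].
Proof.
have [Vp pg] : V (col' i p) /\ p 0 i = g (col' i p).
  by have : (S `&` U) p by []; rewrite SU.
apply/seteqP; split => [v [gamma [g0 gS /velocityP gv]]|v /= vi].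
  apply/eqP; rewrite -subr_eq0 -normr_eq0 eq_le normr_ge0 andbT.
  apply/ler_addgt0Pr => e e0; rewrite add0r.
  (* [C] is the sum of the coefficients of [e1] in the three error bounds [d1], [d2] and [d3]
     below. *)
  pose C := 2 + enorm a + enorm v.
  have C0 : 0 < C by rewrite /C -addrA ltr_pwDl ?addr_ge0 ?enorm_ge0.
  pose e1 := Num.min 1 (e / C).
  have e10 : 0 < e1 by rewrite lt_min ltr01 divr_gt0.
  have e1C : e1 * C <= e by rewrite -ler_pdivlMr// ge_min lexx orbT.
  have e11 : e1 <= 1 by rewrite ge_min lexx.
  have [eta eta0 xP] := ga e10.
  have [r r0 rU] := (open_eballP _).1 oU _ Up.
  have [d d0 dP] := gv _ e10.
  case: gS => s /= s0 sS.
  have v10 : 0 < 1 + enorm v by rewrite ltr_pwDl ?enorm_ge0.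
  (* Below [b] the curve is in [S], inside [U] and above the ball of radius [eta], and its
     difference quotient is within [e1] of [v]. *)
  pose b := Num.min (Num.min d s) (Num.min r eta / (1 + enorm v)).
  have b0 : 0 < b by rewrite !lt_min d0 s0 divr_gt0// lt_min r0.
  pose h := b / 2; have h0 : 0 < h by rewrite divr_gt0.
  have hb : h < b by rewrite ltr_pdivrMr// ltr_pMr// ltr1n.
  move: hb; rewrite /b !lt_min => /andP[/andP[hd hs]].
  rewrite ltr_pdivlMr// lt_min => /andP[hr heta].
  have nh : `|h| = h by rewrite gtr0_norm.
  have := dP h (lt0r_neq0 h0); rewrite nh => /(_ hd).
  have Sh : S (gamma h) by apply: sS; rewrite /= sub0r normrN nh.
  rewrite g0; set w := h^-1 *: (gamma h - p) => wv.
  have gw : gamma h - p = h *: w by rewrite scalerA divff ?scale1r// gt_eqF.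
  have wn : enorm w <= 1 + enorm v.
    by have := ler_enormD (w - v) v; rewrite subrK; lra.
  have gp : enorm (gamma h - p) <= h * (1 + enorm v).
    by rewrite gw enormZ nh ler_pM2l.
  have Uh : U (gamma h) by apply: rU; rewrite /eball/= (le_lt_trans gp).
  have [_ hg] : V (col' i (gamma h)) /\ gamma h 0 i = g (col' i (gamma h)).
    by have : (S `&` U) (gamma h) by []; rewrite SU.
  have xh : eball (col' i p) eta (col' i (gamma h)).
    by rewrite /eball/= -col'B (le_lt_trans (enorm_col' _ _))// (le_lt_trans gp).
  have := xP _ _ xh (eball_center _ eta0); rewrite -hg -pg -col'B gw.
  rewrite -row_subE gw col'Z edotZr enormZ nh mxE -mulrBr normrM nh mulrCA ler_pM2l//.
  move=> H.
  have d1 : `|v 0 i - w 0 i| <= e1.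
    by rewrite -row_subE (le_trans (coord_le_enorm _ i))// enormBC.
  have d2 : `|edot a (col' i w) - edot a (col' i v)| <= enorm a * e1.
    rewrite -edotBr -col'B (le_trans (cauchy_schwarz _ _))// ler_wpM2l ?enorm_ge0//.
    by rewrite (le_trans (enorm_col' _ _)).
  have d3 : `|w 0 i - edot a (col' i w)| <= e1 * (1 + enorm v).
    by rewrite (le_trans H)// ler_pM2l// (le_trans (enorm_col' _ _)).
  apply: le_trans e1C.
  have -> : v 0 i - edot a (col' i v) = (v 0 i - w 0 i) + (w 0 i - edot a (col' i w))
    + (edot a (col' i w) - edot a (col' i v)) by ring.
  rewrite (le_trans (ler_normD _ _))//.
  have := ler_normD (v 0 i - w 0 i) (w 0 i - edot a (col' i w)).
  by rewrite /C; move: d1 d2 d3; lra.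
(* The curve is the lift to the graph of the straight line through [x] with velocity [v']. *)
pose x := col' i p; pose v' := col' i v.
exists (fun t => emb i (x + t *: v') (g (x + t *: v'))); split.
- by rewrite scale0r addr0 -pg emb_col'.
- have [r r0 rV] := (open_eballP _).1 oV _ Vp.
  have v10 : 0 < 1 + enorm v' by rewrite ltr_pwDl ?enorm_ge0.
  apply/nbhs_ballP; exists (r / (1 + enorm v')) => /=; first by rewrite divr_gt0.
  move=> t; rewrite /ball/= sub0r normrN ltr_pdivlMr// => tr.
  suff : (S `&` U) (emb i (x + t *: v') (g (x + t *: v'))) by case.
  rewrite SU /= col'_emb emb_id; split => //; apply: rV.
  rewrite /eball/= addrC addKr enormZ (le_lt_trans _ tr)//.
  by rewrite ler_wpM2l// lerDr.
apply/velocityP => e e0.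
have v10 : 0 < 1 + enorm v' by rewrite ltr_pwDl ?enorm_ge0.
have e10 : 0 < e / (1 + enorm v') by rewrite divr_gt0.
have [eta eta0 xP] := ga e10.
exists (eta / (1 + enorm v')); first by rewrite divr_gt0.
move=> h h0; rewrite ltr_pdivlMr// => heta.
have xx : x + h *: v' - x = h *: v' by rewrite addrC addKr.
rewrite scale0r addr0 embB embZ xx -[v](emb_col' i) embB scalerA mulVf//.
rewrite scale1r subrr enorm_emb0 vi.
have xh : eball x eta (x + h *: v').
  rewrite /eball/= addrC addKr enormZ (le_lt_trans _ heta)//.
  by rewrite ler_wpM2l// lerDr.
have := xP _ _ xh (eball_center _ eta0); rewrite xx edotZr enormZ.
have -> : h^-1 * (g (x + h *: v') - g x) - edot a v' =
  h^-1 * (g (x + h *: v') - g x - h * edot a v') by field.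
rewrite normrM normfV ler_pdivrMl ?normr_gt0// => /le_trans; apply.
rewrite (_ : _ * (_ * _) = `|h| * e * (enorm v' / (1 + enorm v'))); last by ring.
rewrite ler_piMr ?mulr_ge0 ?(ltW e0)// ler_pdivrMr// mul1r lerDr.
exact: ler01.
Qed.

Lemma tangent_graph_normal : let nu := (jac a)^-1 *: emb i (- a) 1 in
  enorm nu = 1 /\ forall v, tangent S p v <-> edot nu v = 0.
Proof.
move=> nu; have j0 := jac_gt0 a; split.
  rewrite enormZ gtr0_norm ?invr_gt0//.
  have -> : enorm (emb i (- a) 1) = jac a.
    by rewrite /jac /enorm edot_emb edotNl edotNr opprK mulr1 addrC.
  by rewrite mulVf// gt_eqF.
move=> v; rewrite tangent_graph /nu edotZl -{2}(emb_col' i v) edot_emb edotNl mul1r.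
split=> [/= ->|/eqP]; first by rewrite addNr mulr0.
by rewrite mulf_eq0 invr_eq0 gt_eqF//= addrC subr_eq0 => /eqP.
Qed.

End graph_tangent.

(** Whatever vector [xget] selects, its component orthogonal to [nu] is tangent, hence orthogonal to
    the selected vector, hence zero. *)
Lemma unit_normal_hyperplane (R : realType) k (S : set 'rV[R]_k) p nu : enorm nu = 1 ->
  (forall v, tangent S p v <-> edot nu v = 0) ->
  unit_normal S p = nu \/ unit_normal S p = - nu.
Proof.
move=> nu1 Sp; rewrite /unit_normal; case: xgetP => [w _ [w1 wS]|/(_ nu) []]; last first.
  by split => // v /Sp.
have wE : w = edot w nu *: nu.
  apply/eqP; rewrite -subr_eq0 -enorm_eq0 -sqrf_eq0 sqr_enorm; apply/eqP.
  have nn : edot nu nu = 1 by rewrite -sqr_enorm nu1 expr1n.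
  set z := w - _; have z0 : edot nu z = 0.
    by rewrite /z edotBr edotZr nn mulr1 edotC subrr.
  by rewrite {1}/z edotBl edotZl z0 mulr0 subr0; apply/wS/Sp.
have c1 : `|edot w nu| = 1 by rewrite -[LHS]mulr1 -nu1 -enormZ -wE w1.
move: (edot w nu) c1 wE => c + ->.
case: ler0P => _ => [/eqP|->]; last by left; rewrite scale1r.
by rewrite eqr_oppLR => /eqP ->; right; rewrite scaleN1r.
Qed.

(** * The complex structure and the horizontal geometry of the Heisenberg group *)

Section complex_structure.
Variables (R : realType) (n : nat).
Implicit Types x y : 'rV[R]_(n + n).

(** Multiplication by i when (x, y) stands for x + iy. The contact hyperplane at [p] is the graph of
    minus the inner product with [Jrot] of the horizontal part of [p]. *)
Definition Jrot x : 'rV[R]_(n + n) := row_mx (- rsubmx x) (lsubmx x).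

Lemma Jrot_l x j : Jrot x 0 (lshift n j) = - x 0 (rshift n j).
Proof. by rewrite row_mxEl !mxE. Qed.

Lemma Jrot_r x j : Jrot x 0 (rshift n j) = x 0 (lshift n j).
Proof. by rewrite row_mxEr !mxE. Qed.

Lemma edot_split x y : edot x y =
  \sum_(j < n) (x 0 (lshift n j) * y 0 (lshift n j) + x 0 (rshift n j) * y 0 (rshift n j)).
Proof. by rewrite /edot big_split_ord/= -big_split. Qed.

Lemma edot_Jrot x y : edot (Jrot x) (Jrot y) = edot x y.
Proof.
rewrite !edot_split; apply: eq_bigr => j _.
by rewrite !Jrot_l !Jrot_r mulrNN addrC.
Qed.

Lemma Jrot2 x : Jrot (Jrot x) = - x.
Proof.
apply/rowP => j; rewrite [RHS]mxE; case: (split_ordP j) => k ->.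
  by rewrite Jrot_l Jrot_r.
by rewrite Jrot_r Jrot_l.
Qed.

Lemma JrotZ c x : Jrot (c *: x) = c *: Jrot x.
Proof.
apply/rowP => j; rewrite [RHS]mxE; case: (split_ordP j) => k ->.
  by rewrite !Jrot_l mxE mulrN.
by rewrite !Jrot_r mxE.
Qed.

Lemma JrotD x y : Jrot (x + y) = Jrot x + Jrot y.
Proof.
apply/rowP => j; rewrite [RHS]mxE; case: (split_ordP j) => k ->.
  by rewrite !Jrot_l mxE opprD.
by rewrite !Jrot_r mxE.
Qed.

Lemma JrotN x : Jrot (- x) = - Jrot x.
Proof. by rewrite -scaleN1r JrotZ scaleN1r. Qed.

Lemma JrotB x y : Jrot (x - y) = Jrot x - Jrot y.
Proof. by rewrite JrotD JrotN. Qed.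

Lemma edot_Jrotl x y : edot (Jrot x) y = - edot x (Jrot y).
Proof. by rewrite -(edot_Jrot x) Jrot2 edotNr opprK. Qed.

Lemma edot_Jrotxx x : edot (Jrot x) x = 0.
Proof. by have := edot_Jrotl x x; rewrite [in RHS]edotC; lra. Qed.

End complex_structure.

Section heisenberg.
Variables (R : realType) (n : nat).
Implicit Types (p q v w : 'rV[R]_(n + n).+1) (S : set 'rV[R]_(n + n).+1).
Local Notation zi := (zi n).
Local Notation pr v := (col' zi v : 'rV[R]_(n + n)).

Lemma xiE (j : 'I_n) : xi j = lift zi (lshift n j).
Proof. by apply/val_inj; rewrite /= /bump leqNgt ltn_addr. Qed.

Lemma yiE (j : 'I_n) : yi j = lift zi (rshift n j).
Proof. by apply/val_inj; rewrite /= /bump leqNgt ltn_add2l ltn_ord. Qed.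

Lemma leviE v w : levi v w = edot (pr v) (pr w).
Proof.
by rewrite edot_split; apply: eq_bigr => j _; rewrite xiE yiE !mxE.
Qed.

Lemma contactE p v : contact p v <-> v 0 zi = - edot (Jrot (pr p)) (pr v).
Proof.
have -> : edot (Jrot (pr p)) (pr v) =
    \sum_(j < n) (p 0 (xi j) * v 0 (yi j) - p 0 (yi j) * v 0 (xi j)).
  rewrite edot_split; apply: eq_bigr => j _.
  by rewrite Jrot_l Jrot_r xiE yiE !mxE mulNr addrC.
rewrite /contact/=; split=> [/eqP|->]; last by rewrite addNr.
by rewrite addr_eq0 => /eqP.
Qed.

(* Coordinates of the orthogonal projection of [nu] in the frame [eX], [eY]. *)
Definition hor p (nu : 'rV[R]_(n + n).+1) : 'rV[R]_(n + n) :=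
  pr nu - nu 0 zi *: Jrot (pr p).

Lemma edot_eX p nu j : edot (eX j p) nu = hor p nu 0 (lshift n j).
Proof.
rewrite /eX edotDl edotZl !(edotC _ nu) !edot_delta /hor row_subE row_scaleE.
by rewrite Jrot_l xiE yiE !mxE mulrN opprK mulrC.
Qed.

Lemma edot_eY p nu j : edot (eY j p) nu = hor p nu 0 (rshift n j).
Proof.
rewrite /eY edotBl edotZl !(edotC _ nu) !edot_delta /hor row_subE row_scaleE.
by rewrite Jrot_r xiE yiE !mxE mulrC.
Qed.

Lemma horN p nu : hor p (- nu) = - hor p nu.
Proof.
have e : pr (- nu) = - pr nu by apply/rowP => j; rewrite !mxE.
by rewrite /hor e row_oppE scaleNr opprK opprB addrC.
Qed.

Lemma edot_contact p v nu : contact p v -> edot nu v = edot (pr v) (hor p nu).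
Proof.
move=> /contactE vz; rewrite -{1}(emb_col' zi nu) -{1}(emb_col' zi v) edot_emb vz.
by rewrite /hor edotBr edotZr edotC (edotC (pr v) (Jrot _)) mulrN.
Qed.

Section hyperplane.
Variables (S : set 'rV[R]_(n + n).+1) (p nu : 'rV[R]_(n + n).+1).
Hypotheses (nu1 : enorm nu = 1) (Snu : forall v, tangent S p v <-> edot nu v = 0).

Lemma parea_densityE : parea_density S p = enorm (hor p nu).
Proof.
rewrite /parea_density /enorm edot_split; congr Num.sqrt; apply: eq_bigr => j _.
rewrite edot_eX edot_eY -!expr2.
by have [->|->] := unit_normal_hyperplane nu1 Snu; rewrite ?horN ?row_oppE ?sqrrN.
Qed.

(** The horizontal part of the p-normal is a unit multiple of [h], and the density is the length of
    [h]: their product is [h] up to a sign, which the absolute value removes. If [h = 0], both sides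
    vanish whatever the default value of [pnormal]. *)
Lemma levi_pnormalE w :
  `|levi w (pnormal S p)| * enorm (hor p nu) = `|edot (pr w) (hor p nu)|.
Proof.
set h := hor p nu; have [h0|h0] := eqVneq h 0.
  by rewrite h0 enorm0 mulr0 edot0r normr0.
have hh : edot h h != 0 by rewrite -sqr_enorm expf_neq0// enorm_eq0.
pose lift_c (c : 'rV[R]_(n + n)) := emb zi c (- edot (Jrot (pr p)) c).
have lift_contact c : contact p (lift_c c).
  by apply/contactE; rewrite emb_id col'_emb.
have lift_tangent c : edot c h = 0 -> tangent S p (lift_c c).
  by move=> ch; apply/Snu; rewrite (edot_contact _ (lift_contact c)) col'_emb.
rewrite leviE /pnormal; case: xgetP => [N _ [cN N1 NS]|/(_ (lift_c ((enorm h)^-1 *: h))) []]; last first.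
  split => //.
    rewrite leviE col'_emb edotZl edotZr -sqr_enorm expr2 mulKf ?mulVf//;
    by rewrite enorm_eq0.
  move=> v /Snu + cv; rewrite (edot_contact _ cv) -/h => vh.
  by rewrite leviE col'_emb edotZl edotC vh mulr0.
set c := pr N; pose k := edot c h / edot h h.
have ck : c = k *: h.
  (* The part of [c] orthogonal to [h] lifts to a tangent contact vector, to which [N] is
     orthogonal; so it is orthogonal to itself. *)
  apply/eqP; rewrite -subr_eq0 -enorm_eq0 -sqrf_eq0 sqr_enorm; apply/eqP.
  set z := c - k *: h.
  have zh : edot z h = 0 by rewrite /z edotBl edotZl /k divfK// subrr.
  have := NS _ (lift_tangent _ zh) (lift_contact _); rewrite leviE col'_emb -/c => cz.
  by rewrite {2}/z edotBr edotZr zh mulr0 subr0 edotC.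
have k1 : `|k| * enorm h = 1.
  have : enorm c = 1 by rewrite /enorm -leviE N1 sqrtr1.
  by rewrite ck enormZ.
by rewrite ck edotZr normrM mulrAC k1 mul1r.
Qed.

End hyperplane.

(** The composite map is x -> x + (q - p) plus a vertical term. Of that term only differentiability
    matters: it lets the differential be computed as a directional derivative, coordinate by
    coordinate. *)
Lemma push_pr p q v : pr (push p q v) = pr v.
Proof.
pose b : 'rV[R]_(n + n).+1 := q - p.
pose l (x : 'rV[R]_(n + n).+1) : R :=
  \sum_(j < n) ((- p) 0 (yi j) * x 0 (xi j) - (- p) 0 (xi j) * x 0 (yi j)) +
  \sum_(j < n) (q 0 (yi j) * (x 0 (xi j) - p 0 (xi j)) -
    q 0 (xi j) * (x 0 (yi j) - p 0 (yi j))).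
have fE : left_translation q \o left_translation (hinv p) =
    (fun x => x + b + l x *: delta_mx 0 zi).
  apply/funext => x /=; set y := left_translation (hinv p) x.
  have yx k : y 0 (lift zi k) = x 0 (lift zi k) - p 0 (lift zi k).
    rewrite /y /left_translation /hinv !mxE eq_sym (negbTE (neq_lift _ _)) andbF mulr0 addr0.
    by rewrite addrC.
  rewrite /left_translation.
  under eq_bigr do rewrite xiE yiE !yx -xiE -yiE.
  rewrite {yx}/y /left_translation /hinv /l scalerDl /b.
  set s := (X in _ + (_ + _ + X) + _); set t := (X in _ + X).
  by rewrite !addrA [q - p + x]addrC addrA.
have cf j x : differentiable (fun x : 'rV[R]_(n + n).+1 => x 0 j : R) x.
  exact: differentiable_coord.
have dsum (f : 'I_n -> 'rV[R]_(n + n).+1 -> R) :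
    (forall j, differentiable (f j) p) -> differentiable (fun x => \sum_j f j x) p.
  by move=> /differentiable_sum; rewrite fct_sumE.
have dl : differentiable l p.
  apply: differentiableD.
    apply: dsum => j; apply: differentiableB;
      apply: differentiableM => //; exact: differentiable_cst.
  apply: dsum => j; apply: differentiableB;
    (apply: differentiableM; first exact: differentiable_cst);
    apply: differentiableB => //; exact: differentiable_cst.
have df : differentiable (fun x => x + b + l x *: (delta_mx 0 zi : 'rV[R]_(n + n).+1)) p.
  apply: differentiableD; last exact: differentiableZl.
  by apply: differentiableD => //; exact: differentiable_cst.
rewrite /push fE -deriveE//; apply/rowP => k.
rewrite derive_mx; last exact: diff_derivable.
rewrite !mxE /derive; apply: cvg_lim => //; apply: cvg_near_cst; near=> h.
have h0 : h != 0 by near: h; exact: nbhs_dnbhs_neq.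
rewrite /= !mxE eq_sym (negbTE (neq_lift _ _)) andbF !mulr0 !addr0 /GRing.scale/=.
by field.
Unshelve. all: by end_near. Qed.

End heisenberg.

(** * Measurable normals and sigma-finiteness for C^2 hypersurfaces *)

Section continuous_partials.
Variables (R : realType) (m : nat) (V : set 'rV[R]_m) (g : 'rV[R]_m -> R).
Local Notation e_ i := (delta_mx 0 i : 'rV[R]_m).

Lemma partial_mvt (w : 'rV[R]_m) (i : 'I_m) (d c eps : R) :
  (forall s, `|s| <= `|d| -> derivable g (w + s *: e_ i) (e_ i)) ->
  (forall s, `|s| <= `|d| -> `|'D_(e_ i) g (w + s *: e_ i) - c| <= eps) ->
  `|g (w + d *: e_ i) - g w - c * d| <= eps * `|d|.
Proof.
move=> dg Dg; pose phi s := g (w + s *: e_ i).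
have dphi s : `|s| <= `|d| -> is_derive s (1 : R) phi ('D_(e_ i) g (w + s *: e_ i)).
  move=> sd; have := dg s sd; rewrite /derivable => dgs.
  have E : (fun h : R => h^-1 *: ((phi \o shift s) (h *: (1 : R)) - phi s)) =
    (fun h => h^-1 *: ((g \o shift (w + s *: e_ i)) (h *: e_ i) - g (w + s *: e_ i))).
    apply/funext => h /=; have -> : h *: (1 : R) = h by rewrite /GRing.scale/= mulr1.
    by rewrite /phi scalerDl addrCA.
  by apply: DeriveDef; rewrite /derivable /derive ?E.
have mvt a b : a <= b -> (forall s, s \in `[a, b] -> `|s| <= `|d|) ->
    exists2 s, `|s| <= `|d| & phi b - phi a = 'D_(e_ i) g (w + s *: e_ i) * (b - a).
  move=> ab sd.
  have [||s sab ->] := @MVT_segment R phi (fun s => 'D_(e_ i) g (w + s *: e_ i)) a b ab.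
  - by move=> s sab; apply/dphi/sd; exact: subset_itv_oo_cc.
  - by apply: derivable_within_continuous => s /sd/dphi[].
  - by exists s => //; exact: sd.
have -> : g w = phi 0 by rewrite /phi scale0r addr0.
rewrite -/(phi d); have [d0|d0] := leP 0 d.
  have [|s sd ->] := mvt 0 d d0.
    by move=> s; rewrite in_itv/= => /andP[s0 sd]; rewrite !ger0_norm.
  by rewrite subr0 -mulrBl normrM ler_wpM2r// Dg.
have [|s sd] := mvt d 0 (ltW d0).
  by move=> s; rewrite in_itv/= => /andP[s0 sd]; rewrite !ler0_norm ?(ltW d0)// lerN2.
rewrite sub0r => h.
have -> : phi d - phi 0 = 'D_(e_ i) g (w + s *: e_ i) * d by rewrite -opprB h mulrN opprK.
rewrite -mulrBl normrM ler_wpM2r//.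
exact: Dg.
Qed.

(** One goes from [v] to [u] by changing one coordinate at a time; each change is controlled by the
    mean value theorem and the continuity of one partial derivative at [x]. *)
Lemma sdiff_partials (x : 'rV[R]_m) : open V -> V x ->
  (forall i u, V u -> derivable g u (e_ i)) ->
  (forall i, {in V, continuous ('D_(e_ i) g)}) ->
  sdiff g x (\row_i 'D_(e_ i) g x).
Proof.
move=> oV Vx dg cg e e0.
have e'0 : 0 < e / m.+1%:R by rewrite divr_gt0.
have [eta eta0 etaP] : exists2 eta, 0 < eta & forall y, eball x eta y ->
    V y /\ forall i, `|'D_(e_ i) g y - 'D_(e_ i) g x| <= e / m.+1%:R.
  suff : nbhs x (V `&` [set y | forall i, `|'D_(e_ i) g y - 'D_(e_ i) g x| <= e / m.+1%:R]).
    by move=> /nbhs_eball.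
  apply: filterI; first exact: open_nbhs_nbhs.
  apply: (@filter_forall _ _ (fun i y => `|'D_(e_ i) g y - 'D_(e_ i) g x| <= e / m.+1%:R)
    (nbhs x) (nbhs_filter x)).
  move=> i; have Vx' : x \in V by rewrite inE.
  have := cg i x Vx' (ball ('D_(e_ i) g x) (e / m.+1%:R)).
  move=> /(_ (nbhsx_ballx _ _ e'0)); apply: (@filterS _ (nbhs x) (nbhs_filter x)) => y.
  by rewrite /ball/= distrC => /ltW.
(* On the [i]-th segment the coordinate is within [rho] of that of [x] at the start and moves by at
   most [2 * rho], which explains the 3. *)
pose rho := eta / m.+1%:R / 3; have rho3 : 3 * rho = eta / m.+1%:R by rewrite mulrC divfK.
exists rho; first by rewrite !divr_gt0.
move=> u v xu xv.
(* The first [j] coordinates are those of [u], the others still those of [v]. *)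
pose w (j : nat) : 'rV[R]_m := \row_i (if (i < j)%N then u 0 i else v 0 i).
have w0 : w 0%N = v by apply/rowP => i; rewrite mxE.
have wm : w m = u by apply/rowP => i; rewrite mxE ltn_ord.
have near (y : 'rV[R]_m) : (forall i, `|y 0 i - x 0 i| <= eta / m.+1%:R) -> eball x eta y.
  move=> yx; rewrite /eball/=; apply: (@le_lt_trans _ _ (m%:R * (eta / m.+1%:R))).
    by apply: enorm_le_sup => i; rewrite row_subE.
  by rewrite mulrCA gtr_pMr// ltr_pdivrMr// mul1r ltr_nat.
have cx (y : 'rV[R]_m) i : eball x rho y -> `|y 0 i - x 0 i| <= rho.
  by move=> xy; rewrite -row_subE (le_trans (coord_le_enorm _ i))// ltW.
have step (i : 'I_m) : `|g (w i.+1) - g (w i) - 'D_(e_ i) g x * (u 0 i - v 0 i)| <=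
    e / m.+1%:R * enorm (u - v).
  have wS : w i.+1 = w i + (u 0 i - v 0 i) *: e_ i.
    apply/rowP => j; rewrite !mxE eqxx/= ltnS; have [->|ji] := eqVneq j i.
      by rewrite leqnn ltnn mulr1 addrC subrK.
    by rewrite mulr0 addr0 leq_eqVlt (negbTE (ji : val j != val i)).
  have seg s : `|s| <= `|u 0 i - v 0 i| -> eball x eta (w i + s *: e_ i).
    have ui := cx u i xu; have vi := cx v i xv.
    move=> sd; apply: near => j; rewrite !mxE eqxx/= -rho3.
    have [->|ji] := eqVneq j i.
      rewrite ltnn mulr1; move: ui vi sd; rewrite !ler_norml => /andP[u1 u2] /andP[v1 v2].
      by case: (ler0P (u 0 i - v 0 i)) => _ /andP[s1 s2]; apply/andP; split; lra.
    have uj := cx u j xu; have vj := cx v j xv.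
    have rho1 : rho <= 3 * rho by rewrite ler_peMl ?ler1n// !divr_ge0// ltW.
    rewrite mulr0 addr0; case: ifP => _; first exact: le_trans uj rho1.
    exact: le_trans vj rho1.
  rewrite wS; apply: (le_trans (partial_mvt (eps := e / m.+1%:R) _ _)).
  - by move=> s /seg /etaP[Vs _]; exact: dg.
  - by move=> s /seg /etaP[_].
  - by rewrite -row_subE ler_wpM2l ?(ltW e'0)// coord_le_enorm.
have -> : g u - g v = \sum_(0 <= j < m) (g (w j.+1) - g (w j)).
  by rewrite (telescope_sumr (fun j => g (w j)))// wm w0.
rewrite big_mkord /edot.
under [X in _ - X]eq_bigr do rewrite mxE row_subE.
rewrite -sumrB (le_trans (ler_norm_sum _ _ _))//.
apply: (le_trans (ler_sum _ (fun i _ => step i))).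
rewrite sumr_const card_ord -[X in X <= _]mulr_natl mulrA ler_wpM2r ?enorm_ge0//.
by rewrite mulrCA ger_pMr// ler_pdivrMr// mul1r ler_nat.
Qed.

End continuous_partials.

Definition normal_at (R : realType) k (S : set 'rV[R]_k) (q nu : 'rV[R]_k) :=
  enorm nu = 1 /\ forall v, tangent S q v <-> edot nu v = 0.

Section hypersurface.
Variables (R : realType) (m' : nat).
Local Notation m := m'.+1.
Variable (S : set 'rV[R]_m.+1).
Local Notation hm := (@hmeasure R m m.+1).

Lemma Ck_on_sdiff k (V : set 'rV[R]_k) (g : 'rV[R]_k -> R) x : open V -> Ck_on 2 V g ->
  V x -> sdiff g x (\row_i 'D_(delta_mx 0 i : 'rV[R]_k) g x).
Proof.
move=> oV [_ gV] Vx; apply: sdiff_partials oV Vx _ _.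
- by move=> i u; have [+ _] := gV i; exact.
- by move=> i; have [_ []] := gV i.
Qed.

Lemma leb_eball_lty (x : 'rV[R]_m) r : (leb R m (eball x r) < +oo)%E.
Proof.
have [r0|r0] := leP r 0.
  rewrite (_ : eball x r = set0) ?measure0 ?ltry// -subset0 => u.
  by rewrite /eball/= ltNge (le_trans r0)// enorm_ge0.
pose s : 'rV[R]_m := const_mx r - x.
have r20 : 0 <= 2 * r by rewrite mulr_ge0// ltW.
apply: (@le_lt_trans _ _ (leb R m [set u | @cube R m (2 * r) (u + s)])).
  apply: le_measure; rewrite ?inE//.
  - exact: measurable_eball.
  - apply: measurable_preimage (@measurable_cube R m _).
    by apply: measurable_addrV; [exact: measurable_id|exact: measurable_cst].
  - move=> u xu i; rewrite !mxE.
    have := le_lt_trans (coord_le_enorm (u - x) i) xu.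
    by rewrite row_subE ltr_norml => /andP[? ?]; apply/andP; split; lra.
rewrite leb_translation_invariant; last exact: measurable_cube.
by rewrite leb_cube// ltry.
Qed.

(** What a chart provides near a point. It is phrased with a measurable superset [B] and a globally
    measurable [nu] so as to pass to arbitrary subsets of [E], as [eball_lindelof] requires. *)
Definition tame (E : set 'rV[R]_m.+1) := (exists2 B, measurable B &
    S `&` E `<=` B /\ (hm B < +oo)%E) /\
  exists2 nu : 'rV[R]_m.+1 -> 'rV[R]_m.+1, measurable_fun setT nu &
    forall q, S q -> E q -> normal_at S q (nu q).

Lemma C2_hypersurface_tame : C2_hypersurface S ->
  forall p, S p -> exists2 eta, 0 < eta & tame (eball p eta).
Proof.
move=> SC2 p Sp; have [i [U [V [g [oU Up oV gC2 SU]]]]] := SC2 p Sp.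
pose a x : 'rV[R]_m := \row_j 'D_(delta_mx 0 j : 'rV[R]_m) g x.
have ga x : V x -> sdiff g x (a x) by exact: Ck_on_sdiff.
have [Vp pg] : V (col' i p) /\ p 0 i = g (col' i p).
  by have : (S `&` U) p by []; rewrite SU.
have [eta1 eta10 e1P] := ga _ Vp _ ltr01.
have [eta2 eta20 e2P] := (open_eballP _).1 oV _ Vp.
have [r r0 rU] := (open_eballP _).1 oU _ Up.
pose eta := Num.min eta1 eta2.
exists (Num.min r eta); first by rewrite !lt_min r0 eta10.
have etaV : eball (col' i p) eta `<=` V.
  by move=> u; rewrite /eball/= lt_min => /andP[_]; exact: e2P.
have me : measurable (eball (col' i p) eta) by exact: measurable_eball.
split.
  exists (gr i g @` eball (col' i p) eta); first exact: (measurable_gr_image i oV ga).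
  split.
    move=> q [Sq]; rewrite /eball/= lt_min => /andP[qr qeta].
    have [Vq qg] : V (col' i q) /\ q 0 i = g (col' i q).
      have : (S `&` U) q by split=> //; exact: rU.
      by rewrite SU.
    exists (col' i q); last by rewrite /gr -qg emb_col'.
    by rewrite -col'B (le_lt_trans (enorm_col' _ _)).
  (* The chart coordinates contribute 1 to the Lipschitz constant, the gradient its length, and the
     strict differentiability error another 1. *)
  pose L := 2 + enorm (a (col' i p)).
  have L0 : 0 < L by rewrite ltr_pwDl ?enorm_ge0.
  apply: (@le_lt_trans _ _ ((L ^+ m)%:E * hm ((fun u => emb i u 0%R) @` eball (col' i p) eta))%E).
    apply: hmeasure_lipschitz => // u v; rewrite /eball/= !lt_min => /andP[u1 _] /andP[v1 _].
    have := e1P _ _ u1 v1; rewrite mul1r => h.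
    have h2 := cauchy_schwarz (a (col' i p)) (u - v).
    rewrite /gr !embB subrr.
    have -> : emb i (u - v) (g u - g v) = emb i (u - v) 0 + emb i 0 (g u - g v).
      by rewrite embD addr0 add0r.
    rewrite (le_trans (ler_enormD _ _))// enorm_emb0.
    have -> : enorm (emb i (u - v) 0) = enorm (u - v).
      by rewrite /enorm edot_emb mulr0 addr0.
    have := ler_normD (g u - g v - edot (a (col' i p)) (u - v)) (edot (a (col' i p)) (u - v)).
    by rewrite subrK /L !mulrDl mul1r; lra.
  rewrite (@hmeasure_isometry _ _ _ m _ _ _ id); last first.
    by move=> u v _ _; rewrite embB subrr /enorm edot_emb mulr0 addr0.
  by rewrite image_id hmeasure_leb// lte_mul_pinfty ?lee_fin ?exprn_ge0 ?ltW// leb_eball_lty.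
(* Extension by 0 makes the gradient, and then the normal, measurable on the whole space. *)
pose a' u := if u \in V then a u else 0.
have mV : measurable V by exact: measurable_open.
have ma' : measurable_fun setT a'.
  have mVb : measurable_fun setT (fun u : 'rV[R]_m => u \in V).
    by apply: (measurable_fun_bool true); rewrite setTI (_ : _ @^-1` _ = V)//;
       apply/seteqP; split => u; [exact: set_mem|exact: mem_set].
  apply: measurable_fun_if => //.
    rewrite setTI (_ : _ @^-1` _ = V); first exact: measurable_grad oV ga.
    by apply/seteqP; split => u; [exact: set_mem|exact: mem_set].
exists (fun q => (jac (a' (col' i q)))^-1 *: emb i (- a' (col' i q)) 1).
  have maq : measurable_fun setT (fun q => a' (col' i q)).
    exact: (measurableT_comp ma' (measurable_col' i)).
  have maN : measurable_fun setT (fun q => - a' (col' i q)).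
    under eq_fun do rewrite -scaleN1r.
    by apply: measurable_scalerV => //; exact: measurable_cst.
  apply: measurable_scalerV.
    have -> : (fun q => (jac (a' (col' i q)))^-1) =
        (fun q => enorm (emb i (a' (col' i q)) 1) `^ (-1)).
      by apply/funext => q; rewrite -jacE powR_inv1// ltW// jac_gt0.
    apply: (measurableT_comp (f := fun x : R => x `^ (-1)) (g := fun q => enorm _)).
      exact: measurable_powR.
    by apply: measurable_enorm; apply: measurable_emb.
  by apply: measurable_emb.
move=> q Sq; rewrite /eball/= lt_min => /andP[qr _].
have Uq : U q by exact: rU.
have [Vq _] : V (col' i q) /\ q 0 i = g (col' i q).
  by have : (S `&` U) q by []; rewrite SU.
rewrite /a' mem_set//.
exact: (tangent_graph_normal oU Uq Sq oV SU (ga _ Vq)).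
Qed.

Lemma tame_lindelof : C2_hypersurface S -> exists E : nat -> set 'rV[R]_m.+1,
  [/\ forall n, measurable (E n), forall n, tame (E n) & S `<=` \bigcup_n E n].
Proof.
move=> SC2; have [||x Sx|E [oE tE SE]] := @eball_lindelof R m.+1 S tame.
- split; first by exists set0 => //; rewrite setI0; split => //; rewrite measure0 ltry.
  by exists (fun=> 0) => //; exact: measurable_cst.
- move=> E F EF [[B mB [FB Boo]] [nu mnu nuF]]; split.
    by exists B => //; split => // x [Sx /EF Fx]; exact: FB.
  by exists nu => // q Sq /EF; exact: nuF.
- exact: C2_hypersurface_tame.
by exists E; split => // n; exact: measurable_open.
Qed.

(** The pointwise choice [unit_normal] carries no measurability information. A measurable normal is
    glued from those of countably many charts, cut down to disjoint pieces. *)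
Lemma C2_hypersurface_normal : measurable S -> C2_hypersurface S ->
  exists nu : 'rV[R]_m.+1 -> 'rV[R]_m.+1,
    measurable_fun S nu /\ forall q, S q -> normal_at S q (nu q).
Proof.
move=> mS /tame_lindelof[E [mE tE SE]].
have /choice[nu nuP] (n : nat) : exists nu : 'rV[R]_m.+1 -> 'rV[R]_m.+1,
    measurable_fun setT nu /\ forall q, S q -> E n q -> normal_at S q (nu q).
  by have [_ [nu mnu nuE]] := tE n; exists nu.
pose F n := S `&` seqDU E n.
have mF n : measurable (F n) by apply: measurableI => //; exact: seqDU_measurable.
have SF : S = \bigcup_n F n.
  by rewrite -setI_bigcupr -seqDU_bigcup_eq; apply/esym; exact: setIidl.
have /choice[k kP] (q : 'rV[R]_m.+1) : exists n, S q -> F n q.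
  have [Sq|nSq] := pselect (S q); last by exists 0%N.
  have [n _ Fn] : (\bigcup_n F n) q by rewrite -SF.
  by exists n.
have kF n q : F n q -> k q = n.
  move=> Fnq; have Sq : S q by case: Fnq.
  have /trivIsetP tF : trivIset setT F by apply: trivIset_setIl; exact: trivIset_seqDU.
  apply: contrapT => /eqP kn.
  have : (F (k q) `&` F n) q by split => //; exact: kP.
  by rewrite tF.
exists (fun q => nu (k q) q); split.
  rewrite [X in measurable_fun X]SF; apply/measurable_fun_bigcup => // n.
  apply: (eq_measurable_fun (nu n)).
    by move=> q; rewrite inE => /kF ->.
  exact: measurable_funTS (nuP n).1.
move=> q Sq; apply: (nuP (k q)).2 => //.
by have [_ h] := kP q Sq; exact: subset_seqDU h.
Qed.

(** The measure [hm] is not sigma-finite on the ambient space, but Tonelli only integrates over [S];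
    the complement of [S] is one more piece, of restricted measure 0. *)
Lemma C2_hypersurface_sigma_finite (mS : measurable S) : C2_hypersurface S ->
  sigma_finite setT (mrestr hm mS).
Proof.
move=> /tame_lindelof[E [mE tE SE]].
exists (fun n => if n is n'.+1 then E n' else ~` S).
  apply/seteqP; split => // q _; have [Sq|nSq] := pselect (S q).
    by have [n _ Eq] := SE q Sq; exists n.+1.
  by exists 0%N.
case=> [|n].
  split; first exact: measurableC.
  by rewrite /mrestr setICl measure0 ltry.
split; first exact: mE.
have [[B mB [SB Boo]] _] := tE n.
rewrite /mrestr (le_lt_trans _ Boo)// le_measure ?inE//; first exact: measurableI.
by rewrite setIC.
Qed.

End hypersurface.

Lemma strict_derive (R : realType) (F F' : R -> R) (s0 r : R) : 0 < r ->
  (forall s, `|s - s0| < r -> is_derive s 1 F (F' s)) -> {for s0, continuous F'} ->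
  forall e, 0 < e -> exists2 d, 0 < d & forall s t, `|s - s0| < d -> `|t - s0| < d ->
    `|F s - F t - F' s0 * (s - t)| <= e * `|s - t|.
Proof.
move=> r0 dF cF' e e0.
have /nbhs_ballP[d1 /= d10 d1P] := cF' _ (nbhsx_ballx (F' s0) e e0).
exists (Num.min r d1); first by rewrite lt_min r0.
have key s t : s <= t -> `|s - s0| < Num.min r d1 -> `|t - s0| < Num.min r d1 ->
    `|F t - F s - F' s0 * (t - s)| <= e * `|t - s|.
  move=> st sd td.
  have near c : c \in `[s, t] -> `|c - s0| < r /\ `|F' c - F' s0| <= e.
    rewrite in_itv/= => /andP[sc ct].
    have : `|c - s0| < Num.min r d1.
      by move: sd td; rewrite !ltr_norml => /andP[? ?] /andP[? ?]; apply/andP; split; lra.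
    rewrite lt_min => /andP[cr cd]; split => //.
    have := d1P c; rewrite /ball/= distrC => /(_ cd).
    by rewrite /ball/= distrC => /ltW.
  have [||c cst ->] := @MVT_segment R F F' s t st.
  - by move=> c cst; apply: dF; apply: (near _ _).1; exact: subset_itv_oo_cc.
  - by apply: derivable_within_continuous => c /near[/dF[]].
  - by rewrite -mulrBl normrM ler_wpM2r//; case: (near c cst).
move=> s t sd td; have [st|/ltW ts] := leP s t; last exact: key.
have -> : F s - F t - F' s0 * (s - t) = - (F t - F s - F' s0 * (t - s)) by ring.
by rewrite normrN (distrC s t); exact: key.
Qed.

(** With the squared norm as variable, the increment |u|^2 - |v|^2 = <u + v, u - v> reduces the
    claim to one variable, up to the replacement of [u + v] by [2 *: x]. *)
Lemma sdiff_radial (R : realType) m (F F' : R -> R) (x : 'rV[R]_m) (r : R) : 0 < r ->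
  (forall s, `|s - edot x x| < r -> is_derive s 1 F (F' s)) ->
  {for edot x x, continuous F'} ->
  sdiff (fun u => F (edot u u)) x ((2 * F' (edot x x)) *: x).
Proof.
move=> r0 dF cF' e e0; set s0 := edot x x; set c := F' s0.
pose C := 2 * (enorm x + 1).
have C0 : 0 < C by rewrite mulr_gt0// ltr_wpDl// enorm_ge0.
have eC0 : 0 < e / 2 / C by rewrite !divr_gt0.
have [d d0 dP] := strict_derive r0 dF cF' eC0.
have c0 : 0 < 4 * (`|c| + 1) by rewrite mulr_gt0// ltr_wpDl.
(* The three terms respectively bound |u| and |v| by |x| + 1, keep the squared norms within [d] of
   [s0], and make the replacement of [u + v] by [2 *: x] cost at most [e / 2]. *)
pose eta := Num.min 1 (Num.min (d / C) (e / (4 * (`|c| + 1)))).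
have eta0 : 0 < eta by rewrite !lt_min ltr01 !divr_gt0.
have eta1 : eta <= 1 by rewrite ge_min lexx.
have etad : eta * C <= d by rewrite -ler_pdivlMr// !ge_min lexx !orbT.
have etae : eta * (4 * (`|c| + 1)) <= e by rewrite -ler_pdivlMr// !ge_min lexx !orbT.
exists eta => // u v xu xv.
have nx y : eball x eta y -> enorm y <= enorm x + 1.
  by move=> xy; have := ler_enorm_dist y x; rewrite /eball/= in xy; lra.
have sq y z : edot y y - edot z z = edot (y + z) (y - z).
  by rewrite edotDl !edotBr (edotC z y); ring.
have near y : eball x eta y -> `|edot y y - s0| < d.
  move=> xy; rewrite sq (le_lt_trans (cauchy_schwarz _ _))//.
  apply: lt_le_trans etad.
  apply: (@le_lt_trans _ _ (C * enorm (y - x))).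
    rewrite ler_wpM2r ?enorm_ge0// (le_trans (ler_enormD _ _))//.
    by have := nx y xy; rewrite /C; lra.
  by rewrite mulrC ltr_pM2r.
have h1 := dP _ _ (near u xu) (near v xv); rewrite sq in h1.
have uv : enorm (u + v) <= C.
  by rewrite (le_trans (ler_enormD _ _))//; have := nx u xu; have := nx v xv; rewrite /C; lra.
have h2 : `|edot (u + v) (u - v)| <= C * enorm (u - v).
  by rewrite (le_trans (cauchy_schwarz _ _))// ler_wpM2r// enorm_ge0.
have h3 : `|edot (u + v - 2 *: x) (u - v)| <= 2 * eta * enorm (u - v).
  rewrite (le_trans (cauchy_schwarz _ _))// ler_wpM2r ?enorm_ge0//.
  have -> : u + v - 2 *: x = (u - x) + (v - x).
    by rewrite addrACA -opprD -mulr2n scaler_nat.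
  by rewrite (le_trans (ler_enormD _ _))//; move: xu xv; rewrite /eball/=; lra.
have h4 : e / 2 / C * `|edot (u + v) (u - v)| <= e / 2 * enorm (u - v).
  by rewrite (le_trans (ler_wpM2l (ltW eC0) h2))// mulrA divfK// gt_eqF.
have h5 : `|c * edot (u + v - 2 *: x) (u - v)| <= e / 2 * enorm (u - v).
  rewrite normrM (le_trans (ler_wpM2l (normr_ge0 c) h3))// mulrA ler_wpM2r ?enorm_ge0//.
  have : `|c| * (4 * eta) <= e by apply: le_trans etae; have := normr_ge0 c; lra.
  lra.
have -> : F (edot u u) - F (edot v v) - edot ((2 * c) *: x) (u - v) =
   (F (edot u u) - F (edot v v) - c * edot (u + v) (u - v)) +
   c * edot (u + v - 2 *: x) (u - v).
  by rewrite edotBl !edotZl; ring.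
rewrite (le_trans (ler_normD _ _))//.
by have := le_trans h1 h4; move: h5; lra.
Qed.

Lemma adde_idr0 (R : realType) (a x : \bar R) : a \is a fin_num -> (a + x = a -> x = 0)%E.
Proof.
case: a => [a| |]// _; case: x => [x| |]//; rewrite -EFinD => h; have {}h := EFin_inj h.
by apply: (congr1 (@EFin R)); lra.
Qed.

(** * Balls and spheres *)

Section balls.
Variables (R : realType) (m' : nat).
Local Notation m := m'.+1.
Local Open Scope ereal_scope.

Definition sphere k (r : R) : set 'rV[R]_k := [set u | enorm u = r].
Definition cball k (r : R) : set 'rV[R]_k := [set u | (enorm u <= r)%R].

Lemma enorm_eball k (r : R) : eball 0 r = [set u : 'rV[R]_k | (enorm u < r)%R].
Proof. by apply/seteqP; split => u; rewrite /eball/= subr0. Qed.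

Lemma measurable_enorm_preimage k (A : set R) : measurable A ->
  measurable [set u : 'rV[R]_k | A (enorm u)].
Proof.
move=> mA; have := measurable_enorm (@measurable_id _ 'rV[R]_k setT) measurableT mA.
by rewrite setTI.
Qed.

Lemma measurable_sphere k r : measurable (@sphere k r).
Proof. exact: measurable_enorm_preimage (measurable_set1 r). Qed.

Lemma measurable_cball k r : measurable (@cball k r).
Proof.
rewrite (_ : cball _ = [set u | `]-oo, r]%classic (enorm u)]).
  exact: measurable_enorm_preimage (measurable_itv _).
by apply/seteqP; split => u; rewrite /= in_itv.
Qed.

Lemma leb_eball_scale (r : R) : (0 < r)%R ->
  leb R m (eball 0 r) = (r ^+ m)%:E * leb R m (eball 0 1%R).
Proof.
move=> r0; have ri : (0 < r^-1)%R by rewrite invr_gt0.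
rewrite -[r in LHS]invrK -[r in RHS]invrK exprVn -leb_scale//; last exact: measurable_eball.
apply: (congr1 (leb R m)).
by apply/seteqP; split => u; rewrite !enorm_eball/= enormZ gtr0_norm// invrK mulrC ltr_pdivrMr// mul1r.
Qed.

Lemma leb_cball_scale (r : R) : (0 < r)%R ->
  leb R m (cball r) = (r ^+ m)%:E * leb R m (cball 1%R).
Proof.
move=> r0; have ri : (0 < r^-1)%R by rewrite invr_gt0.
rewrite -[r in LHS]invrK -[r in RHS]invrK exprVn -leb_scale//; last exact: measurable_cball.
apply: (congr1 (leb R m)).
by apply/seteqP; split => u; rewrite /cball/= enormZ gtr0_norm// invrK mulrC ler_pdivrMr// mul1r.
Qed.

(** The closed unit ball lies in the open ball of radius [c] for every [c > 1], whose volume is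
    [c ^+ m] times that of the unit ball. *)
Lemma leb_cball1 : leb R m (cball 1%R) = leb R m (eball 0 1%R).
Proof.
apply/eqP; rewrite eq_le; apply/andP; split; last first.
  apply: le_measure; rewrite ?inE; [exact: measurable_eball|exact: measurable_cball|].
  by move=> u; rewrite enorm_eball => /= /ltW.
apply: (@lee_expr_mul _ m); first exact: measure_ge0.
move=> c c1; rewrite -leb_eball_scale ?(lt_trans ltr01)//.
apply: le_measure; rewrite ?inE; [exact: measurable_cball|exact: measurable_eball|].
by move=> u u1; rewrite enorm_eball/= (le_lt_trans u1).
Qed.

Lemma leb_cball (r : R) : (0 < r)%R -> leb R m (cball r) = leb R m (eball 0 r).
Proof. by move=> r0; rewrite leb_cball_scale// leb_cball1 -leb_eball_scale. Qed.

Lemma leb_sphere (r : R) : (0 < r)%R -> leb R m (@sphere m r) = 0.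
Proof.
move=> r0; have mB := @measurable_eball R m 0 r.
have := leb_cball r0.
rewrite (_ : cball r = eball 0 r `|` sphere r).
  rewrite measureU//; last 2 first.
  - exact: measurable_sphere.
  - by rewrite -subset0 => u; rewrite enorm_eball /sphere/= => -[/lt_eqF/eqP].
  have : leb R m (eball 0 r) \is a fin_num.
    by rewrite ge0_fin_numE ?measure_ge0// leb_eball_lty.
  exact: adde_idr0.
apply/seteqP; split => u; rewrite enorm_eball /cball /sphere/=.
  by rewrite le_eqVlt => /predU1P[|]; [right|left].
by case=> [/ltW|->].
Qed.

(** The unit cube fits in the ball of radius [m.+1]. *)
Lemma leb_eball_gt0 (r : R) : (0 < r)%R -> 0 < leb R m (eball 0 r).
Proof.
move=> r0; rewrite leb_eball_scale// mule_gt0 ?lte_fin ?exprn_gt0//.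
have : 1 <= (m.+1%:R ^+ m)%:E * leb R m (eball 0 1%R).
  rewrite -leb_eball_scale// -[1]/((1%R)%:E) -[X in X%:E <= _](expr1n R m) -leb_cube//.
  apply: le_measure; rewrite ?inE; [exact: measurable_cube|exact: measurable_eball|].
  move=> u u1; rewrite enorm_eball/=; apply: (@le_lt_trans _ _ (m%:R * 1)%R).
    by apply: enorm_le_sup => i; have /andP[u0 ?] := u1 i; rewrite ger0_norm.
  by rewrite mulr1 ltr_nat.
rewrite lt0e measure_ge0 andbT; apply: contraTneq => ->.
by rewrite mule0 -ltNge lte_fin.
Qed.

End balls.

(** * Euclidean hemispheres as graphs *)

Section hemisphere.
Variables (R : realType) (m' : nat).
Local Notation m := m'.+1.
Variables (i : 'I_m.+1) (rho : R).
Hypothesis rho0 : 0 < rho.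
Local Notation hm := (@hmeasure R m m.+1).
Local Open Scope ereal_scope.

Let g (u : 'rV[R]_m) : R := Num.sqrt (rho ^+ 2 - edot u u).
Let a (u : 'rV[R]_m) : 'rV[R]_m := (- (g u)^-1 *: u)%R.
Let V : set 'rV[R]_m := eball 0 rho.

Let VP u : V u -> (0 < rho ^+ 2 - edot u u)%R.
Proof.
by rewrite /V enorm_eball/= => u1; rewrite subr_gt0 -sqr_enorm ltr_pXn2r// nnegrE ?enorm_ge0// ltW.
Qed.

Let ga u : V u -> sdiff g u (a u).
Proof.
move=> /VP u0; rewrite /a.
pose F (s : R) : R := Num.sqrt (rho ^+ 2 - s).
pose F' (s : R) : R := (- (2 * F s)^-1)%R.
rewrite (_ : - (g u)^-1 = 2 * F' (edot u u))%R; last first.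
  by rewrite /F' /F -/(g u) invfM mulrN mulrA divff ?mul1r.
have dF s : (`|s - edot u u| < rho ^+ 2 - edot u u)%R -> is_derive s (1%R : R) F (F' s).
  move=> /(le_lt_trans (ler_norm _)); rewrite ltrD2r -subr_gt0 => s0.
  have d1 : is_derive s (1%R : R) (fun s : R => rho ^+ 2 - s)%R (- 1)%R.
    by apply: is_derive_eq; rewrite add0r mul1r.
  have d2 := is_derive1_sqrt s0.
  have := @is_derive1_comp _ Num.sqrt (fun s => rho ^+ 2 - s)%R _ _ _ d2 d1.
  by rewrite mulrN1.
apply: (sdiff_radial u0 dF).
apply: cvgN; apply: cvgV.
  by rewrite mulf_neq0// gt_eqF// sqrtr_gt0.
apply: cvgM; first exact: cvg_cst.
apply: differentiable_continuous; apply/derivable1_diffP.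
by have [] := dF (edot u u) _; rewrite // subrr normr0.
Qed.

Let upper := gr i g @` V.

Let jacg u : V u -> jac (a u) = (rho / Num.sqrt (rho ^+ 2 - edot u u))%R.
Proof.
move=> /VP u0; have g0 : (0 < g u)%R by rewrite sqrtr_gt0.
have g2 : (g u ^+ 2 = rho ^+ 2 - edot u u)%R by rewrite sqr_sqrtr// ltW.
have rg : (0 <= rho / g u)%R by rewrite divr_ge0 ?ltW.
rewrite -/(g u) -[RHS](ger0_norm rg) -sqrtr_sqr.
congr Num.sqrt; have uu : edot u u = (rho ^+ 2 - g u ^+ 2)%R by rewrite g2 opprB addrC subrK.
by rewrite edotZl edotZr uu; field; rewrite gt_eqF.
Qed.

Lemma upperE : upper = [set q | enorm q = rho /\ (0 < q 0 i)%R].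
Proof.
apply/seteqP; split => [_ [u Vu <-]|q [qr q0]].
  have u0 := VP Vu; rewrite /= emb_id sqrtr_gt0; split => //.
  apply/eqP; rewrite -(@eqrXn2 _ 2)// ?enorm_ge0 ?(ltW rho0)// sqr_enorm_emb sqr_enorm.
  by rewrite [(g u ^+ 2)%R]sqr_sqrtr ?ltW// addrC subrK.
have qE : (enorm (col' i q) ^+ 2 = rho ^+ 2 - q 0%R i ^+ 2)%R.
  by rewrite -qr -[in X in _ = (enorm X ^+ 2 - _)%R](emb_col' i q) sqr_enorm_emb addrK.
exists (col' i q).
  rewrite /V enorm_eball/= -(@ltr_pXn2r _ 2) ?nnegrE ?enorm_ge0 ?ltW// qE.
  by rewrite ltrBlDr ltrDl exprn_gt0.
rewrite /gr /g -sqr_enorm qE opprB addrC subrK sqrtr_sqr gtr0_norm//.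
exact: emb_col'.
Qed.

Lemma measurable_hemisphere_jac :
  measurable_fun V (fun u => rho / Num.sqrt (rho ^+ 2 - edot u u))%R.
Proof.
apply: (eq_measurable_fun (fun u => jac (a u))).
  by move=> u /[!inE] Vu; rewrite jacg.
exact: (measurable_jac i (@open_eball _ _ _ _) ga).
Qed.

Lemma measurable_hemisphere_gr :
  measurable_fun V (fun u => emb i u (Num.sqrt (rho ^+ 2 - edot u u))).
Proof. exact: (measurable_gr i (@open_eball _ _ _ _) ga). Qed.

Lemma integral_hemisphere_chart F : measurable_fun setT F -> (forall q, 0 <= F q) ->
  \int[hm]_(q in [set q | enorm q = rho /\ (0 < q 0%R i)%R]) F q =
  \int[leb R m]_(u in V) (F (emb i u (Num.sqrt (rho ^+ 2 - edot u u))) *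
                          (rho / Num.sqrt (rho ^+ 2 - edot u u))%:E).
Proof.
move=> mF F0; rewrite -upperE (@area_formula _ _ i V g a (@open_eball _ _ _ _) ga)//.
  by apply: eq_integral => u /[!inE] Vu; rewrite jacg.
exact: measurable_funTS.
Qed.

(** The height times the area factor [rho] / height is the constant [rho]: the projection to the
    equatorial disc. *)
Lemma integral_hemisphere_normal :
  \int[hm]_(q in [set q | enorm q = rho /\ (0 < q 0%R i)%R]) `|q 0%R i|%:E =
  rho%:E * leb R m (eball 0 rho).
Proof.
rewrite integral_hemisphere_chart//; last first.
  apply/measurable_EFinP; apply: measurableT_comp => //; exact: measurable_coord.
rewrite -integral_cst; last exact: measurable_eball.
apply: eq_integral => u /[!inE] /VP u0; rewrite -EFinM emb_id ger0_norm ?sqrtr_ge0//.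
by rewrite mulrC divfK// gt_eqF// sqrtr_gt0.
Qed.

End hemisphere.

Section sphere_integrals.
Variables (R : realType) (m' : nat).
Local Notation m := m'.+1.
Local Notation hm := (@hmeasure R m m.+1).
Local Open Scope ereal_scope.

Lemma ge0_integral_involution (O : 'rV[R]_m.+1 -> 'rV[R]_m.+1) D f :
  measurable_fun setT O -> (forall u v, enorm (O u - O v) = enorm (u - v)) ->
  involutive O -> measurable D -> measurable_fun setT f -> (forall q, 0 <= f q) ->
  \int[hm]_(q in O @^-1` D) f (O q) = \int[hm]_(q in D) f q.
Proof.
move=> mO iO KO mD mf f0; apply: ge0_integral_preserving => //.
  move=> A mA _; have {2}-> : A = O @` (O @^-1` A).
    by apply/seteqP; split => [u Au|_ [u Au <-]//]; exists (O u); rewrite /= KO.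
  by rewrite -[X in _ X = _](image_id (O @^-1` A)); apply: hmeasure_isometry.
exact: measurable_funTS.
Qed.

Variable rho : R.
Hypothesis rho0 : (0 < rho)%R.

Lemma measurable_abs_edot d (T : measurableType d) (D : set T) k (f : T -> 'rV[R]_k) w :
  measurable_fun D f -> measurable_fun D (fun x => `|edot (f x) w|%:E).
Proof.
move=> mf; apply/measurable_EFinP; apply: measurableT_comp => //.
by apply: measurable_edot => //; exact: measurable_cst.
Qed.

Variable i : 'I_m.+1.
Definition cap_sphere (A : set R) := [set q : 'rV[R]_m.+1 | enorm q = rho /\ A (q 0%R i)].

Lemma measurable_cap_sphere A : measurable A -> measurable (cap_sphere A).
Proof.
move=> mA; have h := measurable_coord i measurableT mA; rewrite setTI in h.
exact: (measurableI _ _ (@measurable_sphere R m.+1 rho) h).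
Qed.

(** The equator is an isometric copy of a sphere of one dimension less, which is a Lebesgue null set
    of R^m. *)
Lemma equator_null : hm (cap_sphere [set 0%R]) = 0.
Proof.
rewrite -(leb_sphere m' rho0) -hmeasure_leb; last exact: (@measurable_sphere R _ rho).
rewrite -[X in _ = hmeasure _ X](image_id (@sphere R m rho)).
have -> : cap_sphere [set 0%R] = (fun u => emb i u 0%R) @` @sphere R m rho.
  apply/seteqP; split => [q [qr /= q0]|_ [u ur <-]].
    exists (col' i q); last by rewrite -q0 emb_col'.
    rewrite /sphere/=; apply/eqP; rewrite -(@eqrXn2 _ 2)// ?enorm_ge0 ?(ltW rho0)//.
    by rewrite -qr -[in X in _ == (enorm X ^+ 2)%R](emb_col' i q) sqr_enorm_emb q0 expr0n addr0.
  split; last by rewrite /= emb_id.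
  apply/eqP; rewrite -(@eqrXn2 _ 2)// ?enorm_ge0 ?(ltW rho0)//.
  by rewrite sqr_enorm_emb expr0n addr0 ur.
apply: hmeasure_isometry => u v _ _; apply/eqP.
by rewrite -(@eqrXn2 _ 2)// ?enorm_ge0// embB sqr_enorm_emb subrr expr0n addr0.
Qed.

Lemma integral_sphere_even (f : 'rV[R]_m.+1 -> \bar R) : measurable_fun setT f -> (forall q, 0 <= f q) ->
  (forall q, f (- q)%R = f q) ->
  \int[hm]_(q in @sphere R m.+1 rho) f q = 2%:E * \int[hm]_(q in cap_sphere [set t | (0 < t)%R]) f q.
Proof.
move=> mf f0 fN.
have mpos : measurable [set t : R | (0 < t)%R].
  by rewrite -set_itv_o_infty; exact: measurable_itv.
have mneg : measurable [set t : R | (t < 0)%R].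
  by rewrite -set_itv_infty_o; exact: measurable_itv.
have mU := measurable_cap_sphere mpos; have mL := measurable_cap_sphere mneg.
have mE := measurable_cap_sphere (@measurable_set1 R 0%R).
rewrite (ge0_negligible_integral mE) //; last 2 first.
- exact: measurable_funTS.
- exact: equator_null.
rewrite (_ : _ `\` _ = cap_sphere [set t | (0 < t)%R] `|` cap_sphere [set t | (t < 0)%R]).
  rewrite ge0_integral_setU//; last 2 first.
  - exact: measurable_funTS.
  - by apply/disj_setPS => q [[_ /= h1] [_ /= /lt_gtF]]; rewrite h1.
  rewrite (_ : \int[hm]_(q in cap_sphere [set t | (t < 0)%R]) f q =
               \int[hm]_(q in cap_sphere [set t | (0 < t)%R]) f q).
    by rewrite -mule2n mule_natl.
  rewrite -(@ge0_integral_involution (fun q => - q)%R _ f)//.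
  - have -> : (fun q : 'rV[R]_m.+1 => (- q)%R) @^-1` cap_sphere [set t | (t < 0)%R] =
        cap_sphere [set t | (0 < t)%R].
      by apply/seteqP; split => q; rewrite /cap_sphere/= enormN row_oppE oppr_lt0.
    by apply: eq_integral => q _; rewrite fN.
  - apply: measurable_fun_rV => j; under eq_fun do rewrite row_oppE.
    by apply: measurableT_comp => //; exact: measurable_coord.
  - by move=> u v; rewrite -opprD enormN.
  - exact: opprK.
apply/seteqP; split => [q [qr qE]|q [[qr /= q0]|[qr /= q0]]].
- have [q0|q0|q0] := ltgtP (q 0%R i) 0%R; [right|left|] => //.
  by case: qE.
- by split=> // -[_ /= q1]; rewrite q1 ltxx in q0.
- by split=> // -[_ /= q1]; rewrite q1 ltxx in q0.
exact: (@measurable_sphere R _ rho).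
Qed.

Lemma integral_sphere w : \int[hm]_(q in @sphere R m.+1 rho) `|edot q w|%:E =
  (2 * enorm w)%:E * (rho%:E * leb R m (eball 0 rho)).
Proof.
pose e := (enorm w *: emb i 0 1 : 'rV[R]_m.+1)%R.
have we : enorm w = enorm e.
  by rewrite /e enormZ enorm_emb0 normr1 mulr1 ger0_norm// enorm_ge0.
pose O := refl (w - e)%R.
have mO : measurable_fun setT O by exact: measurable_refl.
have -> : @sphere R m.+1 rho = O @^-1` @sphere R m.+1 rho.
  by apply/seteqP; split => q; rewrite /sphere/= /O enorm_refl.
have edE q : edot q e = (enorm w * q 0%R i)%R.
  by rewrite /e edotZr -[q in LHS](emb_col' i) edot_emb edot0r add0r mulr1.
transitivity (\int[hm]_(q in O @^-1` @sphere R m.+1 rho) `|edot (O q) e|%:E).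
  by apply: eq_integral => q _; rewrite -{1}(refl_swap we) edot_refl.
rewrite (ge0_integral_involution (f := fun q => `|edot q e|%:E)) => //; last 4 first.
- by move=> u v; rewrite -reflB enorm_refl.
- exact: reflK.
- exact: (@measurable_sphere R _ rho).
- exact/measurable_abs_edot/measurable_id.
rewrite integral_sphere_even//; last 2 first.
- exact/measurable_abs_edot/measurable_id.
- by move=> q; rewrite -scaleN1r edotZl mulN1r normrN.
rewrite EFinM -muleA; congr (_ * _).
have mcap : measurable (cap_sphere [set t | (0 < t)%R]).
  by apply: measurable_cap_sphere; rewrite -set_itv_o_infty; exact: measurable_itv.
rewrite -(integral_hemisphere_normal i rho0) -ge0_integralZl//; last 2 first.
- apply/measurable_EFinP; apply: measurableT_comp => //.
  by apply: measurable_funTS; exact: measurable_coord.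
- by rewrite lee_fin enorm_ge0.
by apply: eq_integral => q _; rewrite edE normrM ger0_norm ?enorm_ge0.
Qed.

(** A reflection that moves [w] to the axis does not preserve the hemisphere. The whole sphere is
    preserved, and the evenness of the integrand then halves its integral. *)
Lemma integral_hemisphere w :
  \int[hm]_(q in cap_sphere [set t | (0 < t)%R]) `|edot q w|%:E =
  (enorm w)%:E * (rho%:E * leb R m (eball 0 rho)).
Proof.
have := integral_sphere w; rewrite integral_sphere_even//; last 2 first.
- exact/measurable_abs_edot/measurable_id.
- by move=> q; rewrite -scaleN1r edotZl mulN1r normrN.
rewrite EFinM -muleA => /(congr1 (fun x => (2^-1)%:E * x)).
by rewrite 2!(muleA (2^-1)%:E) -EFinM mulVf ?pnatr_eq0// !mul1e.
Qed.

End sphere_integrals.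

(** * Averaging over the unit ball *)

Section edot_tonelli.
Context d d' (T : measurableType d) (T' : measurableType d') (R : realType).
Variables (mu : {sigma_finite_measure set T -> \bar R}).
Variables (nu : {sigma_finite_measure set T' -> \bar R}).
Local Open Scope ereal_scope.

(** Extension by zero, so that Tonelli applies on the full product: the pairing vanishes as soon as
    one factor does. *)
Definition mkcondV d0 (T0 : measurableType d0) k (D : set T0) (f : T0 -> 'rV[R]_k) x :=
  if x \in D then f x else 0%R.

Lemma measurable_mkcondV d0 (T0 : measurableType d0) k (D : set T0) (f : T0 -> 'rV[R]_k) :
  measurable D -> measurable_fun D f -> measurable_fun setT (mkcondV D f).
Proof.
move=> mD mf; apply: measurable_fun_rV => i.
have -> : (fun x => mkcondV D f x 0%R i) = (fun x => f x 0%R i) \_ D.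
  by apply/funext => x; rewrite patchE /mkcondV; case: ifPn => // _; rewrite mxE.
by apply/(measurable_restrictT _ mD); exact: measurable_coord_comp.
Qed.

Variables (k : nat) (D : set T) (E : set T') (G : T -> 'rV[R]_k) (H : T' -> 'rV[R]_k).
Hypotheses (mD : measurable D) (mE : measurable E).
Hypotheses (mG : measurable_fun D G) (mH : measurable_fun E H).

Let f (z : T * T') := `|edot (mkcondV D G z.1) (mkcondV E H z.2)|%:E.

Let mf : measurable_fun setT f.
Proof.
apply/measurable_EFinP; apply: measurableT_comp => //; apply: measurable_edot.
  exact: (measurableT_comp (measurable_mkcondV mD mG) measurable_fst).
exact: (measurableT_comp (measurable_mkcondV mE mH) measurable_snd).
Qed.

Let integral_fr x : \int[nu]_y f (x, y) =
  ((fun x => \int[nu]_(y in E) `|edot (G x) (H y)|%:E) \_ D) x.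
Proof.
rewrite patchE /f/= {1}/mkcondV.
case: ifPn => xD; last by under eq_integral do rewrite edot0l normr0; rewrite integral0.
rewrite [RHS]integral_mkcond; apply: eq_integral => y _; rewrite patchE /mkcondV.
by case: ifPn => // _; rewrite edot0r normr0.
Qed.

Lemma measurable_integral_edot :
  measurable_fun D (fun x => \int[nu]_(y in E) `|edot (G x) (H y)|%:E).
Proof.
apply: (eq_measurable_fun (fun x => \int[nu]_y f (x, y))).
  by move=> x xD; rewrite integral_fr patchE xD.
by apply: measurable_funTS; apply: measurable_fun_fubini_tonelli_F => // z; rewrite lee_fin.
Qed.

Lemma tonelli_edot :
  \int[mu]_(x in D) \int[nu]_(y in E) `|edot (G x) (H y)|%:E =
  \int[nu]_(y in E) \int[mu]_(x in D) `|edot (G x) (H y)|%:E.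
Proof.
transitivity (\int[mu]_x \int[nu]_y f (x, y)).
  by rewrite integral_mkcond; apply: eq_integral => x _; rewrite integral_fr.
rewrite (fubini_tonelli _ mf) => [|z]; last by rewrite lee_fin.
rewrite [RHS]integral_mkcond; apply: eq_integral => y _; rewrite patchE /f/= {2}/mkcondV.
case: ifPn => yE; last by under eq_integral do rewrite edot0r normr0; rewrite integral0.
rewrite [RHS]integral_mkcond; apply: eq_integral => x _; rewrite patchE /mkcondV.
by case: ifPn => // _; rewrite edot0l normr0.
Qed.

End edot_tonelli.

Section averaging.
Variables (R : realType) (k : nat).
Local Notation N := k.+1.
Local Open Scope ereal_scope.
Let B : set 'rV[R]_N := eball 0 1%R.
Let mB : measurable B. Proof. exact: measurable_eball. Qed.

(** [ball_norm] and [ball_coord] only serve as a ratio that cancels in the end; they need no value,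
    only to be positive and finite. The index [k] refers to the ball of R^(k+1). *)
Definition ball_norm : \bar R := \int[leb R N]_(w in B) (enorm w)%:E.
Definition ball_coord : \bar R := \int[leb R N]_(w in B) `|w 0%R ord0|%:E.

Lemma integral_ball_edot v : \int[leb R N]_(w in B) `|edot v w|%:E = (enorm v)%:E * ball_coord.
Proof.
pose e := (enorm v *: 'e_(@ord0 k) : 'rV[R]_N)%R.
have ve : enorm v = enorm e.
  rewrite /e enormZ ger0_norm ?enorm_ge0// /enorm edot_delta.
  by rewrite mxE !eqxx sqrtr1 mulr1.
pose O := refl (v - e)%R.
transitivity (\int[leb R N]_(w in O @^-1` B) `|edot e (O w)|%:E).
  rewrite (_ : O @^-1` B = B).
    by apply: eq_integral => w _; rewrite -(refl_swap ve) edot_refl.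
  by apply/seteqP; split => w; rewrite /B enorm_eball/= enorm_refl.
rewrite (ge0_integral_preserving (nu := leb R N) (g := fun w => `|edot e w|%:E))//; last 3 first.
- exact: measurable_refl.
- by move=> A mA _; exact: leb_refl.
- under eq_fun do rewrite edotC; exact/measurable_abs_edot/measurable_id.
rewrite -ge0_integralZl//; last 2 first.
- apply/measurable_EFinP; apply: measurableT_comp => //.
  by apply: measurable_funTS; exact: measurable_coord.
- by rewrite lee_fin enorm_ge0.
apply: eq_integral => w _; rewrite /e edotZl edotC edot_delta normrM ger0_norm//.
exact: enorm_ge0.
Qed.

Lemma ball_norm_lty : ball_norm < +oo.
Proof.
apply: (le_lt_trans _ (leb_eball_lty (0%R : 'rV[R]_N) 1%R)).
rewrite -[leX in _ <= leX]mul1e -integral_cst//; apply: ge0_le_integral => //.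
- by move=> w _; rewrite lee_fin enorm_ge0.
- apply/measurable_EFinP/measurable_enorm; exact: measurable_id.
- by move=> w; rewrite /B enorm_eball/= => /ltW; rewrite lee_fin.
Qed.

Lemma ball_coord_le : ball_coord <= ball_norm.
Proof.
apply: ge0_le_integral => //.
- apply/measurable_EFinP; apply: measurableT_comp => //.
  by apply: measurable_funTS; exact: measurable_coord.
- apply/measurable_EFinP/measurable_enorm; exact: measurable_id.
- by move=> w _; rewrite lee_fin coord_le_enorm.
Qed.

(** On the ball of radius 1/4 around half the first basis vector, contained in the unit ball, the
    first coordinate is at least 1/4. *)
Lemma ball_coord_gt0 : 0 < ball_coord.
Proof.
pose c : 'rV[R]_N := (2^-1 *: 'e_(@ord0 k))%R.
have cn : enorm c = 2^-1%R.
  by rewrite /c enormZ ger0_norm// /enorm edot_delta mxE !eqxx sqrtr1 mulr1.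
have cB : eball c 4^-1%R `<=` B.
  move=> w; rewrite /B enorm_eball /eball/= => wc.
  by have := ler_enorm_dist w c; rewrite cn; lra.
have m4 : measurable (eball c 4^-1%R) by exact: measurable_eball.
have lb : (4^-1%:E * leb R N (eball c 4^-1%R) <= ball_coord).
  rewrite -integral_cst//.
  apply: (@le_trans _ _ (\int[leb R N]_(w in eball c 4^-1%R) `|w 0%R ord0|%:E)).
    apply: ge0_le_integral => //.
    - by move=> w _; rewrite lee_fin invr_ge0.
    - apply/measurable_EFinP; apply: measurableT_comp => //.
      by apply: measurable_funTS; exact: measurable_coord.
    - move=> w wc; rewrite lee_fin.
      have := coord_le_enorm (w - c)%R ord0; rewrite row_subE /c row_scaleE mxE !eqxx mulr1.
      move: wc; rewrite /eball/= => wc h.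
      by have := ler_norm (w 0%R ord0); move: (le_lt_trans h wc); rewrite ltr_norml => /andP[]; lra.
  apply: ge0_subset_integral => //.
  apply/measurable_EFinP; apply: measurableT_comp => //.
  by apply: measurable_funTS; exact: measurable_coord.
apply: lt_le_trans lb; rewrite mule_gt0// -(leb_translation_invariant c)//.
rewrite (_ : [set u | _] = eball 0 4^-1%R) ?leb_eball_gt0//.
by apply/seteqP; split => u; rewrite /eball/= addrK subr0.
Qed.

(** Integrate the hypothesis over [w] in the unit ball and exchange the integrals: the mean of |<G
    x, w>| over [w] depends on |G x| alone. So [kappa] is determined by the lengths of [G]. *)
Lemma average_edot d (T : measurableType d) (mu : {sigma_finite_measure set T -> \bar R})
    (D : set T) (G : T -> 'rV[R]_N) (kappa : \bar R) : 0 <= kappa ->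
  measurable D -> measurable_fun D G ->
  (forall w, \int[mu]_(x in D) `|edot (G x) w|%:E = (enorm w)%:E * kappa) ->
  ball_norm * kappa = ball_coord * \int[mu]_(x in D) (enorm (G x))%:E.
Proof.
move=> kappa0 mD mG Gk.
have c0 : 0 <= ball_coord by exact: ltW ball_coord_gt0.
rewrite /ball_norm muleC -[LHS]ge0_integralZl//; last 2 first.
- apply/measurable_EFinP/measurable_enorm; exact: measurable_id.
- by move=> w _; rewrite lee_fin enorm_ge0.
rewrite -ge0_integralZl//; last 2 first.
- exact/measurable_EFinP/measurable_enorm.
- by move=> w _; rewrite lee_fin enorm_ge0.
transitivity (\int[leb R N]_(w in B) \int[mu]_(x in D) `|edot (G x) w|%:E).
  by apply: eq_integral => w _; rewrite Gk muleC.
rewrite -(tonelli_edot mu (leb R N) mD mB mG (@measurable_id _ _ B)).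
by apply: eq_integral => x _; rewrite integral_ball_edot muleC.
Qed.

End averaging.

Section sphere_constants.
Variables (R : realType) (m' : nat).
Local Notation m := m'.+1.
Local Notation hm := (@hmeasure R m m.+1).
Local Open Scope ereal_scope.

(** The position field has length 1 on the unit sphere, so its average is the area of the cap, while
    [integral_hemisphere] provides its constant [kappa], the volume of the equatorial disc. *)
Lemma hmeasure_sphere :
  ball_coord R m * hm (@sphere R m.+1 1%R) = 2%:E * (leb R m (eball 0%R 1%R) * ball_norm R m).
Proof.
pose i : 'I_m.+1 := ord0; pose V : set 'rV[R]_m := eball 0%R 1%R.
pose h (u : 'rV[R]_m) : R := (1 / Num.sqrt (1 ^+ 2 - edot u u))%R.
pose gru (u : 'rV[R]_m) := emb i u (Num.sqrt (1 ^+ 2 - edot u u)).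
pose cap := cap_sphere (1%R : R) i [set t | (0 < t)%R].
have h0 u : (0 <= h u)%R by rewrite divr_ge0// sqrtr_ge0.
have mG : measurable_fun V (fun u => h u *: gru u)%R.
  apply: measurable_scalerV; first exact: (measurable_hemisphere_jac i ltr01).
  exact: (measurable_hemisphere_gr i ltr01).
have mV : measurable V by exact: measurable_eball.
have avg := @average_edot R m _ _ (leb R m) V (fun u => h u *: gru u)%R (leb R m V)
  (measure_ge0 _ _) mV mG.
have -> : hm (@sphere R m.+1 1%R) = 2%:E * hm cap.
  have mS := @measurable_sphere R m.+1 1%R.
  have mc : measurable cap.
    by apply: measurable_cap_sphere; rewrite -set_itv_o_infty; exact: measurable_itv.
  rewrite -[LHS]mul1e -[hm cap]mul1e -!integral_cst//.
  by rewrite (integral_sphere_even ltr01 i).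
rewrite muleCA; congr (_ * _); rewrite [RHS]muleC avg.
  congr (_ * _); rewrite -[LHS]mul1e -integral_cst//; last first.
    by apply: measurable_cap_sphere; rewrite -set_itv_o_infty; exact: measurable_itv.
  transitivity (\int[hm]_(q in cap) (enorm q)%:E).
    by apply: eq_integral => q /[!inE] -[-> _].
  rewrite (integral_hemisphere_chart i ltr01)//; last first.
  - by move=> q; rewrite lee_fin enorm_ge0.
  - exact/measurable_EFinP/measurable_enorm.
  by apply: eq_integral => u _; rewrite enormZ -EFinM mulrC (ger0_norm (h0 u)).
move=> w; rewrite -[leb R m V]mul1e -(integral_hemisphere ltr01 i w).
rewrite (integral_hemisphere_chart i ltr01)//; last exact/measurable_abs_edot.
by apply: eq_integral => u _; rewrite edotZl normrM -EFinM mulrC (ger0_norm (h0 u)).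
Qed.

(** This is the hemisphere integral for the horizontal direction [emb i w 0], which cancels the
    height term of the chart. *)
Lemma integral_ball_radial (rho : R) (w : 'rV[R]_m) : (0 < rho)%R ->
  \int[leb R m]_(u in eball 0%R rho)
    `|edot ((rho / Num.sqrt (rho ^+ 2 - edot u u)) *: u)%R w|%:E =
  (enorm w)%:E * (rho%:E * leb R m (eball 0%R rho)).
Proof.
move=> rho0; pose i : 'I_m.+1 := ord0.
have <- : enorm (emb i w 0%R) = enorm w.
  by apply/eqP; rewrite -(@eqrXn2 _ 2)// ?enorm_ge0// sqr_enorm_emb expr0n addr0.
rewrite -(integral_hemisphere rho0 i) (integral_hemisphere_chart i rho0)//; last first.
  exact/measurable_abs_edot/measurable_id.
apply: eq_integral => u _; rewrite edot_emb mulr0 addr0 edotZl normrM -EFinM mulrC.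
have h0 : (0 <= rho / Num.sqrt (rho ^+ 2 - edot u u))%R by rewrite divr_ge0 ?sqrtr_ge0// ltW.
by rewrite (ger0_norm h0).
Qed.

End sphere_constants.

(** * Unitary invariance of a field twisted by a complex structure *)

Section reflection_linear.
Variables (R : realType) (k : nat).
Implicit Types u v w : 'rV[R]_k.

Lemma reflZ w c u : refl w (c *: u) = c *: refl w u.
Proof. by rewrite /refl edotZl; apply/rowP => i; rewrite !mxE; ring. Qed.

Lemma reflD w u v : refl w (u + v) = refl w u + refl w v.
Proof. by rewrite /refl edotDl; apply/rowP => i; rewrite !mxE; ring. Qed.

Lemma reflN w u : refl (- w) u = refl w u.
Proof.
have -> : - w = -1 *: w by rewrite scaleN1r.
rewrite /refl edotZl !edotZr !mulN1r opprK scalerA.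
by congr (_ - _ *: _); ring.
Qed.

Lemma refl_ortho u v : edot u v = 0 -> refl v u = u.
Proof. by move=> uv; rewrite /refl uv mulr0 mul0r scale0r subr0. Qed.

Lemma refl_comm v w u : edot v w = 0 -> refl v (refl w u) = refl w (refl v u).
Proof.
move=> vw; have wv : edot w v = 0 by rewrite edotC.
have -> : refl w u = u - (2 * edot u w / edot w w) *: w by [].
rewrite reflB reflZ (refl_ortho wv).
have -> : refl v u = u - (2 * edot u v / edot v v) *: v by [].
by rewrite reflB reflZ (refl_ortho vw) /refl addrAC.
Qed.

End reflection_linear.

Section twisted_field.
Variables (R : realType) (m' : nat).
Local Notation m := m'.+1.
Variable J : 'rV[R]_m -> 'rV[R]_m.
Hypothesis JB : forall u v, J (u - v) = J u - J v.
Hypothesis JZ : forall c u, J (c *: u) = c *: J u.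
Hypothesis Jdot : forall u v, edot (J u) (J v) = edot u v.
Hypothesis JJ : forall u, J (J u) = - u.
Hypothesis mJ : measurable_fun setT J.
Implicit Types (u v w x : 'rV[R]_m).

Let JD u v : J (u + v) = J u + J v.
Proof.
have JN w : J (- w) = - J w by have := JZ (-1) w; rewrite !scaleN1r.
by have := JB u (- v); rewrite JN !opprK.
Qed.

Let JdotN u v : edot (J u) v = - edot u (J v).
Proof. by rewrite -Jdot JJ -scaleN1r edotZl mulN1r. Qed.

Let Jxx u : edot u (J u) = 0.
Proof. by apply/eqP; have := JdotN u u; rewrite edotC => h; apply/eqP; lra. Qed.

Let Jrefl v u : J (refl v u) = refl (J v) (J u).
Proof. by rewrite /refl JB JZ !Jdot. Qed.

(* The complex reflection in the hyperplane orthogonal to [v] for the complex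
   structure [J]. *)
Let crefl v u := refl v (refl (J v) u).

Let J_crefl v u : J (crefl v u) = crefl v (J u).
Proof. by rewrite /crefl !Jrefl JJ reflN refl_comm// JdotN Jxx oppr0. Qed.

Variables (V : set 'rV[R]_m) (al : R -> R).
Hypothesis mV : measurable V.
Hypothesis Vr : forall u v, enorm u = enorm v -> V u -> V v.
Let G u := al (enorm u) *: u + J u.
Hypothesis mG : measurable_fun V G.
Local Open Scope ereal_scope.
Let I w := \int[leb R m]_(u in V) `|edot (G u) w|%:E.

(** A linear isometry that commutes with [J] commutes with [G] too, since [al] only sees the length,
    and it preserves [V]. *)
Let I_isometry (O : 'rV[R]_m -> 'rV[R]_m) w : measurable_fun setT O ->
  (forall u v, O (u - v) = O u - O v)%R -> (forall u v, O (u + v) = O u + O v)%R ->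
  (forall c u, O (c *: u) = c *: O u)%R -> (forall u, J (O u) = O (J u)) ->
  (forall u v, edot (O u) (O v) = edot u v) -> (forall v, exists u, O u = v) ->
  I (O w) = I w.
Proof.
move=> mO OB OD OZ OJ Odot sO.
have On u : enorm (O u) = enorm u by rewrite /enorm Odot.
have OV : O @^-1` V = V.
  by apply/seteqP; split => u; apply: Vr; rewrite On.
rewrite /I -{1}(ge0_integral_preserving (mu := leb R m) (f := O))//.
- rewrite OV; apply: eq_integral => u _; rewrite /G On OJ -OZ -OD Odot.
  by [].
- by move=> A mA _; apply: leb_isometry => // u v; rewrite -OB On.
- exact: measurable_abs_edot.
Qed.

Let I_crefl v w : I (crefl v w) = I w.
Proof.
apply: I_isometry.
- exact: (measurableT_comp (@measurable_refl _ _ v) (@measurable_refl _ _ (J v))).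
- by move=> x y; rewrite /crefl !reflB.
- by move=> x y; rewrite /crefl !reflD.
- by move=> c x; rewrite /crefl !reflZ.
- by move=> x; exact: J_crefl.
- by move=> x y; rewrite /crefl !edot_refl.
- by move=> x; exists (refl (J v) (refl v x)); rewrite /crefl !reflK.
Qed.

Let I_rot c s w : (c ^+ 2 + s ^+ 2 = 1)%R -> I (c *: w + s *: J w)%R = I w.
Proof.
move=> cs; apply: (@I_isometry (fun w => c *: w + s *: J w)%R).
- by apply: measurable_addrV; apply: measurable_scalerV => //; exact: measurable_cst.
- by move=> x y; rewrite JB; apply/rowP => i; rewrite !mxE; ring.
- by move=> x y; rewrite JD; apply/rowP => i; rewrite !mxE; ring.
- by move=> a x; rewrite JZ; apply/rowP => i; rewrite !mxE; ring.
- by move=> x; rewrite JD !JZ.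
- move=> x y; rewrite !edotDl !edotDr !edotZl !edotZr Jdot JdotN.
  by rewrite -[RHS]mul1r -cs; ring.
- move=> x; exists (c *: x - s *: J x)%R; rewrite JB !JZ JJ.
  by apply/rowP => i; rewrite !mxE -[RHS]mul1r -cs; ring.
Qed.

(** [crefl (w - z)] carries [w] to [z] only if [w] is orthogonal to [J z]. So [w'] is first
    multiplied by a complex phase [c + s J] that makes its Hermitian product with [w] real. *)
Let I_enorm w w' : enorm w = enorm w' -> I w = I w'.
Proof.
move=> ww'.
have [c [s [cs h]]] : exists c s : R, (c ^+ 2 + s ^+ 2 = 1 /\
    c * edot w (J w') = s * edot w w')%R.
  (* The phase is the normalised Hermitian product; if that product vanishes, the phase 1 does. *)
  pose a := edot w w'; pose b := edot w (J w'); pose r := Num.sqrt (a ^+ 2 + b ^+ 2).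
  have [r0|r0] := eqVneq r 0%R.
    exists 1%R, 0%R; split; first by ring.
    have : (a ^+ 2 + b ^+ 2 <= 0)%R by rewrite -sqrtr_eq0 -/r r0.
    rewrite -/b mul0r mul1r => ab; apply/eqP; rewrite -sqrf_eq0 eq_le sqr_ge0 andbT.
    by have := sqr_ge0 a; lra.
  exists (a / r)%R, (b / r)%R; split; last by rewrite -/a -/b; ring.
  have r2 : (r ^+ 2 = a ^+ 2 + b ^+ 2)%R by rewrite sqr_sqrtr// addr_ge0 ?sqr_ge0.
  by rewrite !expr_div_n -mulrDl -r2 divff// sqrf_eq0.
rewrite -(I_rot w' cs); set z := (c *: w' + s *: J w')%R.
have wz : enorm w = enorm z.
  rewrite ww' /enorm /z !edotDl !edotDr !edotZl !edotZr Jdot JdotN Jxx.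
  by congr Num.sqrt; rewrite -[LHS]mul1r -cs; ring.
have wJz : edot w (J z) = 0%R.
  by rewrite /z JD !JZ JJ edotDr !edotZr edotNr h; ring.
rewrite -(I_crefl (w - z)%R w); congr I.
rewrite /crefl (refl_ortho (v := J (w - z)%R)) ?refl_swap//.
by rewrite JB edotBr Jxx wJz subrr.
Qed.

(** Unitary invariance makes [I] a multiple of the norm. The multiple is that of the radial field of
    the same length, which carries no twist and is handled by reflections. *)
Lemma integral_twisted kappa :
  (forall w, \int[leb R m]_(u in V) `|edot (enorm (G u) / enorm u *: u)%R w|%:E =
     (enorm w)%:E * kappa) ->
  measurable_fun V (fun u => enorm (G u) / enorm u *: u)%R -> 0 <= kappa ->
  forall w, I w = (enorm w)%:E * kappa.
Proof.
move=> Hk mH kappa0.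
pose e : 'rV[R]_m := 'e_(@ord0 m').
have e1 : enorm e = 1%R by rewrite /enorm edot_delta mxE !eqxx sqrtr1.
have Ie w : I w = (enorm w)%:E * I e.
  rewrite (@I_enorm w (enorm w *: e)%R); last first.
    by rewrite enormZ e1 mulr1 ger0_norm// enorm_ge0.
  rewrite /I -ge0_integralZl//; last 2 first.
  - exact: measurable_abs_edot.
  - by rewrite lee_fin enorm_ge0.
  by apply: eq_integral => u _; rewrite edotZr normrM ger0_norm ?enorm_ge0.
have Ie0 : 0 <= I e by apply: integral_ge0.
suff <- : I e = kappa by exact: Ie.
(* The two fields have the same length, hence the same average over [w]. *)
have h1 := average_edot (mu := leb R m) Ie0 mV mG Ie.
have h2 := average_edot (mu := leb R m) kappa0 mV mH Hk.
have : ball_norm R m' * I e = ball_norm R m' * kappa.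
  rewrite h1 h2; congr (_ * _); apply: eq_integral => u _; congr (_%:E).
  rewrite enormZ ger0_norm ?divr_ge0 ?enorm_ge0//.
  have [->|u0] := eqVneq u 0%R; last by rewrite divfK// enorm_eq0.
  by rewrite /G scaler0 add0r -[X in J X](scale0r 0%R) JZ scale0r enorm0 mulr0.
have b0 : 0 < ball_norm R m' := lt_le_trans (ball_coord_gt0 R m') (ball_coord_le R m').
have : ball_norm R m' \is a fin_num by rewrite ge0_fin_numE ?ball_norm_lty// ltW.
move=> /fineK bE; rewrite -bE.
move=> /(congr1 (fun x : \bar R => (fine (ball_norm R m'))^-1%:E * x)).
by rewrite !muleA -!EFinM mulVf ?mul1e// gt_eqF// -lte_fin bE.
Qed.

End twisted_field.

(** * Volumes of balls *)

Section gauss.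
Variable R : realType.
Local Open Scope ereal_scope.
Local Notation lam := (@lebesgue_measure R).

Lemma integral_gauss_rV k :
  \int[leb R k]_u (expR (- edot u u))%:E = (Num.sqrt pi ^+ k)%:E.
Proof.
elim: k => [|k IHk].
  transitivity (\int[leb R 0]_u (cst 1 u)).
    by apply: eq_integral => u _; rewrite /edot big_ord0 oppr0 expR0.
  rewrite integral_cst// mul1e expr0; apply: (eq_trans (lebE (k := 0) (@measurableT _ _))); exact: diracT.
have mexp k' : measurable_fun setT (fun u : 'rV[R]_k' => expR (- edot u u)).
  apply: measurableT_comp => //; apply: measurableT_comp => //.
  by apply: measurable_edot; exact: measurable_id.
rewrite ge0_integral_lebS//; last exact/measurable_EFinP.
transitivity (\int[lam]_t ((gauss_fun t)%:E * (Num.sqrt pi ^+ k)%:E)).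
  apply: eq_integral => t _; rewrite -IHk -ge0_integralZl//; last 2 first.
  - exact/measurable_EFinP.
  - by rewrite lee_fin gauss_fun_ge0.
  by apply: eq_integral => u _; rewrite edot_consv/= opprD expRD -expr2 EFinM.
rewrite ge0_integralZr//; last 2 first.
- by apply/measurable_EFinP; exact: measurable_gauss_fun.
- by move=> t _; rewrite lee_fin gauss_fun_ge0.
by rewrite integralT_gauss -EFinM -exprS.
Qed.

Lemma integral_exp_tail (a : R) : \int[lam]_(s in `]a, +oo[) (expR (- s))%:E = (expR (- a))%:E.
Proof.
have cexp : continuous (fun x : R => expR (- x)).
  by move=> x; apply: continuous_comp; [exact: continuousN|exact: continuous_expR].
have d (x : R) : is_derive x (1%R : R) (fun x => - expR (- x))%R (expR (- x)).
  by apply: is_derive_eq; rewrite mulrN1 opprK.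
rewrite integral_itv_obnd_cbnd; last first.
  by apply/measurable_EFinP; apply: measurable_funTS; apply: continuous_measurable_fun; exact: cexp.
rewrite (@ge0_continuous_FTC2y _ _ (fun x => - expR (- x))%R a 0%R).
- by rewrite EFinN oppeK add0e.
- by move=> x _; exact: expR_ge0.
- exact: continuous_subspaceT.
- by rewrite -oppr0; apply: cvgN; exact: cvgr_expR.
- by move=> x _; have [] := d x.
- by apply: cvg_at_right_filter; apply: cvgN; exact: cexp.
- by move=> x _; rewrite derive1E; have [_ ->] := d x.
Qed.

(** Write exp(-|u|^2) as the integral of exp(-s) over s > |u|^2 and exchange: at level s one finds
    the ball of radius sqrt s, of volume s^(m/2) times that of the unit ball. *)
Lemma leb_ball_Gamma m' : leb R m'.+1 (eball 0%R 1%R) *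
    \int[lam]_(t in `]0%R, +oo[) (t `^ (m'.+1%:R / 2) * expR (- t))%:E =
  (Num.sqrt pi ^+ m'.+1)%:E.
Proof.
set m := m'.+1; rewrite -integral_gauss_rV.
pose E : set ('rV[R]_m * measurableTypeR R) := [set z | edot z.1 z.1 < z.2]%R.
have mE : measurable E.
  have mf : measurable_fun setT (fun z : 'rV[R]_m * measurableTypeR R => z.2 - edot z.1 z.1)%R.
    apply: measurable_funB; first exact: measurable_snd.
    by apply: measurable_edot; exact: measurable_fst.
  have mp : measurable (`]0%R, +oo[%classic : set R) by exact: measurable_itv.
  have := mf measurableT _ mp; rewrite setTI; congr measurable.
  by apply/seteqP; split => z; rewrite /E/= in_itv/= andbT subr_gt0.
have EE u s : ((u, s) \in E) = (edot u u < s)%R.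
  by apply/idP/idP => [/set_mem//|h]; exact: mem_set.
have itvE (a s : R) : (s \in (`]a, +oo[%classic : set R)) = (a < s)%R.
  by apply/idP/idP => [/set_mem|h]; last apply: mem_set; rewrite /= in_itv/= andbT.
pose f (z : 'rV[R]_m * measurableTypeR R) : \bar R := (\1_E z * expR (- z.2))%:E.
have mf : measurable_fun setT f.
  apply/measurable_EFinP; apply: measurable_funM; first exact: measurable_indic.
  by apply: measurableT_comp => //; apply: measurableT_comp => //; exact: measurable_snd.
have f0 z : 0 <= f z by rewrite lee_fin mulr_ge0// expR_ge0.
transitivity (\int[lam]_s \int[leb R m]_u f (u, s)); last first.
  rewrite -(fubini_tonelli _ mf)//.
  apply: eq_integral => u _; rewrite -integral_exp_tail [RHS]integral_mkcond.
  apply: eq_integral => s _; rewrite /f/= patchE indicE EE itvE.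
  by case: ifPn => _; rewrite ?mul1r ?mul0r.
rewrite -ge0_integralZl//; last 2 first.
- apply/measurable_EFinP; apply: measurable_funM; apply: measurable_funTS.
    exact: measurable_powR.
  by apply: measurableT_comp => //; exact: measurableT_comp.
- by move=> t _; rewrite lee_fin mulr_ge0 ?powR_ge0 ?expR_ge0.
rewrite integral_mkcond; apply: eq_integral => s _; rewrite patchE itvE.
have fE : \int[leb R m]_u f (u, s) = (expR (- s))%:E * leb R m [set u | edot u u < s]%R.
  have mEs : measurable [set u : 'rV[R]_m | edot u u < s]%R.
    have := measurable_ysection s mE; congr measurable.
    by apply/seteqP; split => u; rewrite /ysection/= inE.
  rewrite -integral_cst// [RHS]integral_mkcond; apply: eq_integral => u _.
  have sE : (u \in [set u : 'rV[R]_m | edot u u < s]%R) = (edot u u < s)%R.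
    by apply/idP/idP => [/set_mem//|h]; exact: mem_set.
  rewrite /f patchE indicE/= EE sE.
  by case: ifPn => _; rewrite ?mul1r ?mul0r.
rewrite fE; case: ifPn => [s0|]; last first.
  rewrite -leNgt => s0; rewrite (_ : [set u | _] = set0) ?measure0 ?mule0//.
  by rewrite -subset0 => u /= /lt_le_trans/(_ s0); rewrite ltNge edot_ge0.
have -> : [set u : 'rV[R]_m | edot u u < s]%R = eball 0%R (Num.sqrt s).
  rewrite enorm_eball; apply/seteqP; split => u /=; rewrite /enorm ltr_sqrt//.
have pE : (s `^ (m%:R / 2) = Num.sqrt s ^+ m)%R.
  by rewrite mulrC powRrM powR12_sqrt ?ltW// powR_mulrn// sqrtr_ge0.
by rewrite (@leb_eball_scale _ _ (Num.sqrt s)) ?sqrtr_gt0// pE EFinM [LHS]muleC [RHS]muleCA muleA.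
Qed.

End gauss.

Section ball_constants.
Variable R : realType.

Definition omega k : R := fine (leb R k (eball 0 1)).

Lemma omega_gt0 m' : 0 < omega m'.+1.
Proof. by rewrite fine_gt0// leb_eball_gt0// leb_eball_lty. Qed.

Lemma omegaE m' : leb R m'.+1 (eball 0 1) = (omega m'.+1)%:E.
Proof. by rewrite fineK// ge0_fin_numE ?leb_eball_lty. Qed.

Lemma omega_Gamma m' s : s = m'.+1%:R / 2 + 1 ->
  omega m'.+1 * Gamma s = Num.sqrt (pi : R) ^+ m'.+1.
Proof.
move=> ->; have := leb_ball_Gamma R m'; rewrite omegaE /Gamma addrK /Rintegral.
move: (integral _ _ _) => I h.
(* The positive volume times [I] is finite, so [I] is finite and taking [fine] in [Gamma] loses
   nothing. *)
have : I \is a fin_num.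
  case: I h => [r| |]//; rewrite ?gt0_muley ?gt0_muleNy ?lte_fin ?omega_gt0//.
move=> /fineK IE; rewrite -IE -EFinM in h; exact: EFin_inj h.
Qed.

(** From omega_(2n) Gamma(n+1) = pi^n and omega_(2n-1) Gamma(n+1/2) = pi^(n-1/2). The right side is
    the value of [sheet_const], which is how [Cn] enters. *)
Lemma Cn_omega n' (lambda : R) : 0 < lambda ->
  Cn n'.+1 lambda * omega (n' + n'.+1) = lambda^-1 ^+ (n'.+1 + n'.+1).+1 * omega (n'.+1 + n'.+1).
Proof.
move=> l0; have p0 : 0 < Num.sqrt (pi : R) by rewrite sqrtr_gt0 pi_gt0.
have h1 : omega (n'.+1 + n'.+1) * Gamma (n'.+1%:R + 1) = Num.sqrt (pi : R) ^+ (n'.+1 + n'.+1).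
  apply: (@omega_Gamma (n' + n'.+1)).
  have -> : (n' + n'.+1).+1%:R = n'.+1%:R + n'.+1%:R :> R by rewrite -natrD.
  by field.
have h2 : omega (n' + n'.+1) * Gamma (n'.+1%:R + 2^-1) = Num.sqrt (pi : R) ^+ (n' + n'.+1).
  rewrite addnS; apply: omega_Gamma.
  have -> : (n' + n').+1%:R = n'%:R + n'%:R + 1 :> R by rewrite -addn1 !natrD.
  by rewrite -addn1 natrD; field.
have G0 : Gamma (n'.+1%:R + 1) != 0 :> R.
  by apply: contra_eq_neq h1 => ->; rewrite mulr0 eq_sym expf_neq0// gt_eqF.
rewrite /Cn mul2n -addnn exprVn.
have -> : omega (n'.+1 + n'.+1) = Num.sqrt (pi : R) ^+ (n'.+1 + n'.+1) / Gamma (n'.+1%:R + 1).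
  by rewrite -h1 mulfK.
have -> : Num.sqrt (pi : R) ^+ (n'.+1 + n'.+1) =
    Num.sqrt (pi : R) * Num.sqrt (pi : R) ^+ (n' + n'.+1) by rewrite addSn exprS.
rewrite -h2.
by field; rewrite G0 expf_neq0// gt_eqF.
Qed.

End ball_constants.

(** * The Pansu sphere *)

Section pansu_profile.
Variables (R : realType) (lambda : R).
Hypothesis l0 : 0 < lambda.
Local Notation rho := (lambda^-1).
Implicit Types s r : R.

Let lr r : 0 <= r -> r < rho -> 0 <= lambda * r < 1.
Proof.
by move=> r0 rr; rewrite mulr_ge0 ?(ltW l0)//= -(mulfV (lt0r_neq0 l0)) ltr_pM2l.
Qed.

Let lr2 r : 0 <= r -> r < rho -> 0 < 1 - lambda ^+ 2 * r ^+ 2.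
Proof.
move=> r0 /(lr r0)/andP[h0 h1]; rewrite subr_gt0 -exprMn.
by rewrite expr_lt1.
Qed.

Lemma pansu_profile_gt0 r : 0 < r -> r < rho -> 0 < pansu_profile lambda r.
Proof.
move=> r0 rr; have /andP[h0 h1] := lr (ltW r0) rr.
rewrite /pansu_profile mulr_gt0 ?invr_gt0 ?mulr_gt0 ?exprn_gt0//.
rewrite ltr_pwDl ?mulr_gt0 ?sqrtr_gt0 ?lr2 ?(ltW r0)//.
by rewrite acos_ge0//; apply/andP; split; [exact: le_trans h0|exact: ltW].
Qed.

Lemma pansu_profile_rho : pansu_profile lambda rho = 0.
Proof.
rewrite /pansu_profile mulfV ?gt_eqF// exprVn mulfV ?expf_neq0 ?gt_eqF//.
by rewrite subrr sqrtr0 acos1 mulr0 addr0 mulr0.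
Qed.

(** Derivative of the profile in the variable s = r^2, the one used by [sdiff_radial]; equivalently
    f'(r) = - r^2 / sqrt(rho^2 - r^2). *)
Definition pansu_slope s : R := - (Num.sqrt s / (2 * Num.sqrt (rho ^+ 2 - s))).

Lemma is_derive_pansu_profile s : 0 < s -> s < rho ^+ 2 ->
  is_derive s 1 (fun s => pansu_profile lambda (Num.sqrt s)) (pansu_slope s).
Proof.
move=> s0 sr; set r := Num.sqrt s.
have r0 : 0 < r by rewrite sqrtr_gt0.
have r2 : r ^+ 2 = s by rewrite sqr_sqrtr// ltW.
have rr : r < rho by rewrite -(@ltr_pXn2r _ 2) ?nnegrE ?invr_ge0 ?(ltW r0) ?(ltW l0)// r2.
have /andP[h0 h1] := lr (ltW r0) rr.
have w0 := lr2 (ltW r0) rr.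
pose w := Num.sqrt (1 - lambda ^+ 2 * r ^+ 2).
have wg0 : 0 < w by rewrite sqrtr_gt0.
have w2 : w ^+ 2 = 1 - lambda ^+ 2 * r ^+ 2 by rewrite sqr_sqrtr// ltW.
have lin1 : is_derive r (1 : R) (fun r => lambda * r) lambda.
  by apply: is_derive_eq; rewrite ?scaler1 ?scaler0 ?addr0 ?mulr1.
have dq : is_derive r (1 : R) (fun r => 1 - lambda ^+ 2 * r ^+ 2) (- (2 * lambda ^+ 2 * r)).
  apply: is_derive_eq.
  by rewrite add0r mul1r /GRing.scale/= mulr1; ring.
have dw := @is_derive1_comp _ Num.sqrt (fun r => 1 - lambda ^+ 2 * r ^+ 2) _ _ _ (is_derive1_sqrt w0) dq.
have hm1 : -1 < lambda * r < 1 by rewrite h1 andbT (lt_le_trans _ h0)// ltrN10.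
have da := @is_derive1_comp _ acos (fun r => lambda * r) _ _ _ (is_derive1_acos hm1) lin1.
have dp := is_deriveM lin1 dw.
have ds := is_deriveD dp da.
have dt := is_deriveZ (2 * lambda ^+ 2)^-1 ds.
have := @is_derive1_comp _ (pansu_profile lambda) Num.sqrt s _ _ dt (is_derive1_sqrt s0).
congr is_derive; rewrite /GRing.scale/= -/r -/w.
have -> : Num.sqrt (1 - (lambda * r) ^+ 2) = w by rewrite exprMn.
have -> : pansu_slope s = - (lambda * r / (2 * w)).
  rewrite /pansu_slope -/r.
  have -> : Num.sqrt (rho ^+ 2 - s) = w / lambda.
    rewrite -[RHS]ger0_norm ?divr_ge0 ?ltW// -sqrtr_sqr; congr Num.sqrt.
    by rewrite expr_div_n w2 r2; field; rewrite gt_eqF.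
  by field; rewrite !gt_eqF.
have ww : w * w = 1 - lambda ^+ 2 * r ^+ 2 by rewrite -expr2.
transitivity ((2 * lambda ^+ 2)^-1 * ((w * w - lambda ^+ 2 * r ^+ 2 - 1) * lambda / w) / (2 * r)).
  by field; rewrite !gt_eqF.
rewrite ww; field; rewrite !gt_eqF//.
Qed.

Lemma pansu_slope_continuous s : s < rho ^+ 2 -> {for s, continuous pansu_slope}.
Proof.
move=> sr; apply: cvgN; apply: cvgM; first exact: sqrt_continuous.
apply: cvgV; first by rewrite mulf_neq0// gt_eqF// sqrtr_gt0 subr_gt0.
apply: cvgM; first exact: cvg_cst.
apply: (@continuous_comp _ _ _ (fun s => rho ^+ 2 - s) Num.sqrt); last exact: sqrt_continuous.
by apply: cvgB; [exact: cvg_cst|exact: cvg_id].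
Qed.

End pansu_profile.

Section null_sets.
Import HBNNSimple.
Context d (T : measurableType d) (R : realType).
Local Open Scope ereal_scope.

(* No measurability of [f] is required, in contrast with
   [ge0_negligible_integral]. *)
Lemma ge0_integral_setD_null (mu : {measure set T -> \bar R}) (D N : set T) (f : T -> \bar R) :
  measurable N -> mu N = 0 -> (forall x, 0 <= f x) ->
  \int[mu]_(x in D) f x = \int[mu]_(x in D `\` N) f x.
Proof.
move=> mN N0 f0; have p0 A x : 0 <= (f \_ A) x by rewrite patchE; case: ifPn.
have mCN : measurable (~` N) by exact: measurableC.
rewrite integral_mkcond [RHS]integral_mkcond !ge0_integralTE//.
apply/eqP; rewrite eq_le; apply/andP; split; apply: ub_ereal_sup => _ [h hf <-].
  (* The integral is a supremum over simple functions, so it suffices to cut each of these off on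
     [N], which does not change its integral; [f] itself is left alone. *)
  have pE x : proj_nnsfun h mCN x = (h \_ (~` N)) x by rewrite (mrestrict h mCN).
  have -> : sintegral mu h = sintegral mu (proj_nnsfun h mCN).
    rewrite -!integralT_nnsfun (ge0_negligible_integral mN)//; last 2 first.
    - exact/measurable_EFinP.
    - by move=> x _; rewrite lee_fin.
    rewrite setTD integral_mkcond; apply: eq_integral => x _.
    apply: eq_trans (congr1 (@EFin R) (esym (pE x))).
    by rewrite !patchE; case: ifPn.
  apply: ereal_sup_ubound; exists (proj_nnsfun h mCN) => // x /=.
  have := hf x; rewrite (_ : (proj_nnsfun h mCN x)%:E = ((h \_ (~` N)) x)%:E) ?pE// !patchE.
  rewrite in_setD; case: ifPn => xD; case: ifPn => xN //; rewrite in_setC in xN.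
    by rewrite xN.
  by rewrite (negbTE xN).
apply: ereal_sup_ubound; exists h => // x; apply: le_trans (hf x) _.
by rewrite !patchE in_setD; case: (x \in D) => //=; case: ifPn.
Qed.

End null_sets.

(** * The two open sheets of the Pansu sphere *)

Section pansu_geometry.
Variables (R : realType) (n' : nat) (lambda : R).
Hypothesis l0 : 0 < lambda.
Local Notation n := n'.+1.
Local Notation N := (n + n)%N.
Local Notation m' := (n' + n)%N.
Local Notation rho := (lambda^-1).
Local Notation zi := (zi n).
Local Notation pr q := (col' zi q : 'rV[R]_N).
Implicit Types (p q : 'rV[R]_N.+1) (u v : 'rV[R]_N).
Let P : set 'rV[R]_N.+1 := pansu lambda.

Let r0 : 0 < rho. Proof. by rewrite invr_gt0. Qed.

Lemma radiusE p : Defs.radius p = enorm (pr p).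
Proof.
rewrite /Defs.radius /enorm edot_split; congr Num.sqrt; apply: eq_bigr => j _.
by rewrite xiE yiE !mxE !expr2.
Qed.

(** Leaves out the centre, above which the poles lie, and the boundary, where the slope is
    infinite. *)
Definition annulus : set 'rV[R]_N := [set u : 'rV[R]_N | 0 < enorm u < rho].

Lemma open_annulus : open annulus.
Proof.
apply/open_eballP => u /andP[u0 ur].
exists (Num.min (enorm u) (rho - enorm u)); first by rewrite lt_min u0 subr_gt0.
move=> v; rewrite /eball/= lt_min => /andP[v1 v2].
have := ler_enorm_dist u v; have := ler_enorm_dist v u; rewrite (enormBC u v) => h1 h2.
by rewrite /annulus/=; apply/andP; split; lra.
Qed.

Section sheet.
Variable sg : R.
Hypothesis sg1 : sg ^+ 2 = 1.

(** The sign [sg] is 1 on the upper sheet and -1 on the lower one. *)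
Definition sheet_fun u : R := sg * pansu_profile lambda (enorm u).
Definition sheet_grad u : 'rV[R]_N := (sg * (2 * pansu_slope lambda (edot u u))) *: u.

Let a_sq u : annulus u -> 0 < edot u u < rho ^+ 2.
Proof.
move=> /andP[u0 ur]; rewrite -sqr_enorm exprn_gt0//=.
by rewrite ltr_pXn2r// nnegrE ltW.
Qed.

Lemma sheet_sdiff u : annulus u -> sdiff sheet_fun u (sheet_grad u).
Proof.
move=> /a_sq/andP[u0 ur]; rewrite /sheet_grad mulrCA.
pose F s := sg * pansu_profile lambda (Num.sqrt s).
pose F' s := sg * pansu_slope lambda s.
have e0 : 0 < Num.min (edot u u) (rho ^+ 2 - edot u u) by rewrite lt_min u0 subr_gt0.
apply: (@sdiff_radial _ _ F F' u _ e0).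
  move=> s; rewrite lt_min !ltr_norml => /andP[/andP[s1 _] /andP[_ s2]].
  have s0 : 0 < s by lra.
  have sr : s < rho ^+ 2 by lra.
  exact: is_deriveZ (is_derive_pansu_profile l0 s0 sr).
apply: cvgM; first exact: cvg_cst.
exact: pansu_slope_continuous.
Qed.

Let U : set 'rV[R]_N.+1 := [set p : 'rV[R]_N.+1 | 0 < sg * p 0 zi /\ annulus (pr p)].

Let oU : open U.
Proof.
apply/open_eballP => p [p0 pa].
have [e e0 eP] := (open_eballP annulus).1 open_annulus _ pa.
have sg_norm : `|sg| = 1.
  by apply/eqP; rewrite -(@eqrXn2 _ 2)// real_normK ?num_real// sg1 expr1n.
exists (Num.min e (sg * p 0 zi)); first by rewrite lt_min e0.
move=> q; rewrite /eball/= lt_min => /andP[q1 q2]; split.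
  have := le_lt_trans (coord_le_enorm (q - p) zi) q2; rewrite row_subE => h.
  have : `|sg * (q 0 zi - p 0 zi)| < sg * p 0 zi by rewrite normrM sg_norm mul1r.
  by rewrite mulrBr ltr_norml => /andP[]; lra.
by apply: eP; rewrite /eball/= -col'B (le_lt_trans (enorm_col' zi _)).
Qed.

Lemma pansuI : P `&` U = [set q : 'rV[R]_N.+1 | annulus (pr q) /\ q 0 zi = sheet_fun (pr q)].
Proof.
have sgE : sg = 1 \/ sg = -1.
  have : (sg == 1) || (sg == -1) by rewrite -eqf_sqr expr1n sg1.
  by case/orP => /eqP; [left|right].
apply/seteqP; split => [p [[]]|p [pa pz]].
  rewrite radiusE => _ pz [p0 pa]; split => //.
  have := pansu_profile_gt0 l0 (elimT andP pa).1 (elimT andP pa).2.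
  move: p0; rewrite /sheet_fun.
  by case: sgE pz => -> [] ->; rewrite ?mul1r ?mulN1r ?opprK// => h1 h2; lra.
have h := pansu_profile_gt0 l0 (elimT andP pa).1 (elimT andP pa).2.
split; last first.
  by split => //; rewrite pz /sheet_fun mulrA -expr2 sg1 mul1r.
rewrite /P /pansu/= radiusE; split; first by have /andP[_ /ltW] := pa.
by rewrite pz /sheet_fun; case: sgE => ->; [left|right]; rewrite ?mul1r ?mulN1r.
Qed.

Definition sheet : set 'rV[R]_N.+1 := gr zi sheet_fun @` annulus.

Lemma sheetE : sheet = P `&` U.
Proof.
rewrite pansuI; apply/seteqP; split => [_ [u ua <-]|q [qa qz]].
  by rewrite /= /gr col'_emb emb_id.
by exists (pr q) => //; rewrite /gr -qz emb_col'.
Qed.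

Lemma sheet_normal p : sheet p ->
  normal_at P p ((jac (sheet_grad (pr p)))^-1 *: emb zi (- sheet_grad (pr p)) 1).
Proof.
rewrite sheetE => -[Pp Up]; have pa : annulus (pr p) by case: Up.
exact: (tangent_graph_normal oU Up Pp open_annulus pansuI (sheet_sdiff pa)).
Qed.

(** Up to the factor [- (jac _)^-1], the horizontal part of the unit normal above [u]. The area
    factor of the chart will cancel that of the normalisation. *)
Definition sheet_hor u : 'rV[R]_N := sheet_grad u + Jrot u.

Lemma hor_sheet u : annulus u ->
  @hor R n (gr zi sheet_fun u) ((jac (sheet_grad u))^-1 *: emb zi (- sheet_grad u) 1) =
  - (jac (sheet_grad u))^-1 *: sheet_hor u.
Proof.
move=> ua; rewrite /hor col'Z !col'_emb row_scaleE emb_id mulr1.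
by rewrite /sheet_hor scalerDr !scaleNr scalerN.
Qed.

End sheet.
End pansu_geometry.

Lemma measurable_Jrot (R : realType) n : measurable_fun setT (@Jrot R n).
Proof.
apply: measurable_fun_rV => j; case: (split_ordP j) => k ->.
  by under eq_fun do rewrite Jrot_l; apply: measurableT_comp => //; exact: measurable_coord.
by under eq_fun do rewrite Jrot_r; exact: measurable_coord.
Qed.

Section sheet_integrals.
Variables (R : realType) (n' : nat) (lambda : R).
Hypothesis l0 : 0 < lambda.
Local Notation n := n'.+1.
Local Notation N := (n + n)%N.
Local Notation m' := (n' + n)%N.
Local Notation rho := (lambda^-1).
Local Notation zi := (zi n).
Local Notation pr q := (col' zi q : 'rV[R]_N).
Local Notation V := (@annulus R n' lambda).
Implicit Types (p q : 'rV[R]_N.+1) (u v w : 'rV[R]_N).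
Variable sg : R.
Hypothesis sg1 : sg ^+ 2 = 1.
Local Notation g := (@sheet_fun R n' lambda sg).
Local Notation a := (@sheet_grad R n' lambda sg).
Local Notation G := (@sheet_hor R n' lambda sg).
Local Notation S := (@sheet R n' lambda sg).
Local Notation hm := (@hmeasure R N N.+1).

Let r0 : 0 < rho. Proof. by rewrite invr_gt0. Qed.

Lemma measurable_annulus : measurable V.
Proof. by apply: measurable_open; exact: open_annulus. Qed.

Let ga u : V u -> sdiff g u (a u). Proof. exact: sheet_sdiff. Qed.

Lemma measurable_sheet_hor : measurable_fun V G.
Proof.
apply: measurable_addrV; last by apply: measurable_funTS; exact: measurable_Jrot.
exact: (measurable_grad (m := N) (@open_annulus R n' lambda) ga).
Qed.

Lemma measurable_sheet : measurable S.
Proof.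
exact: (@measurable_gr_image R m' zi V g a (@open_annulus R n' lambda) ga _ measurable_annulus).
Qed.

(** [Jrot u] is orthogonal to [u], so with r = |u| the squared length is r^2 (r^2 / (rho^2 - r^2)) +
    r^2 = r^2 rho^2 / (rho^2 - r^2). The ratio is the area factor of a Euclidean hemisphere of
    radius [rho]. *)
Lemma enorm_sheet_hor u : V u ->
  enorm (G u) / enorm u = rho / Num.sqrt (rho ^+ 2 - edot u u).
Proof.
move=> /andP[u0 ur].
have s0 : 0 < rho ^+ 2 - edot u u.
  by rewrite subr_gt0 -sqr_enorm ltr_pXn2r// nnegrE ltW.
set w := Num.sqrt _; have w0 : 0 < w by rewrite sqrtr_gt0.
have ww : w ^+ 2 = rho ^+ 2 - enorm u ^+ 2 by rewrite sqr_sqrtr ?ltW// sqr_enorm.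
suff -> : enorm (G u) = enorm u * (rho / w) by rewrite mulrAC divff ?mul1r// gt_eqF.
have rw0 : 0 <= enorm u * (rho / w) by rewrite mulr_ge0 ?enorm_ge0// ltW// divr_gt0.
apply/eqP; rewrite -(@eqrXn2 _ 2)// ?enorm_ge0//.
rewrite sqr_enorm /sheet_hor edotDl !edotDr edot_Jrot /sheet_grad !edotZl !edotZr.
rewrite edot_Jrotxx (edotC u (Jrot u)) edot_Jrotxx !mulr0 addr0 add0r /pansu_slope -/w.
have uu : edot u u = enorm u ^+ 2 by rewrite sqr_enorm.
rewrite uu sqrtr_sqr ger0_norm ?enorm_ge0//.
set r := enorm u in u0 ur ww *.
have w2 : rho ^+ 2 = w ^+ 2 + r ^+ 2 by rewrite ww subrK.
apply/eqP; transitivity (sg ^+ 2 * (r ^+ 2 / w ^+ 2) * r ^+ 2 + r ^+ 2).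
  by field; rewrite gt_eqF.
by rewrite sg1 exprMn expr_div_n w2; field; rewrite gt_eqF.
Qed.

Local Open Scope ereal_scope.
(** The integral of |<q, w>| over a Euclidean hemisphere of radius [rho], for a unit vector [w]. *)
Definition sheet_const : \bar R := rho%:E * leb R N (eball 0%R rho).

Lemma integral_sheet_edot w :
  \int[leb R N]_(u in V) `|edot (G u) w|%:E = (enorm w)%:E * sheet_const.
Proof.
have mV := measurable_annulus.
have mh : measurable_fun V (fun u => rho / Num.sqrt (rho ^+ 2 - edot u u))%R.
  apply: measurable_funS (measurable_hemisphere_jac (m' := m') ord0 r0) => //.
    exact: measurable_eball.
  by move=> u /andP[_]; rewrite enorm_eball.
pose al r : R := (sg * (2 * pansu_slope lambda (r ^+ 2)))%R.
have GE u : G u = (al (enorm u) *: u + Jrot u)%R.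
  by rewrite /sheet_hor /sheet_grad /al sqr_enorm.
have mG := measurable_sheet_hor.
have key := @integral_twisted R m' (@Jrot R n) (@JrotB R n) (@JrotZ R n) (@edot_Jrot R n)
  (@Jrot2 R n) (@measurable_Jrot R n) V al mV _ _ sheet_const.
under eq_integral do rewrite GE.
apply: key.
- by move=> u v uv; rewrite /annulus/= uv.
- by apply: eq_measurable_fun mG => u _; rewrite GE.
- move=> {}w; rewrite /sheet_const -(@integral_ball_radial R m' rho w r0).
  rewrite integral_mkcond [RHS]integral_mkcond; apply: eq_integral => u _.
  rewrite !patchE.
  (* The annulus misses only the origin of the ball, where the field vanishes. *)
  have -> : (u \in V) = (u != 0%R) && (u \in eball 0%R rho).
    apply/idP/andP => [/set_mem/andP[u0 ur]|[u0 /set_mem ur]].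
      by rewrite -enorm_gt0 u0; split => //; apply: mem_set; rewrite enorm_eball.
    apply: mem_set; rewrite /annulus/= enorm_gt0 u0/=.
    by move: ur; rewrite enorm_eball.
  have [->|u0] := eqVneq u 0%R; first by rewrite /= scaler0 edot0l normr0; case: ifPn.
  rewrite /=; case: ifPn => // /set_mem; rewrite enorm_eball => ur.
  by rewrite -GE enorm_sheet_hor// /annulus/= enorm_gt0 u0.
- apply: (eq_measurable_fun (fun u => (rho / Num.sqrt (rho ^+ 2 - edot u u)) *: u)%R).
    by move=> u /set_mem uV; rewrite -GE enorm_sheet_hor.
  by apply: measurable_scalerV => //; exact: measurable_id.
- by rewrite mule_ge0// lee_fin ltW.
Qed.

Lemma average_sheet :
  ball_norm R m' * sheet_const = ball_coord R m' * \int[leb R N]_(u in V) (enorm (G u))%:E.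
Proof.
apply: (@average_edot R m' _ _ (leb R N) V G sheet_const).
- by rewrite mule_ge0// lee_fin ltW.
- exact: measurable_annulus.
- exact: measurable_sheet_hor.
- exact: integral_sheet_edot.
Qed.

(** On the sheet this is [hor] of the unit normal, that is, p-normal times density. *)
Definition sheet_cov p : 'rV[R]_N := (- (jac (a (pr p)))^-1 *: G (pr p))%R.

Lemma measurable_sheet_cov : measurable_fun S sheet_cov.
Proof.
apply: (@measurable_comp _ _ _ _ _ _ V (fun u => - (jac (a u))^-1 *: G u)%R S (fun p => pr p)).
- exact: measurable_annulus.
- by move=> _ [_ [u Vu <-] <-]; rewrite /gr col'_emb.
- apply: measurable_scalerV; last exact: measurable_sheet_hor.
  have mj := @measurable_jac R m' zi V g a (@open_annulus R n' lambda) ga.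
  apply: (eq_measurable_fun (fun u => - (jac (a u) `^ (-1)))%R).
    by move=> u _; rewrite powR_inv1// ltW// jac_gt0.
  by apply: measurable_funN; exact: (measurableT_comp (measurable_powR (-1)%R) mj).
exact: measurable_funTS (measurable_col' zi).
Qed.

Lemma integral_sheet Phi : measurable_fun S Phi -> (forall p, 0 <= Phi p) ->
  \int[hm]_(p in S) Phi p = \int[leb R N]_(u in V) (Phi (gr zi g u) * (jac (a u))%:E).
Proof.
exact: (@area_formula R m' zi V g a (@open_annulus R n' lambda) ga Phi).
Qed.

End sheet_integrals.

Lemma measurable_rV_set1 (R : realType) k (x : 'rV[R]_k) : measurable [set x].
Proof.
have mf : measurable_fun setT (fun q : 'rV[R]_k => enorm (q - x)).
  apply: measurable_enorm; apply: measurable_addrV; first exact: measurable_id.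
  exact: measurable_cst.
have := mf measurableT _ (measurable_set1 0%R); rewrite setTI; congr measurable.
apply/seteqP; split => q /=; last by move=> ->; rewrite subrr enorm0.
by move=> /eqP; rewrite enorm_eq0 subr_eq0 => /eqP.
Qed.

Section pansu_integrals.
Variables (R : realType) (n' : nat) (lambda : R).
Hypothesis l0 : 0 < lambda.
Local Notation n := n'.+1.
Local Notation N := (n + n)%N.
Local Notation m' := (n' + n)%N.
Local Notation rho := (lambda^-1).
Local Notation zi := (zi n).
Local Notation pr q := (col' zi q : 'rV[R]_N).
Local Notation V := (@annulus R n' lambda).
Local Notation S := (@sheet R n' lambda).
Local Notation G := (@sheet_hor R n' lambda).
Local Notation cov := (@sheet_cov R n' lambda).
Local Notation hm := (@hmeasure R N N.+1).
Local Notation P := (@pansu R n lambda).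
Local Notation K := (@sheet_const R n' lambda).
Implicit Types (p q : 'rV[R]_N.+1) (u v w : 'rV[R]_N).
Local Open Scope ereal_scope.

Let sheet_covE sg u :
  cov sg (gr zi (@sheet_fun R n' lambda sg) u) =
  (- (jac (@sheet_grad R n' lambda sg u))^-1 *: G sg u)%R.
Proof. by rewrite /sheet_cov /gr col'_emb. Qed.

Lemma integral_sheet_cov sg : (sg ^+ 2 = 1)%R ->
  \int[hm]_(p in S sg) (enorm (cov sg p))%:E = \int[leb R N]_(u in V) (enorm (G sg u))%:E.
Proof.
move=> sg1; rewrite (integral_sheet l0); last 2 first.
- by apply/measurable_EFinP/measurable_enorm; exact: measurable_sheet_cov.
- by move=> p; rewrite lee_fin enorm_ge0.
apply: eq_integral => u _; rewrite sheet_covE enormZ normrN gtr0_norm ?invr_gt0 ?jac_gt0//.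
by rewrite -EFinM mulrAC mulVf ?mul1r// gt_eqF// jac_gt0.
Qed.

Lemma integral_sheet_tonelli sg d (T : measurableType d)
    (nu : {sigma_finite_measure set T -> \bar R}) (E : set T) (H : T -> 'rV[R]_N) :
  (sg ^+ 2 = 1)%R -> measurable E -> measurable_fun E H ->
  \int[hm]_(p in S sg) \int[nu]_(y in E) `|edot (cov sg p) (H y)|%:E =
  K * \int[nu]_(y in E) (enorm (H y))%:E.
Proof.
move=> sg1 mE mH; have mV := @measurable_annulus R n' lambda.
have mS := @measurable_sheet R n' lambda l0 sg.
have mc := @measurable_sheet_cov R n' lambda l0 sg.
have mG := @measurable_sheet_hor R n' lambda l0 sg.
have mabs (w : 'rV[R]_N) : measurable_fun E (fun y => `|edot w (H y)|%:E).
  under eq_fun do rewrite edotC; exact: measurable_abs_edot.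
rewrite (integral_sheet l0); last 2 first.
- exact: measurable_integral_edot.
- by move=> p; apply: integral_ge0.
transitivity (\int[leb R N]_(u in V) \int[nu]_(y in E) `|edot (G sg u) (H y)|%:E).
  apply: eq_integral => u _; rewrite -ge0_integralZr//; last by rewrite lee_fin ltW// jac_gt0.
  have j0 : (0 < (jac (@sheet_grad R n' lambda sg u))^-1)%R by rewrite invr_gt0 jac_gt0.
  apply: eq_integral => y _; rewrite sheet_covE edotZl normrM normrN (gtr0_norm j0).
  by rewrite -EFinM mulrAC mulVf ?mul1r// gt_eqF// jac_gt0.
rewrite (tonelli_edot (leb R N) nu mV mE mG mH) -ge0_integralZl//; last 3 first.
- by apply/measurable_EFinP; exact: measurable_enorm.
- by move=> y _; rewrite lee_fin enorm_ge0.
- by rewrite mule_ge0// lee_fin invr_ge0 ltW.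
by apply: eq_integral => y _; rewrite (integral_sheet_edot l0 sg1) muleC.
Qed.

Let one_sqr : (1 ^+ 2 = 1 :> R)%R. Proof. by rewrite expr1n. Qed.
Let opp_sqr : ((-1) ^+ 2 = 1 :> R)%R. Proof. by rewrite sqrrN expr1n. Qed.

Let pole (c : R) : set 'rV[R]_N.+1 := [set emb zi 0%R c].

Let measurable_pole c : measurable (pole c).
Proof.
exact: measurable_rV_set1.
Qed.

(** A point is isometric to a point of the unit sphere of R^(2n), which is a null set. *)
Let pole_null c : hm (pole c) = 0.
Proof.
pose e : 'rV[R]_m'.+1 := 'e_ord0.
have e1 : sphere 1%R e by rewrite /sphere/= /enorm edot_delta mxE !eqxx sqrtr1.
apply/eqP; rewrite eq_le measure_ge0 andbT.
rewrite -(@leb_sphere R m' 1%R ltr01) -hmeasure_leb; last exact: measurable_sphere.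
have -> : hm (pole c) = hmeasure m'.+1 [set e].
  rewrite /pole -(image_set1 (fun _ : unit => emb zi 0%R c) tt) -(image_set1 (fun _ : unit => e) tt).
  by apply: hmeasure_isometry => x y _ _; rewrite !subrr !enorm0.
apply: le_measure; rewrite ?inE.
- exact: measurable_rV_set1.
- exact: measurable_sphere.
- by move=> _ ->.
Qed.

Let c0 : R := pansu_profile lambda 0.
Let nul : set 'rV[R]_N.+1 := cap_sphere rho zi [set 0%R] `|` (pole c0 `|` pole (- c0)%R).

Let measurable_nul : measurable nul.
Proof.
apply: measurableU; last by apply: measurableU; exact: measurable_pole.
by apply: (@measurable_cap_sphere R m'); exact: measurable_set1.
Qed.

Let nul_null : hm nul = 0.
Proof.
have r0 : (0 < rho)%R by rewrite invr_gt0.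
have mp := measurable_pole.
have p0 : hm (pole c0 `|` pole (- c0)%R) = 0.
  exact: (eq_trans (measureU0 (mp c0) (mp (- c0)%R) (pole_null _)) (pole_null c0)).
have mcap : measurable (cap_sphere rho zi [set 0%R]).
  by apply: (@measurable_cap_sphere R m'); exact: measurable_set1.
apply: (eq_trans (measureU0 mcap (measurableU _ _ (mp c0) (mp (- c0)%R)) p0)).
exact: (@equator_null R m').
Qed.

(** The profile vanishes exactly where the two graphs meet, at the equator, and only the two poles
    lie above the centre; elsewhere the sign of the height tells the sheets apart. *)
Let pansuD : P `\` nul = S 1%R `|` S (-1)%R.
Proof.
rewrite (sheetE n' l0 one_sqr) (sheetE n' l0 opp_sqr); apply/seteqP; split.
  move=> p [Pp Np]; have [pr1 pz] := Pp; rewrite radiusE in pr1 pz.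
  have pE : (enorm p ^+ 2 = enorm (pr p) ^+ 2 + p 0%R zi ^+ 2)%R.
    by rewrite -[in LHS](emb_col' zi p) sqr_enorm_emb.
  have r_lt : (enorm (pr p) < rho)%R.
    rewrite lt_neqAle pr1 andbT; apply/eqP => pr2; apply: Np; left.
    rewrite pr2 pansu_profile_rho// oppr0 in pz.
    have pz0 : (p 0 zi = 0)%R by case: pz.
    split; last by rewrite /= pz0.
    by apply/eqP; rewrite -(@eqrXn2 _ 2)// ?enorm_ge0 ?invr_ge0 ?(ltW l0)// pE pz0 expr0n addr0 pr2.
  have r_gt : (0 < enorm (pr p))%R.
    rewrite enorm_gt0; apply/eqP => pr2; apply: Np; right.
    rewrite pr2 enorm0 -/c0 in pz.
    by rewrite /pole/= -(emb_col' zi p) pr2; case: pz => ->; [left|right].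
  have pa : annulus lambda (pr p) by rewrite /annulus/= r_gt.
  have h := pansu_profile_gt0 l0 r_gt r_lt.
  case: pz => pz; [left|right]; split => //; split => //.
    by rewrite mul1r pz.
  by rewrite pz mulrNN mul1r.
have nN sg p : (0 < sg * p 0%R zi)%R -> annulus lambda (pr p) -> ~ nul p.
  move=> p0 /andP[u0 _] [[_ /= pz]|[|]].
  - by rewrite pz mulr0 ltxx in p0.
  - by move=> pE; rewrite pE col'_emb enorm0 ltxx in u0.
  - by move=> pE; rewrite pE col'_emb enorm0 ltxx in u0.
by move=> p [] [Pp [p0 pa]]; split => //; exact: nN p0 pa.
Qed.

(** Measurability is asked on the sheets only, because in the applications nothing is known of [Phi]
    on the null set that is removed. *)
Lemma integral_pansu Phi : (forall p, 0 <= Phi p) ->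
  measurable_fun (S 1%R) Phi -> measurable_fun (S (-1)%R) Phi ->
  \int[hm]_(p in P) Phi p = \int[hm]_(p in S 1%R) Phi p + \int[hm]_(p in S (-1)%R) Phi p.
Proof.
move=> Phi0 m1 m2; have mS1 := @measurable_sheet R n' lambda l0 1%R; have mS2 := @measurable_sheet R n' lambda l0 (-1)%R.
rewrite (ge0_integral_setD_null P measurable_nul nul_null Phi0) pansuD ge0_integral_setU//.
  exact/measurable_funU.
apply/disj_setPS => p []; rewrite (sheetE n' l0 one_sqr) (sheetE n' l0 opp_sqr).
by move=> [_ [p1 _]] [_ [p2 _]]; move: p1 p2; rewrite mul1r mulN1r; lra.
Qed.

End pansu_integrals.

(** * Projected p-areas *)

Section parea_integrals.
Variables (R : realType) (n : nat).
Hypothesis n0 : (0 < n)%N.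
Local Notation zi := (zi n).
Local Notation pr q := (col' zi q : 'rV[R]_(n + n)).
Local Notation hm := (@hmeasure R (n + n) (n + n).+1).
Implicit Types (S : set 'rV[R]_(n + n).+1) (nu : 'rV[R]_(n + n).+1 -> 'rV[R]_(n + n).+1).

Let surfaceE : @surface_measure R (n + n) (n + n).+1 = hm.
Proof. by rewrite -hmeasureE// addn_gt0 n0. Qed.

Lemma pareaE S nu : (forall q, S q -> normal_at S q (nu q)) ->
  parea S = (\int[hm]_(q in S) (enorm (hor q (nu q)))%:E)%E.
Proof.
move=> Snu; rewrite /parea /pintegral surfaceE; apply: eq_integral => q /set_mem Sq.
by have [nu1 nuT] := Snu q Sq; rewrite mul1e (parea_densityE nu1 nuT).
Qed.

(** The density absorbs the normalisation of [pnormal], so the integrand becomes a pairing of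
    measurable vector fields and singular points contribute 0. *)
Lemma projected_pareaE S nu p v : (forall q, S q -> normal_at S q (nu q)) ->
  projected_parea S p v = (\int[hm]_(q in S) `|edot (pr v) (hor q (nu q))|%:E)%E.
Proof.
move=> Snu; rewrite /projected_parea /pintegral surfaceE; apply: eq_integral => q /set_mem Sq.
have [nu1 nuT] := Snu q Sq.
by rewrite (parea_densityE nu1 nuT) -EFinM (levi_pnormalE nuT) push_pr.
Qed.

Lemma measurable_hor S nu : measurable_fun S nu -> measurable_fun S (fun q => hor q (nu q)).
Proof.
move=> mnu; apply: measurable_addrV.
  exact: (measurableT_comp (measurable_col' zi) mnu).
rewrite (_ : (fun q => - _) = fun q => (- nu q 0 zi) *: Jrot (pr q)); last first.
  by apply/funext => q; rewrite scaleNr.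
apply: measurable_scalerV.
  by apply: measurable_funN; exact: measurable_coord_comp.
apply: measurable_funTS; apply: (measurableT_comp (@measurable_Jrot R n)).
exact: measurable_col'.
Qed.

End parea_integrals.

(** * The p-area of the Pansu sphere and the total projected p-area *)

Section total_integral.
Variables (R : realType) (n' : nat) (lambda : R).
Hypothesis l0 : 0 < lambda.
Local Notation n := n'.+1.
Local Notation N := (n + n)%N.
Local Notation m' := (n' + n)%N.
Local Notation zi := (zi n).
Local Notation pr q := (col' zi q : 'rV[R]_N).
Local Notation S := (@sheet R n' lambda).
Local Notation cov := (@sheet_cov R n' lambda).
Local Notation hm := (@hmeasure R N N.+1).
Local Notation P := (@pansu R n lambda).
Local Notation K := (@sheet_const R n' lambda).
Local Open Scope ereal_scope.

Let one_sqr : (1 ^+ 2 = 1 :> R)%R. Proof. by rewrite expr1n. Qed.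
Let opp_sqr : ((-1) ^+ 2 = 1 :> R)%R. Proof. by rewrite sqrrN expr1n. Qed.

Let sheet_density sg p : (sg ^+ 2 = 1)%R -> S sg p ->
  parea_density P p = enorm (cov sg p) /\
  forall y, (`|edot (pr (pnormal P p)) y| * parea_density P p = `|edot (cov sg p) y|)%R.
Proof.
move=> sg1 Sp; have [nu1 nuT] := sheet_normal l0 sg1 Sp.
have pE : cov sg p = @hor R n p
    ((jac (@sheet_grad R n' lambda sg (pr p)))^-1 *: emb zi (- @sheet_grad R n' lambda sg (pr p)) 1)%R.
  have [u ua up] := Sp; have pu : pr p = u by rewrite -up /gr col'_emb.
  by rewrite /sheet_cov pu -up; exact: esym (hor_sheet _ ua).
rewrite pE; split; first exact: (@parea_densityE R n).
move=> y; rewrite (@parea_densityE R n _ _ _ nu1 nuT) edotC.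
(* Any vector with horizontal part [y] would do; [emb zi y 0] is one. *)
have := @levi_pnormalE R n _ _ _ nuT (emb zi y 0%R); rewrite leviE col'_emb => ->.
by rewrite edotC.
Qed.

Lemma parea_pansu :
  ball_coord R m' * parea P = 2%:E * (ball_norm R m' * K).
Proof.
have -> : parea P = \int[hm]_(p in P) (parea_density P p)%:E.
  rewrite /parea /pintegral -hmeasureE//; apply: eq_integral => p _.
  by rewrite mul1e.
have Phi0 p : 0 <= (parea_density P p)%:E by rewrite lee_fin sqrtr_ge0.
have mPhi sg : (sg ^+ 2 = 1)%R -> measurable_fun (S sg) (fun p => (parea_density P p)%:E).
  move=> sg1; apply: (eq_measurable_fun (fun p => (enorm (cov sg p))%:E)).
    by move=> p /set_mem Sp; rewrite (sheet_density sg1 Sp).1.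
  by apply/measurable_EFinP/measurable_enorm; exact: measurable_sheet_cov.
have IPhi sg : (sg ^+ 2 = 1)%R ->
    ball_coord R m' * \int[hm]_(p in S sg) (parea_density P p)%:E = ball_norm R m' * K.
  move=> sg1; rewrite (average_sheet n' l0 sg1) -(integral_sheet_cov n' l0 sg1); congr (_ * _).
  by apply: eq_integral => p /set_mem Sp; rewrite (sheet_density sg1 Sp).1.
rewrite (integral_pansu l0 Phi0 (mPhi _ one_sqr) (mPhi _ opp_sqr)).
rewrite ge0_muleDr ?integral_ge0// IPhi// IPhi//.
by rewrite -mule2n mule_natl.
Qed.

(** Each of the two sheets contributes [K] times the p-area, since every horizontal covector of
    [Sigma] integrates to its length times [K]. The restriction [mu] replaces [hm] to make Tonelli
    available. *)
Lemma integral_projected_parea (Sigma : set 'rV[R]_N.+1) :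
  measurable Sigma -> C2_hypersurface Sigma ->
  pintegral P P (fun p => projected_parea Sigma p (pnormal P p)) = 2%:E * K * parea Sigma.
Proof.
move=> mS C2.
have [nu [mnu Snu]] : exists nu : 'rV[R]_N.+1 -> 'rV[R]_N.+1,
    measurable_fun Sigma nu /\ forall q, Sigma q -> normal_at Sigma q (nu q).
  exact: (@C2_hypersurface_normal R m' Sigma mS C2).
have [mu muE] : exists mu : {sigma_finite_measure set 'rV[R]_N.+1 -> \bar R},
    mu = mrestr hm mS :> (set 'rV[R]_N.+1 -> \bar R).
  exact: (sigma_finite_measureW (@C2_hypersurface_sigma_finite R m' Sigma mS C2)).
have mh := measurable_hor mnu.
have muI f : measurable_fun Sigma f -> (forall q, 0 <= f q) ->
    \int[hm]_(q in Sigma) f q = \int[mu]_(q in Sigma) f q.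
  by move=> mf f0; rewrite muE ge0_integral_mrestr.
have mabs (w : 'rV[R]_N) : measurable_fun Sigma (fun q => `|edot w (hor q (nu q))|%:E).
  under eq_fun do rewrite edotC; exact: measurable_abs_edot.
rewrite (pareaE _ Snu)// muI; last 2 first.
- by apply/measurable_EFinP; exact: measurable_enorm.
- by move=> q; rewrite lee_fin enorm_ge0.
rewrite /pintegral -hmeasureE//.
pose Phi p := projected_parea Sigma p (pnormal P p) * (parea_density P p)%:E.
have Phi0 p : 0 <= Phi p.
  rewrite mule_ge0 ?lee_fin ?sqrtr_ge0// (projected_pareaE _ _ _ Snu)//.
  exact: integral_ge0.
have PhiE sg p : (sg ^+ 2 = 1)%R -> S sg p ->
    Phi p = \int[mu]_(q in Sigma) `|edot (cov sg p) (hor q (nu q))|%:E.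
  move=> sg1 Sp; rewrite /Phi (projected_pareaE _ _ _ Snu)// -ge0_integralZr//; last first.
    by rewrite lee_fin sqrtr_ge0.
  under eq_integral do rewrite -EFinM (sheet_density sg1 Sp).2.
  by rewrite muI.
have mPhi sg : (sg ^+ 2 = 1)%R -> measurable_fun (S sg) Phi.
  move=> sg1.
  apply: (eq_measurable_fun (fun p => \int[mu]_(q in Sigma) `|edot (cov sg p) (hor q (nu q))|%:E)).
    by move=> p /set_mem Sp; rewrite (PhiE sg).
  apply: measurable_integral_edot => //; first exact: measurable_sheet.
  exact: measurable_sheet_cov.
have IPhi sg : (sg ^+ 2 = 1)%R ->
    \int[hm]_(p in S sg) Phi p = K * \int[mu]_(q in Sigma) (enorm (hor q (nu q)))%:E.
  move=> sg1; rewrite -(integral_sheet_tonelli l0 mu sg1 mS mh).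
  by apply: eq_integral => p /set_mem Sp; exact: PhiE.
rewrite (integral_pansu l0 Phi0 (mPhi _ one_sqr) (mPhi _ opp_sqr)) !IPhi//.
by rewrite -mule2n -mule_natl muleA.
Qed.

End total_integral.

Lemma hmeasure_unit_sphere (R : realType) k : (0 < k)%N ->
  (ball_coord R k * hmeasure k (@unit_sphere R k) =
   2%:E * ((omega R k)%:E * ball_norm R k))%E.
Proof.
case: k => // k _; rewrite -omegaE; exact: hmeasure_sphere.
Qed.

Lemma volume_unit_ball (R : realType) k : (0 < k)%N ->
  fine (volume (@unit_ball R k)) = omega R k.
Proof.
case: k => // k _; rewrite /omega -leb_cball1 lebE//.
exact: measurable_cball.
Qed.

Lemma ball_coordE (R : realType) k : exists2 c : R, 0 < c & ball_coord R k = c%:E.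
Proof.
exists (fine (ball_coord R k)).
  by rewrite fine_gt0// ball_coord_gt0 (le_lt_trans (ball_coord_le R k) (ball_norm_lty R k)).
by rewrite fineK// ge0_fin_numE ?ltW ?ball_coord_gt0// (le_lt_trans (ball_coord_le R k) (ball_norm_lty R k)).
Qed.

Lemma ball_normE (R : realType) k : exists2 M : R, 0 < M & ball_norm R k = M%:E.
Proof.
have M0 : (0 < ball_norm R k)%E := lt_le_trans (ball_coord_gt0 R k) (ball_coord_le R k).
exists (fine (ball_norm R k)); first by rewrite fine_gt0// M0 ball_norm_lty.
by rewrite fineK// ge0_fin_numE ?ball_norm_lty// ltW.
Qed.

(** A finite product with a positive real excludes infinite values, so [fine] is faithful here. *)
Lemma fine_solve (R : realType) (c b : R) (x : \bar R) : 0 < c -> (c%:E * x = b%:E)%E ->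
  fine x = b / c.
Proof.
move=> c0; case: x => [x| |]; rewrite ?gt0_muley ?gt0_muleNy ?lte_fin// -EFinM => h.
by rewrite -(EFin_inj h)/= mulrAC mulfV ?mul1r// gt_eqF.
Qed.

Theorem theorem2 (R : realType) (n : nat) (lambda : R)
    (Sigma : set 'rV[R]_(n + n).+1)
    (n_ge1 : (1 <= n)%N) (lambda_gt0 : 0 < lambda)
    (Sigma_compact : compact Sigma)
    (Sigma_C2 : C2_hypersurface Sigma)
    (N_ae : pintegral Sigma [set q | Sigma q /\ singular Sigma q] (cst 1%E)
            = 0%E) :
  let P := @pansu R n lambda in
  let omega := fine (volume (@unit_ball R (2 * n).-1)) in
  let S := fine (surface_measure (2 * n).-1 (@unit_sphere R (2 * n).-1)) in
  let total := pintegral P P (fun p => projected_parea Sigma p (pnormal P p)) in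
  parea Sigma = ((1 / (2 * Cn n lambda * omega))%:E * total)%E /\
  parea Sigma = ((S / (2 * omega * fine (parea P)))%:E * total)%E.
Proof.
case: n n_ge1 Sigma Sigma_compact Sigma_C2 N_ae => // n _ Sigma cS C2 _ P om S total.
have mS : measurable Sigma by apply: measurable_closed; apply: compact_closed cS; exact: norm_hausdorff.
have totE : (total = 2%:E * sheet_const n lambda * parea Sigma)%E.
  exact: integral_projected_parea.
have dE : (2 * n.+1).-1 = (n + n.+1)%N by rewrite mul2n -addnn addSn.
have d0 : (0 < n + n.+1)%N by rewrite addnS.
have omE : om = omega R (n + n.+1) by rewrite /om dE volume_unit_ball.
have SE : S = fine (hmeasure (n + n.+1) (@unit_sphere R (n + n.+1))).
  by rewrite /S dE hmeasureE.
have om0 : 0 < om by rewrite omE addnS; exact: omega_gt0.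
have [c c0 cE] := ball_coordE R (n + n.+1).
have [M M0 ME] := ball_normE R (n + n.+1).
(* The geometric constant [rho] times the volume of the ball of radius [rho] in R^(2n) is identified
   with C_n omega_(2n-1). *)
have [k k0 [KE kE]] : exists2 k : R, 0 < k &
    sheet_const n lambda = k%:E /\ k = Cn n.+1 lambda * om.
  exists (Cn n.+1 lambda * om).
    rewrite omE Cn_omega// mulr_gt0 ?exprn_gt0 ?invr_gt0//; exact: omega_gt0.
  split => //; rewrite omE Cn_omega// /sheet_const.
  rewrite (@leb_eball_scale R (n + n.+1)) ?invr_gt0// omegaE -!EFinM.
  by rewrite mulrA -exprS.
have SV : S = 2 * (om * M) / c.
  rewrite SE; apply: fine_solve c0 _.
  by have := hmeasure_unit_sphere R d0; rewrite cE ME omE -!EFinM.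
have PV : fine (parea P) = 2 * (M * k) / c.
  by apply: fine_solve c0 _; have := @parea_pansu R n lambda lambda_gt0; rewrite cE ME KE -!EFinM.
(* As the total equals [2 * k] times the p-area, each formula only has to exhibit the inverse of
   [2 * k]. *)
have cancel (x : R) : x * (2 * k) = 1 -> (parea Sigma = x%:E * total)%E.
  by move=> xk; rewrite totE KE -EFinM muleA -EFinM xk mul1e.
split; apply: cancel.
  by rewrite -mulrA -kE mul1r mulVf// gt_eqF// mulr_gt0.
(* The unknown averages [c] and [M] occur in both [S] and the p-area of [P], and cancel. *)
by rewrite SV PV; field; rewrite !gt_eqF.
Qed.
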